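(* Let $n\ge 7$, $\frac{n+6}{n-6}<p<p_m(n)$, where $$p_m(n)=\begin{cases}+\infty & n\le 30,\\ \dfrac{5n+30-\sqrt{15n^2-60n+190}}{5n-30-\sqrt{15n^2-60n+190}} & n\ge 31.\end{cases}$$ Then there exist real constants $c_{i,j}$ ($0\le i,j\le 2$) and a constant $C(n,p)>0$ independent of $\lambda$ such that, for every smooth solution $u$ of $(-\Delta)^3u=|u|^{p-1}u$ in $\mathbb{R}^n$ and every $x\in\mathbb{R}^n$, the function $$E^c(\lambda,x,u):=E(\lambda,x,u)-\int_{\partial B_1}\Big(\sum_{0\le i,j\le 2}c_{i,j}\lambda^{i+j}\frac{d^iu^\lambda}{d\lambda^i}\frac{d^ju^\lambda}{d\lambda^j}\Big)$$ is nondecreasing in $\lambda>0$, and moreover $$\frac{dE^c(\lambda,x,u)}{d\lambda}\ge C(n,p)\,\lambda^{6\frac{p+1}{p-1}-6-n}\int_{\partial B_\lambda(x)}\Big(\frac{6}{p-1}u+\lambda\partial_ru\Big)^2 .$$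
   Context: $B_1$ is the unit ball of $\mathbb{R}^n$ centered at $0$, $B_\lambda(x)$ the ball of radius $\lambda$ centered at $x$; $\partial_r$ is the radial derivative with respect to the center $x$; $u^\lambda(y)=\lambda^{\frac{6}{p-1}}u(x+\lambda y)$; $\nabla_\theta$ and $\Delta_\theta=\mathrm{div}_\theta\nabla_\theta$ are the gradient and Laplace-Beltrami operator of the unit sphere $\partial B_1$; $\Delta u^\lambda$ is the Euclidean Laplacian of $u^\lambda$ in $y$. Put $k=\frac{6}{p-1}$, $\beta=k(k+4-n)$, and $\delta_1=2(n-1)-4k$, $\delta_2=6k(1+k)-6k(n-1)+(n-1)(n-3)$, $\delta_4=k(k+1)(k+2)(k+3)-2(n-1)k(k+1)(k+2)+(n-1)(n-3)k(k+2)$. Write $f=u^\lambda$ and let $'$ denote $\frac{d}{d\lambda}$ at fixed $y$. The functional $E$ is $$\begin{aligned}E(\lambda,x,u)=&\ \lambda^{6\frac{p+1}{p-1}-n}\Big(\int_{B_\lambda(x)}\tfrac12|\nabla\Delta u|^2-\tfrac1{p+1}\int_{B_\lambda(x)}|u|^{p+1}\Big)\\&+\int_{\partial B_1}\Big\{\tfrac{k+2}{2}(\Delta u^\lambda)^2-\lambda^5f''''f'+2\lambda^5f'''f''-(\delta_1-6)\lambda^4f'''f'-(24-6\delta_1+\delta_2)\lambda^3f''f'\\&\quad-(9\delta_1-3\delta_2-36)\lambda^2(f')^2+(\delta_1-8)\lambda^4(f'')^2+\delta_4\lambda ff'+2\delta_4f^2\\&\quad+2(\Delta_\theta f)^2+\tfrac12\lambda\tfrac{d}{d\lambda}(\Delta_\theta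 f)^2-4(\beta-n+4)|\nabla_\theta f|^2-(\beta-n+4)\lambda\tfrac{d}{d\lambda}|\nabla_\theta f|^2\\&\quad-6\lambda^2|\nabla_\theta f'|^2+\lambda^3\tfrac{d}{d\lambda}|\nabla_\theta f'|^2\Big\}.\end{aligned}$$ *)

(* Defs.v *)
From HB Require Import structures.
From mathcomp Require Import all_boot all_order all_algebra.
From mathcomp Require Import all_classical all_reals all_analysis.

Set Implicit Arguments.
Unset Strict Implicit.
Unset Printing Implicit Defensive.

Import Order.TTheory GRing.Theory Num.Theory.
Import numFieldNormedType.Exports.

Local Open Scope classical_set_scope.
Local Open Scope ring_scope.

(** * Lebesgue measure on R^n

    It is built on [n.-tuple] (which carries the product sigma-algebra) as the
    [n]-fold product of the one-dimensional Lebesgue measure, by transporting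
    [lebesgue_measure \x mu] along [(t, v) |-> t :: v]. *)

Definition tuple_cons (R : realType) (n : nat)
    (tv : measurableTypeR R * n.-tuple (measurableTypeR R)) :
  n.+1.-tuple (measurableTypeR R) := [tuple of tv.1 :: tv.2].

Lemma measurable_tuple_cons (R : realType) (n : nat) :
  measurable_fun [set: measurableTypeR R * n.-tuple (measurableTypeR R)]
    (@tuple_cons R n).
Proof.
exact: (@measurable_cons _ _ _ _ fst n snd measurable_fst measurable_snd).
Qed.

Section lebesgue_step.
Variables (R : realType) (n : nat).
Variable mu : {sigma_finite_measure set (n.-tuple (measurableTypeR R)) -> \bar R}.

Definition lebesgue_step : set (n.+1.-tuple (measurableTypeR R)) -> \bar R :=
  pushforward (lebesgue_measure \x mu)%E (@tuple_cons R n).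

Let step0 : lebesgue_step set0 = 0%E.
Proof. by rewrite /lebesgue_step /pushforward preimage_set0 measure0. Qed.

Let preim_measurable (A : set (n.+1.-tuple (measurableTypeR R))) :
  measurable A -> measurable (@tuple_cons R n @^-1` A).
Proof. by move=> mA; rewrite -[X in measurable X]setTI; exact: measurable_tuple_cons. Qed.

Let step_ge0 A : (0 <= lebesgue_step A)%E.
Proof. by rewrite /lebesgue_step /pushforward; exact: measure_ge0. Qed.

Let step_sigma_additive : semi_sigma_additive lebesgue_step.
Proof.
move=> F mF tF mUF; rewrite /lebesgue_step /pushforward preimage_bigcup.
apply: measure_semi_sigma_additive.
- by move=> i; exact: preim_measurable.
- apply/trivIsetP => /= i j _ _ ij; rewrite -preimage_setI.
  by move/trivIsetP : tF => /(_ _ _ _ _ ij) ->//; rewrite preimage_set0.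
- by rewrite -preimage_bigcup; exact: preim_measurable.
Qed.

HB.instance Definition _ := isMeasure.Build _ _ _
  lebesgue_step step0 step_ge0 step_sigma_additive.

Let step_sigma_finite : sigma_finite setT lebesgue_step.
Proof.
have /sigma_finiteP[A [AT ndA Afin]] := sigma_finiteT (@lebesgue_measure R).
have /sigma_finiteP[B [BT ndB Bfin]] := sigma_finiteT mu.
pose uncons (w : n.+1.-tuple (measurableTypeR R)) :
    measurableTypeR R * n.-tuple (measurableTypeR R) :=
  (tnth w ord0, [tuple of behead w]).
have unconsK tv : uncons (tuple_cons tv) = tv.
  by case: tv => t v; congr pair; apply/val_inj.
have muncons : measurable_fun setT uncons.
  by apply: measurable_fun_pair; [exact: measurable_tnth|exact: measurable_behead].
exists (fun i => uncons @^-1` (A i `*` B i)).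
  apply/esym; rewrite -subTset => w _.
  have [i _ Ai] : (\bigcup_i A i) (uncons w).1 by rewrite -AT.
  have [j _ Bj] : (\bigcup_i B i) (uncons w).2 by rewrite -BT.
  exists (maxn i j) => //; split.
  - by move: Ai; exact/subsetPset/ndA/leq_maxl.
  - by move: Bj; exact/subsetPset/ndB/leq_maxr.
move=> i; have [mA Aoo] := Afin i; have [mB Boo] := Bfin i; split.
  by rewrite -[X in measurable X]setTI; apply: muncons => //; exact: measurableX.
rewrite /lebesgue_step /pushforward -comp_preimage.
rewrite (_ : uncons \o _ = id); last by apply/funext => tv /=; rewrite unconsK.
by rewrite preimage_id product_measure1E// lte_mul_pinfty// ge0_fin_numE.
Qed.

HB.instance Definition _ :=
  @Measure_isSigmaFinite.Build _ _ _ lebesgue_step step_sigma_finite.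

End lebesgue_step.

Fixpoint lebesgue_tuple (R : realType) (n : nat) :
    {sigma_finite_measure set (n.-tuple (measurableTypeR R)) -> \bar R} :=
  match n with
  | 0 => dirac [tuple]
  | n'.+1 => lebesgue_step (lebesgue_tuple R n')
  end.

Definition row_of_tuple (R : realType) (n : nat)
  (t : n.-tuple (measurableTypeR R)) : 'rV[R]_n := \row_i tnth t i.

Definition vol_integral (R : realType) (n : nat) (D : set 'rV[R]_n)
    (g : 'rV[R]_n -> R) : R :=
  Rintegral (lebesgue_tuple R n) (@row_of_tuple R n @^-1` D)
    (g \o @row_of_tuple R n).

(** * Euclidean geometry and calculus on R^n *)

Section calculus.
Variables (R : realType) (n : nat).
Implicit Types (x y v w : 'rV[R]_n) (g u : 'rV[R]_n -> R).

Definition dotp v w : R := \sum_i v 0 i * w 0 i.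

(* The norm [`|v|] that the library puts on ['rV[R]_n] is the sup norm. *)
Definition enorm v : R := Num.sqrt (dotp v v).

Definition eball x (r : R) : set 'rV[R]_n := [set y | enorm (y - x) < r].

Definition partial (i : 'I_n) g : 'rV[R]_n -> R := fun y => 'D_(delta_mx 0 i) g y.

Definition grad g y : 'rV[R]_n := \row_i partial i g y.

Definition lap g y : R := \sum_i partial i (partial i g) y.

Definition smooth g : Prop :=
  forall (s : seq 'I_n) y, differentiable (foldr partial g s) y.

Definition radial_derivative x g y : R :=
  'D_((enorm (y - x))^-1 *: (y - x)) g y.

(** Integral over the sphere of radius [r] centered at [x].  The surface measure
    of the unit sphere is taken to be the cone measure
    [sigma(A) = n * vol {t y | 0 < t < 1, y in A}]; the sphere of radius [r] gets
    its image under [y |-> x + r y], multiplied by [r ^ (n - 1)]. *)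
Definition sphere_integral x (r : R) g : R :=
  r ^+ n.-1 *
  (n%:R * vol_integral (eball 0 1) (fun y => g (x + (r / enorm y) *: y))).

(** Gradient, divergence and Laplace-Beltrami operator of the unit sphere, for
    the metric induced by R^n, at points [y] with [enorm y = 1]: the gradient is
    the tangential part of the Euclidean gradient, and the divergence of a
    tangent field is the trace of its tangential derivative. At such points they
    depend only on the restriction of their argument to the unit sphere. *)
Definition sph_grad g y : 'rV[R]_n := grad g y - dotp (grad g y) y *: y.

Definition sph_div (X : 'rV[R]_n -> 'rV[R]_n) y : R :=
  \sum_i sph_grad (fun z => X z 0 i) y 0 i.

Definition sph_lap g : 'rV[R]_n -> R := sph_div (sph_grad g).

Definition triharmonic_solution (p : R) u : Prop :=
  forall y, iter 3 (fun g z => - lap g z) u y = `|u y| `^ (p - 1) * u y.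

End calculus.

(** * The functional *)

(* The derivative d^j/dl^j, at fixed [y], of a family [F l] of functions. *)
Definition dlam (R : realType) (T : Type) (j : nat) (F : R -> T -> R) :
  R -> T -> R := fun l y => derive1n j (F ^~ y) l.

Definition p_m (R : realType) (n : nat) : \bar R :=
  if (n <= 30)%N then +oo%E else
  let N : R := n%:R in
  let s := Num.sqrt (15 * N ^+ 2 - 60 * N + 190) in
  ((5 * N + 30 - s) / (5 * N - 30 - s))%:E.

Section functional.
Variables (R : realType) (n : nat) (p : R).
Implicit Types (l : R) (x : 'rV[R]_n) (u : 'rV[R]_n -> R).

Let N : R := n%:R.

Definition kexp : R := 6 / (p - 1).
Let k := kexp.

Definition beta : R := k * (k + 4 - N).
Definition delta1 : R := 2 * (N - 1) - 4 * k.
Definition delta2 : R :=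
  6 * k * (1 + k) - 6 * k * (N - 1) + (N - 1) * (N - 3).
Definition delta4 : R :=
  k * (k + 1) * (k + 2) * (k + 3) - 2 * (N - 1) * k * (k + 1) * (k + 2)
  + (N - 1) * (N - 3) * k * (k + 2).

Definition rescale x u l : 'rV[R]_n -> R :=
  fun y => l `^ k * u (x + l *: y).

Definition E_boundary x u l : 'rV[R]_n -> R := fun y =>
  let f := rescale x u in
  let f0 := f l y in
  let f1 := dlam 1 f l y in
  let f2 := dlam 2 f l y in
  let f3 := dlam 3 f l y in
  let f4 := dlam 4 f l y in
  let sq (v : 'rV[R]_n) := dotp v v in
    (k + 2) / 2 * (lap (f l) y) ^+ 2
  - l ^+ 5 * f4 * f1
  + 2 * l ^+ 5 * f3 * f2
  - (delta1 - 6) * l ^+ 4 * f3 * f1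
  - (24 - 6 * delta1 + delta2) * l ^+ 3 * f2 * f1
  - (9 * delta1 - 3 * delta2 - 36) * l ^+ 2 * f1 ^+ 2
  + (delta1 - 8) * l ^+ 4 * f2 ^+ 2
  + delta4 * l * f0 * f1
  + 2 * delta4 * f0 ^+ 2
  + 2 * (sph_lap (f l) y) ^+ 2
  + 2^-1 * l * dlam 1 (fun s z => (sph_lap (f s) z) ^+ 2) l y
  - 4 * (beta - N + 4) * sq (sph_grad (f l) y)
  - (beta - N + 4) * l * dlam 1 (fun s z => sq (sph_grad (f s) z)) l y
  - 6 * l ^+ 2 * sq (sph_grad (dlam 1 f l) y)
  + l ^+ 3 * dlam 1 (fun s z => sq (sph_grad (dlam 1 f s) z)) l y.

Definition E_functional l x u : R :=
  l `^ (6 * ((p + 1) / (p - 1)) - N) *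
    (vol_integral (eball x l)
       (fun y => 2^-1 * dotp (grad (lap u) y) (grad (lap u) y))
     - (p + 1)^-1 * vol_integral (eball x l) (fun y => `|u y| `^ (p + 1)))
  + sphere_integral 0 1 (E_boundary x u l).

Definition Ec_functional (c : 'I_3 -> 'I_3 -> R) l x u : R :=
  E_functional l x u
  - sphere_integral 0 1 (fun y =>
      \sum_(i < 3) \sum_(j < 3) c i j * l ^+ (i + j)%N
        * dlam i (rescale x u) l y * dlam j (rescale x u) l y).

End functional.

(* Main.v *)
(** After a translation take x = 0.  Write k = 6 / (p - 1), D = y . grad,
    L = |y|^2 lap - D^2 - (n - 2) D (the Laplace-Beltrami operator of the sphere
    through y, made homogeneous of degree 0), G(f, g) = |y|^2 grad f . grad g - Df Dg
    and F_j = (k + D)^j u.  On the unit sphere, l^j d^j u^l / dl^j is a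
    combination of l^k F_i (l y), i <= j, so all spherical terms have the form
    l^(2k) times the mean of a density over the sphere of radius l, and l d/dl turns
    a density b into 2 k b + D b.  The volume term is differentiated with a Pohozaev
    identity: (2k + 6) e + D e is a divergence, e being the energy density.

    Up to terms of zero spherical mean, G(f, g) + f L g, the derivative of E^c is
    l^(2k - 1) times the mean of a quadratic form in F_1, F_2, F_3.  The c_ij absorb
    the terms F_1 F_2 and F_2 F_3 and trade all of F_1 F_3 but a multiple al of it for
    F_2^2, which leaves
      3 (F_3 + (al F_1 + 2 L F_1) / 6)^2 + 8/3 (L F_1)^2 + q_1 F_1^2 + q_2 F_2^2
      + r_1 G(F_1, F_1) + b_12 G(F_1, F_2) + 4 G(F_2, F_2).
    It is positive if q_1 > 0, q_2 >= 0 and r_1 >= (b_12 / 4)^2.  With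
    X = k (n - 6 - k) > 0 one has
      q_1 = 3 X^2 + (12 n - 32) X + 8 (n - 2) (n - 4) - al^2 / 12,
      q_2 = - n^2 + 24 n - 68 + 10 X + al.
    For n >= 31 take al = 0: then q_2 >= 0 follows from p < p_m(n).  For n <= 30,
    al = 47/5 (n - 3) works for every supercritical p. *)

Require Import Defs.
From HB Require Import structures.
From mathcomp Require Import all_boot all_order all_algebra.
From mathcomp Require Import all_classical all_reals all_analysis.
From mathcomp Require Import measurable_realfun matrix_normedtype ring lra.

Import Order.TTheory GRing.Theory Num.Theory.
Import numFieldNormedType.Exports.

Set Implicit Arguments.
Unset Strict Implicit.
Unset Printing Implicit Defensive.

Local Open Scope classical_set_scope.
Local Open Scope ring_scope.

(** * Lebesgue measure under affine maps *)

(** A spherical integral is by definition a ball integral of a function constant on rays. Facts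
    about spheres are therefore drawn from balls by differentiating in the radius: the derivative of
    a ball integral is a surface integral, and the divergence theorem, the derivative of a spherical
    mean and Green's formula on spheres follow from this and from the behaviour of the measure under
    translations and dilations. The nonlinearity |u|^(p-1) u need not be smooth where u vanishes,
    but for a solution it equals - lap (lap (lap u)). The energy is rewritten accordingly, so that
    all its densities are smooth, and a power of |u| is differentiated only at points where u is
    nonzero. The corrections have their effect because l d/dl, applied to l^(2k) times the mean of
    F_1^2, F_1 F_2 or F_2^2, produces the densities 2 F_1 F_2, F_2^2 + F_1 F_3 and 2 F_2 F_3. The
    share al of F_1 F_3 that is left is a free parameter: increasing it from 0 helps q_2 and r_1 and
    costs q_1, which absorbs it when the square in F_3 is completed. *)

Lemma pushforward_measure_ex d d' (T1 : measurableType d) (T2 : measurableType d')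
    (R : realType) (m : {measure set T1 -> \bar R}) (f : T1 -> T2) :
  measurable_fun [set: T1] f ->
  exists nu : {measure set T2 -> \bar R}, forall A, nu A = m (f @^-1` A).
Proof. by move=> mf; unshelve eexists (pushforward m f : {measure set T2 -> \bar R}). Qed.

Section lebesgue_affine.
Variable R : realType.
Local Notation leb := (@lebesgue_measure R).

Lemma affine_measurable (a b : R) :
  measurable_fun [set: measurableTypeR R] (fun t : measurableTypeR R => a * t + b : measurableTypeR R).
Proof. exact: measurable_funD. Qed.

(** The pushforward of Lebesgue measure, multiplied by [a], agrees with Lebesgue measure on
    half-open intervals, and these determine it. *)
Lemma lebesgue_measure_affine (a b : R) (A : set (measurableTypeR R)) :
  0 < a -> measurable A ->
  leb ((fun t => a * t + b) @^-1` A) = ((a^-1)%:E * leb A)%E.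
Proof.
move=> a0 mA.
have a0' : 0 <= a by exact: ltW.
have key x y : leb `]x, y]%classic =
    (a%:E * leb ((fun t => a * t + b)%R @^-1` `]x, y]%classic))%E.
  have -> : (fun t => a * t + b) @^-1` `]x, y]%classic =
      `]((x - b) / a), ((y - b) / a)]%classic.
    apply/seteqP; split => t /=;
      rewrite !in_itv/= ltr_pdivrMr// ler_pdivlMr// !(mulrC t);
      by move=> /andP[? ?]; apply/andP; split; lra.
  rewrite !lebesgue_measure_itv /= !lte_fin.
  rewrite ltr_pM2r ?invr_gt0// ltrD2r; case: ifPn => // _; last by rewrite mule0.
  by rewrite -!EFinB -EFinM; congr EFin; field; rewrite gt_eqF.
suff -> : leb A = (a%:E * leb ((fun t => a * t + b)%R @^-1` A))%E.
  by rewrite muleA -EFinM mulVf ?gt_eqF// mul1e.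
have [nu nuE] := pushforward_measure_ex leb (affine_measurable a b).
rewrite -nuE -[RHS]/(mscale (NngNum a0') nu A).
apply: lebesgue_measure_unique => // _ [[x y]] _ <-.
by rewrite [LHS]key -nuE.
Qed.

End lebesgue_affine.

Section lebesgue_tuple_affine.
Variable R : realType.

Definition affine_tuple n (a : R) (b : n.-tuple (measurableTypeR R))
  (t : n.-tuple (measurableTypeR R)) : n.-tuple (measurableTypeR R) :=
  [tuple a * tnth t i + tnth b i | i < n].

Lemma affine_tuple_measurable n (a : R) (b : n.-tuple (measurableTypeR R)) :
  measurable_fun [set: n.-tuple (measurableTypeR R)] (affine_tuple a b).
Proof.
apply/measurable_fun_tnthP => i.
rewrite (_ : _ \o _ = (fun t : n.-tuple (measurableTypeR R) => a * tnth t i + tnth b i)); last first.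
  by apply/funext => t /=; rewrite tnth_mktuple.
apply: (measurableT_comp (affine_measurable a (tnth b i))).
exact: measurable_tnth.
Qed.

Lemma affine_tuple_cons n (a : R) (b : n.+1.-tuple (measurableTypeR R)) s v :
  affine_tuple a b (tuple_cons (s, v)) =
  tuple_cons (a * s + thead b, affine_tuple a [tuple of behead b] v).
Proof.
apply: eq_from_tnth => i; rewrite tnth_mktuple.
case: (unliftP ord0 i) => [j|] ->; last by rewrite !tnth0 /thead.
by rewrite !tnthS tnth_mktuple [in LHS](tuple_eta b) tnthS.
Qed.

(** Induction by slicing off the first coordinate: sections of the preimage are preimages of
    sections, so the tail contributes [n] factors and the one-dimensional change of variables the
    last one. *)
Lemma lebesgue_tuple_affine n (a : R) (b : n.-tuple (measurableTypeR R))
    (A : set (n.-tuple (measurableTypeR R))) : 0 < a -> measurable A ->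
  lebesgue_tuple R n (affine_tuple a b @^-1` A) =
  (((a ^+ n)^-1)%:E * lebesgue_tuple R n A)%E.
Proof.
move=> a0; elim: n b A => [|n ih] b A mA /=.
  rewrite expr0 invr1 mul1e; congr (dirac _ _).
  by apply/seteqP; split => t /=; rewrite [affine_tuple _ _ t]tuple0 [t]tuple0.
rewrite /lebesgue_step /pushforward /product_measure1 /=.
set mu := lebesgue_tuple R n.
set B := @tuple_cons R n @^-1` A.
have mB : measurable B by rewrite -[X in measurable X]setTI; exact: measurable_tuple_cons.
pose phi (s : measurableTypeR R) := mu (xsection B s).
have mphi : measurable_fun setT phi by exact: measurable_fun_xsection.
pose b0 := thead b; pose b' := [tuple of behead b].
transitivity (\int[lebesgue_measure]_s (((a ^+ n)^-1)%:E * phi (a * s + b0)%R))%E.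
  apply: eq_integral => s _ /=.
  rewrite /phi -(ih b') //; last exact: measurable_xsection.
  by congr (mu _); apply/seteqP; split => v; rewrite /xsection /= !inE /B /= affine_tuple_cons.
rewrite ge0_integralZl//; last 2 first.
- by apply: (measurableT_comp mphi); exact: affine_measurable.
- by rewrite lee_fin invr_ge0 exprn_ge0// ltW.
rewrite exprS invfM EFinM (muleC (a^-1)%:E) -muleA; congr (_ * _)%E.
have aV0 : 0 <= a^-1 by rewrite invr_ge0 ltW.
rewrite -[RHS](@ge0_integral_mscale _ _ _ _ setT _ (NngNum aV0))//.
pose aff (s : measurableTypeR R) : measurableTypeR R := a * s + b0.
transitivity (\int[lebesgue_measure]_(s in aff @^-1` setT) (phi \o aff) s)%E; first by [].
rewrite -ge0_integral_pushforward//; first last.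
  exact: affine_measurable.
apply: eq_measure_integral => [|maff X mX _]; first exact: affine_measurable.
exact: (lebesgue_measure_affine b0 a0 mX).
Qed.

End lebesgue_tuple_affine.

(** * Borel measurability in coordinates and the Euclidean norm *)

Section measurability.
Variables (R : realType) (n : nat).
Local Notation T := (n.-tuple (measurableTypeR R)).
Local Notation rot := (@row_of_tuple R n).
Implicit Types (g h : 'rV[R]_n -> R).

Lemma measurable_coord (i : 'I_n) :
  measurable_fun [set: T] (fun t : T => rot t 0 i : R).
Proof.
rewrite (_ : (fun t : T => _) = (fun t : T => tnth t i)); last first.
  by apply/funext => t; rewrite mxE.
exact: measurable_tnth.
Qed.

Lemma measurable_box (q : 'rV[R]_n) (r : R) :
  measurable (rot @^-1` [set y | forall i, `|y 0 i - q 0 i| < r]).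
Proof.
rewrite (_ : _ @^-1` _ = \bigcap_(i in [set: 'I_n]) [set t | `|rot t 0 i - q 0 i| < r]).
  apply: fin_bigcap_measurable => [|i _]; first exact: finite_finset.
  rewrite (_ : [set t | _] = (fun t => rot t 0 i - q 0 i) @^-1` [set z | `|z| < r]) //.
  rewrite -[X in measurable X]setTI.
  have : measurable_fun [set: T] (fun t : T => rot t 0 i - q 0 i).
    by apply: measurable_funB => //; exact: measurable_coord.
  apply => //.
  rewrite (_ : [set z | _] = ball (0 : R) r); first exact: measurable_ball.
  by apply/seteqP; split => z /=; rewrite /ball/= sub0r normrN.
by apply/seteqP; split => [t tq i _ /=|t tq i]; exact: tq.
Qed.

(** Links the topology of row vectors to the product sigma-algebra on tuples: an open set is a
    countable union of boxes with rational centre and radius 1/(m+1). *)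
Lemma measurable_open_row (U : set 'rV[R]_n) : open U -> measurable (rot @^-1` U).
Proof.
move=> oU.
pose box (k : 'rV[rat]_n * nat) := [set y : 'rV[R]_n | forall i, `|y 0 i - ratr (k.1 0 i)| < k.2.+1%:R^-1].
(* Boxes that leave [U] are replaced by the empty set, so that the union runs over a fixed countable
   type. *)
pose F (k : 'rV[rat]_n * nat) := if `[< box k `<=` U >] then rot @^-1` (box k) else set0.
rewrite (_ : rot @^-1` U = \bigcup_k F k).
  apply: countable_bigcupT_measurable => // k; rewrite /F; case: ifPn => // _.
  rewrite (_ : box k = [set y | forall i, `|y 0 i - (map_mx ratr k.1 : 'rV[R]_n) 0 i| < k.2.+1%:R^-1]).
    exact: measurable_box.
  by apply/seteqP; split => y /= H i; move: (H i); rewrite mxE.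
apply/seteqP; split => [t /= Ut|t [k _]]; last first.
  by rewrite /F; case: asboolP => // kU tk; exact: kU.
have := oU; rewrite openE => /(_ _ Ut) /nbhs_ballP[e /= e0 beU].
(* Two radii must fit below [e]: from a point of the box to its rational centre, and from there to
   [t]. *)
pose m := Num.truncn (2 / e).
have m0 : 0 < m.+1%:R :> R by rewrite ltr0n.
have me : 2 * m.+1%:R^-1 < e.
  rewrite ltr_pdivrMr// mulrC -ltr_pdivrMr//.
  by apply: truncnS_gt.
have qex i : exists q : rat, ratr q \in `](rot t 0 i - m.+1%:R^-1), (rot t 0 i + m.+1%:R^-1)[.
  by apply: rat_in_itvoo; rewrite ltrBlDr -addrA ltrDl addr_gt0// invr_gt0.
pose q : 'rV[rat]_n := \row_i projT1 (cid (qex i)).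
have qP i : `|rot t 0 i - ratr (q 0 i)| < m.+1%:R^-1.
  have := projT2 (cid (qex i)); rewrite [q 0 i]mxE in_itv/= => /andP[z1 z2].
  by rewrite distrC ltr_distl z1.
exists (q, m) => //; rewrite /F asboolT; first by move=> i /=; exact: qP.
move=> y yq; apply: beU; split => // i j /=.
rewrite !ord1 /ball/=.
have := qP j; have := yq j => /=.
have -> : rot t 0 j - y 0 j = (rot t 0 j - ratr (q 0 j)) - (y 0 j - ratr (q 0 j)) by ring.
move=> h1 h2; apply: (le_lt_trans (ler_normB _ _)).
by apply: lt_trans me; rewrite mulr_natl mulr2n ltrD.
Qed.

Lemma continuous_measurable_row g : continuous g ->
  measurable_fun [set: T] (g \o rot).
Proof.
move=> cg; apply: (measurability _ (RGenOInfty.measurableE R)) => //.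
move=> /= _ [_ [a ->] <-]; rewrite setTI comp_preimage.
by apply: measurable_open_row; apply: open_comp => // y _; exact: cg.
Qed.

Lemma continuous_dotpp : continuous (fun y : 'rV[R]_n => dotp y y).
Proof.
move=> y; apply: differentiable_continuous.
rewrite (_ : (fun y => _) = \sum_(i < n) (fun y : 'rV[R]_n => y 0 i * y 0 i)).
  by apply: differentiable_sum => i; apply: differentiableM; exact: differentiable_coord.
by apply/funext => z; rewrite fct_sumE.
Qed.

Lemma continuous_enorm : continuous (@enorm R n).
Proof.
by move=> y; apply: (continuous_comp (@continuous_dotpp y)); exact: sqrt_continuous.
Qed.

Lemma dotpp_ge0 (y : 'rV[R]_n) : 0 <= dotp y y.
Proof. by apply: sumr_ge0 => i _; rewrite -expr2 sqr_ge0. Qed.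

Lemma sqr_enorm (y : 'rV[R]_n) : enorm y ^+ 2 = dotp y y.
Proof. by rewrite sqr_sqrtr// dotpp_ge0. Qed.

Lemma enorm_ge0 (y : 'rV[R]_n) : 0 <= enorm y.
Proof. exact: sqrtr_ge0. Qed.

Lemma coord_le_enorm (y : 'rV[R]_n) i : `|y 0 i| <= enorm y.
Proof.
rewrite -(ler_pXn2r (ltn0Sn 1)) ?nnegrE ?enorm_ge0// sqr_enorm.
rewrite real_normK ?num_real// /dotp (bigD1 i)//= -expr2 lerDl.
by apply: sumr_ge0 => j _; rewrite -expr2 sqr_ge0.
Qed.

Lemma enormZ (a : R) (y : 'rV[R]_n) : enorm (a *: y) = `|a| * enorm y.
Proof.
rewrite /enorm (_ : dotp _ _ = a ^+ 2 * dotp y y).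
  by rewrite sqrtrM ?sqr_ge0// sqrtr_sqr.
by rewrite /dotp mulr_sumr; apply: eq_bigr => i _; rewrite !mxE; ring.
Qed.

Lemma enorm_eq0 (y : 'rV[R]_n) : (enorm y == 0) = (y == 0).
Proof.
apply/eqP/eqP => [y0|->]; last first.
  by rewrite -(scale0r (0 : 'rV[R]_n)) enormZ normr0 mul0r.
apply/rowP => i; rewrite mxE; apply/normr0_eq0/le_anti.
by rewrite normr_ge0 andbT -y0 coord_le_enorm.
Qed.

Lemma enorm0 : enorm (0 : 'rV[R]_n) = 0.
Proof. by apply/eqP; rewrite enorm_eq0. Qed.

Lemma continuous_shift_enorm (x : 'rV[R]_n) : continuous (fun y : 'rV[R]_n => enorm (y - x)).
Proof.
move=> y; apply: (@continuous_comp _ _ _ (fun z : 'rV[R]_n => z - x) (@enorm R n)).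
  by apply: differentiable_continuous; apply: differentiableB.
exact: continuous_enorm.
Qed.

Lemma measurable_eball (x : 'rV[R]_n) r : measurable (rot @^-1` eball x r).
Proof.
apply: measurable_open_row.
rewrite (_ : eball x r = (fun y => enorm (y - x)) @^-1` [set z | z < r])//.
by apply: open_comp => // y _; exact: continuous_shift_enorm.
Qed.

End measurability.

Section finite_volume.
Variables (R : realType).

Lemma lebesgue_cube_lty n (M : R) :
  (lebesgue_tuple R n [set t | forall i, (`|tnth t i| <= M)%R] < +oo)%E.
Proof.
elim: n => [|n ih] /=.
  by rewrite diracE; case: (_ \in _); rewrite ltry.
rewrite /lebesgue_step /pushforward.
rewrite (_ : _ @^-1` _ = `[(- M), M]%classic `*` [set t | forall i, `|tnth t i| <= M]).
  rewrite product_measure1E//; last first.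
    rewrite (_ : [set t | _] = \bigcap_(i in [set: 'I_n]) [set t | `|tnth t i| <= M]).
      apply: fin_bigcap_measurable => [|i _]; first exact: finite_finset.
      rewrite (_ : [set t | _] = (fun t => tnth t i) @^-1` `[(- M), M]%classic); last first.
        by apply/seteqP; split => t /=; rewrite in_itv/= ler_norml.
      by rewrite -[X in measurable X]setTI; apply: measurable_tnth.
    by apply/seteqP; split => [t tq i _ /=|t tq i]; exact: tq.
  apply: lte_mul_pinfty => //.
  rewrite -[X in X \is a _]/(lebesgue_measure `[(- M), M]%classic).
  by rewrite lebesgue_measure_itv; case: ifPn.
apply/seteqP; split => -[s t] /=.
  move=> H; split; first by have := H ord0; rewrite tnth0 ler_norml in_itv.
  by move=> i; have := H (lift ord0 i); rewrite tnthS.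
move=> [H1 H2] i; case: (unliftP ord0 i) => [j|] ->; first by rewrite tnthS.
by rewrite tnth0 ler_norml; move: H1; rewrite in_itv.
Qed.

End finite_volume.

(** * The Euclidean inner product *)

Section dotp_theory.
Variables (R : realType) (n : nat).
Implicit Types (v w y : 'rV[R]_n).

Lemma dotpC v w : dotp v w = dotp w v.
Proof. by apply: eq_bigr => i _; rewrite mulrC. Qed.

Lemma dotpDl v1 v2 w : dotp (v1 + v2) w = dotp v1 w + dotp v2 w.
Proof. by rewrite /dotp -big_split; apply: eq_bigr => i _; rewrite mxE mulrDl. Qed.

Lemma dotpZl a v w : dotp (a *: v) w = a * dotp v w.
Proof. by rewrite /dotp mulr_sumr; apply: eq_bigr => i _; rewrite mxE mulrA. Qed.

Lemma dotpBl v1 v2 w : dotp (v1 - v2) w = dotp v1 w - dotp v2 w.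
Proof. by rewrite -scaleN1r dotpDl dotpZl mulN1r. Qed.

Lemma dotpDr v1 v2 w : dotp w (v1 + v2) = dotp w v1 + dotp w v2.
Proof. by rewrite ![dotp w _]dotpC dotpDl. Qed.

Lemma dotpZr a v w : dotp v (a *: w) = a * dotp v w.
Proof. by rewrite ![dotp v _]dotpC dotpZl. Qed.

Lemma dotpBr v1 v2 w : dotp w (v1 - v2) = dotp w v1 - dotp w v2.
Proof. by rewrite ![dotp w _]dotpC dotpBl. Qed.

Lemma dotpp_eq0 v : (dotp v v == 0) = (v == 0).
Proof. by rewrite -sqr_enorm sqrf_eq0 enorm_eq0. Qed.

Lemma cauchy_schwarz v w : dotp v w ^+ 2 <= dotp v v * dotp w w.
Proof.
have [->|w0] := eqVneq w 0.
  have d0 (z : 'rV[R]_n) : dotp z 0 = 0.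
    by rewrite -(scale0r (0 : 'rV[R]_n)) dotpZr mul0r.
  by rewrite !d0 expr0n mulr0.
have ww : 0 < dotp w w by rewrite lt0r dotpp_eq0 w0 dotpp_ge0.
have := dotpp_ge0 (dotp w w *: v - dotp v w *: w).
rewrite !(dotpBl, dotpBr, dotpZl, dotpZr) (dotpC w v) => H.
rewrite -subr_ge0 -(pmulr_rge0 _ ww); apply: le_trans H _.
by rewrite le_eqVlt; apply/orP; left; apply/eqP; ring.
Qed.

Lemma enorm_leD v w : enorm (v + w) <= enorm v + enorm w.
Proof.
rewrite -(ler_pXn2r (ltn0Sn 1)) ?nnegrE ?addr_ge0 ?enorm_ge0//.
rewrite sqrrD !sqr_enorm dotpDl !dotpDr (dotpC w v).
suff : dotp v w <= enorm v * enorm w by lra.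
apply: (le_trans (ler_norm _)).
rewrite -(ler_pXn2r (ltn0Sn 1)) ?nnegrE ?mulr_ge0 ?enorm_ge0//.
by rewrite exprMn !sqr_enorm real_normK ?num_real// cauchy_schwarz.
Qed.

End dotp_theory.

(** * Integrals over balls and spheres *)

Section locally_bounded.
Variables (R : realType) (n : nat).
Local Notation T := (n.-tuple (measurableTypeR R)).
Local Notation rot := (@row_of_tuple R n).
Implicit Types (g h : 'rV[R]_n -> R).

(** Continuity would exclude integrands that jump at the origin, such as the extension of a function
    on a sphere that is constant on rays; this class contains them and is still integrable over
    every ball. *)
Definition mloc_bounded g := measurable_fun [set: T] (g \o rot) /\
  forall M : R, exists K : R, forall y, enorm y <= M -> `|g y| <= K.

Lemma mlb_continuous g : continuous g -> mloc_bounded g.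
Proof.
move=> cg; split; first exact: continuous_measurable_row.
move=> M; have cK := @rV_compact R n (fun _ => `[(- M), M]%classic) (fun _ => @segment_compact R (- M) M).
have := compact_bounded (continuous_compact (continuous_subspaceT cg) cK).
move=> [N [_ /(_ (N + 1))]]; rewrite ltrDl ltr01 => /(_ isT) H.
exists (N + 1) => y yM; apply: H; exists y => //= i.
by rewrite /= in_itv/= -ler_norml (le_trans _ yM)// coord_le_enorm.
Qed.

Lemma mlb_cst a : mloc_bounded (fun _ => a).
Proof. by apply: mlb_continuous; exact: cst_continuous. Qed.

Lemma mlbD g h : mloc_bounded g -> mloc_bounded h -> mloc_bounded (fun y => g y + h y).
Proof.
move=> [mg bg] [mh bh]; split; first exact: measurable_funD.
move=> M; have [K gK] := bg M; have [L hL] := bh M; exists (K + L) => y yM.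
by rewrite (le_trans (ler_normD _ _))// lerD ?gK ?hL.
Qed.

Lemma mlbM g h : mloc_bounded g -> mloc_bounded h -> mloc_bounded (fun y => g y * h y).
Proof.
move=> [mg bg] [mh bh]; split; first exact: (measurable_funM mg mh).
move=> M; have [K gK] := bg M; have [L hL] := bh M; exists (K * L) => y yM.
by rewrite normrM; apply: ler_pM => //; [exact: gK|exact: hL].
Qed.

Lemma mlbZ a g : mloc_bounded g -> mloc_bounded (fun y => a * g y).
Proof. by move=> mg; apply: mlbM => //; exact: mlb_cst. Qed.

Lemma mlbB g h : mloc_bounded g -> mloc_bounded h -> mloc_bounded (fun y => g y - h y).
Proof.
move=> mg mh; rewrite (_ : (fun y => _) = (fun y => g y + (-1) * h y)).
  by apply: mlbD => //; exact: mlbZ.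
by apply/funext => y; rewrite mulN1r.
Qed.

Lemma mlb_norm g : mloc_bounded g -> mloc_bounded (fun y => `|g y|).
Proof.
move=> [mg bg]; split; first exact: measurableT_comp.
by move=> M; have [K gK] := bg M; exists K => y yM; rewrite normr_id gK.
Qed.

Lemma mlb_comp (S : 'rV[R]_n -> 'rV[R]_n) g :
  (forall i, measurable_fun [set: T] (fun t : T => S (rot t) 0 i : R)) ->
  (forall M : R, exists K : R, forall y, enorm y <= M -> enorm (S y) <= K) ->
  mloc_bounded g -> mloc_bounded (g \o S).
Proof.
move=> mS bS [mg bg]; split; last first.
  by move=> M; have [K SK] := bS M; have [L gL] := bg K; exists L => y /SK/gL.
pose ST (t : T) : T := [tuple S (rot t) 0 i | i < n].
rewrite (_ : _ \o _ = (g \o rot) \o ST).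
  apply: (measurableT_comp mg); apply/measurable_fun_tnthP => i.
  rewrite (_ : _ \o _ = (fun t : T => S (rot t) 0 i)); first exact: mS.
  by apply/funext => t /=; rewrite tnth_mktuple.
apply/funext => t /=; congr g; apply/rowP => i.
by rewrite [RHS]mxE tnth_mktuple.
Qed.

Lemma mlb_affine x (a : R) g : mloc_bounded g -> mloc_bounded (fun y => g (x + a *: y)).
Proof.
apply: (@mlb_comp (fun y => x + a *: y)) => [i|M].
  rewrite (_ : (fun t : T => _) = (fun t : T => x 0 i + a * rot t 0 i)).
    by apply: measurable_funD => //; apply: measurable_funM => //; exact: measurable_coord.
  by apply/funext => t; rewrite !mxE.
exists (enorm x + `|a| * M) => y yM; rewrite (le_trans (enorm_leD _ _))// lerD2l.
by rewrite enormZ ler_wpM2l.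
Qed.

Lemma enorm_normalize (r : R) (y : 'rV[R]_n) : 0 <= r -> enorm ((r / enorm y) *: y) <= r.
Proof.
move=> r0; rewrite enormZ ger0_norm ?divr_ge0 ?enorm_ge0//.
have [->|y0] := eqVneq (enorm y) 0; first by rewrite mulr0.
by rewrite divfK.
Qed.

Lemma mlb_normalize (r : R) g : 0 <= r ->
  mloc_bounded g -> mloc_bounded (fun y => g ((r / enorm y) *: y)).
Proof.
move=> r0; apply: (@mlb_comp (fun y => (r / enorm y) *: y)) => [i|M]; last first.
  by exists r => y _; exact: enorm_normalize.
(* As a real power the inverse norm is visibly measurable; both expressions are 0 at the origin. *)
rewrite (_ : (fun t : T => _) = (fun t : T => (r * (enorm (rot t)) `^ (-1)) * rot t 0 i)).
  apply: measurable_funM; last exact: measurable_coord.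
  apply: measurable_funM => //.
  apply: (measurableT_comp (measurable_powR (-1))).
  exact: (continuous_measurable_row (@continuous_enorm R n)).
by apply/funext => t; rewrite !mxE powR_inv1// enorm_ge0.
Qed.

Lemma bounded_volume_lty (D : set 'rV[R]_n) (M : R) :
  measurable (rot @^-1` D) -> (forall y, D y -> enorm y <= M) ->
  (lebesgue_tuple R n (rot @^-1` D) < +oo)%E.
Proof.
move=> mD DM; apply: le_lt_trans (lebesgue_cube_lty n M).
apply: le_measure; rewrite ?inE//.
  rewrite (_ : [set t | _] = \bigcap_(i in [set: 'I_n]) [set t | `|tnth t i| <= M]).
    apply: fin_bigcap_measurable => [|i _]; first exact: finite_finset.
    rewrite (_ : [set t | _] = (fun t => tnth t i) @^-1` `[(- M), M]%classic); last first.
      by apply/seteqP; split => t /=; rewrite in_itv/= ler_norml.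
    by rewrite -[X in measurable X]setTI; apply: measurable_tnth.
  by apply/seteqP; split => [t tq i _ /=|t tq i]; exact: tq.
move=> t /= Dt i; apply: le_trans (DM _ Dt).
by have := coord_le_enorm (rot t) i; rewrite mxE.
Qed.

Lemma mlb_integrable (D : set 'rV[R]_n) (M : R) g :
  measurable (rot @^-1` D) -> (forall y, D y -> enorm y <= M) -> mloc_bounded g ->
  (lebesgue_tuple R n).-integrable (rot @^-1` D) (EFin \o (g \o rot)).
Proof.
move=> mD DM [mg bg]; apply: measurable_bounded_integrable => //.
- exact: bounded_volume_lty mD DM.
- exact: measurable_funTS.
have [K gK] := bg M; exists K; split; first exact: num_real.
by move=> L KL t /= /DM /gK H; rewrite (le_trans H)// ltW.
Qed.

Lemma eball_bounded (x : 'rV[R]_n) r y : eball x r y -> enorm y <= enorm x + r.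
Proof.
move=> H; rewrite -[y](subrK x) addrC (le_trans (enorm_leD _ _))// lerD2l ltW//.
Qed.

Lemma integrable_eball x r g : mloc_bounded g ->
  (lebesgue_tuple R n).-integrable (rot @^-1` eball x r) (EFin \o (g \o rot)).
Proof. exact: mlb_integrable (measurable_eball x r) (@eball_bounded x r). Qed.

End locally_bounded.

(** * Change of variables and estimates for ball integrals *)

Section affine_change.
Variables (R : realType) (n : nat).
Local Notation T := (n.-tuple (measurableTypeR R)).
Local Notation rot := (@row_of_tuple R n).
Local Notation mu := (lebesgue_tuple R n).
Implicit Types (g h : 'rV[R]_n -> R).

Lemma ge0_integral_affine (a : R) (b : T) (D : set T) (f : T -> \bar R) :
  0 < a -> measurable D -> measurable_fun [set: T] f -> (forall t, 0 <= f t)%E ->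
  (\int[mu]_(t in affine_tuple a b @^-1` D) f (affine_tuple a b t) =
   ((a ^+ n)^-1)%:E * \int[mu]_(t in D) f t)%E.
Proof.
move=> a0 mD mf f0.
have aV0 : 0 <= (a ^+ n)^-1 by rewrite invr_ge0 exprn_ge0// ltW.
rewrite -[RHS](@ge0_integral_mscale _ _ _ _ D mD (NngNum aV0))//; last first.
  exact: measurable_funTS.
rewrite -[LHS](ge0_integral_pushforward (affine_tuple_measurable a b))//; last first.
  exact: measurable_funTS.
apply: eq_measure_integral => [|maff X mX _]; first exact: affine_tuple_measurable.
exact: lebesgue_tuple_affine.
Qed.

Lemma row_affine (a : R) (x : 'rV[R]_n) (t : T) :
  rot (affine_tuple a [tuple x 0 i | i < n] t) = x + a *: rot t.
Proof. by apply/rowP => i; rewrite !mxE !tnth_mktuple addrC. Qed.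

Lemma vol_integral_affine (a : R) (x : 'rV[R]_n) (D : set 'rV[R]_n) (M : R) g :
  0 < a -> measurable (rot @^-1` D) -> (forall y, D y -> enorm y <= M) ->
  mloc_bounded g ->
  vol_integral D g = a ^+ n * vol_integral [set y | D (x + a *: y)] (fun y => g (x + a *: y)).
Proof.
move=> a0 mD DM mg.
pose b := [tuple x 0 i | i < n] : T.
have ig := mlb_integrable mD DM mg.
rewrite /vol_integral /Rintegral.
have e1 : rot @^-1` [set y | D (x + a *: y)] = affine_tuple a b @^-1` (rot @^-1` D).
  by apply/seteqP; split => t /=; rewrite row_affine.
have -> : (\int[mu]_(t in rot @^-1` [set y | D (x + a *: y)%R])
    (((fun y => g (x + a *: y)%R) \o rot) t)%:E =
   ((a ^+ n)^-1)%:E * \int[mu]_(t in rot @^-1` D) (g (rot t))%:E)%E.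
  pose G t := (g (rot t))%:E.
  have mG : measurable_fun [set: T] G by apply/measurable_EFinP; case: mg.
  rewrite e1 (eq_integral (fun t => G (affine_tuple a b t))); last first.
    by move=> t _; rewrite /G row_affine.
  (* The nonnegative case is applied to the positive and the negative part; the scalar factors out
     of the difference because the integral of the negative part is finite. *)
  transitivity (\int[mu]_(t in affine_tuple a b @^-1` (rot @^-1` D)) (G^\+) (affine_tuple a b t) -
    \int[mu]_(t in affine_tuple a b @^-1` (rot @^-1` D)) (G^\-) (affine_tuple a b t))%E.
    by rewrite [LHS]integralE; congr (_ - _)%E; apply: eq_integral => t _; rewrite unlock.
  rewrite [in RHS]integralE.
  rewrite !ge0_integral_affine//.
  - rewrite -[X in _ = (_ * (X - _))%E]/(\int[mu]_(t in rot @^-1` D) G^\+ t)%E.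
    rewrite -[X in _ = (_ * (_ - X))%E]/(\int[mu]_(t in rot @^-1` D) G^\- t)%E.
    have fG : (\int[mu]_(t in rot @^-1` D) G^\- t)%E \is a fin_num by exact: integrable_neg_fin_num.
    by rewrite [RHS]muleBr ?fin_num_adde_defl ?fin_numN//.
  - exact: measurable_funeneg.
  - exact: measurable_funepos.
rewrite fineM//; last exact: integrable_fin_num.
by rewrite /= mulrA divff ?mul1r// expf_neq0// gt_eqF.
Qed.

Definition ball_integral (r : R) g : R := vol_integral (eball 0 r) g.

Lemma vol_integral_eball (x : 'rV[R]_n) r g : 0 < r -> mloc_bounded g ->
  vol_integral (eball x r) g = r ^+ n * ball_integral 1 (fun y => g (x + r *: y)).
Proof.
move=> r0 mg; rewrite (@vol_integral_affine r x _ _ _ r0 (measurable_eball x r) (@eball_bounded _ _ x r) mg).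
congr (_ * vol_integral _ _); apply/seteqP; split => y;
  by rewrite /eball/= subr0 addrC addKr enormZ gtr0_norm// -ltr_pdivlMl// mulVf// gt_eqF.
Qed.

Lemma vol_integral_shift (x : 'rV[R]_n) r g : 0 < r -> mloc_bounded g ->
  vol_integral (eball x r) g = ball_integral r (fun y => g (x + y)).
Proof.
move=> r0 mg; rewrite /ball_integral !vol_integral_eball//.
  by congr (_ * vol_integral _ _); apply/funext => y; rewrite add0r.
rewrite (_ : (fun y => g (x + y)) = (fun y => g (x + 1 *: y))); first exact: mlb_affine.
by apply/funext => y; rewrite scale1r.
Qed.

Lemma ball_integral_scale r g : 0 < r -> mloc_bounded g ->
  ball_integral r g = r ^+ n * ball_integral 1 (fun y => g (r *: y)).
Proof.
move=> r0 mg; rewrite /ball_integral vol_integral_eball//.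
by congr (_ * vol_integral _ _); apply/funext => y; rewrite add0r.
Qed.

Lemma ball_integralD r g h : mloc_bounded g -> mloc_bounded h ->
  ball_integral r (fun y => g y + h y) = ball_integral r g + ball_integral r h.
Proof.
move=> mg mh; apply: RintegralD; first exact: measurable_eball.
- exact: integrable_eball.
- exact: integrable_eball.
Qed.

Lemma ball_integralZ r a g : mloc_bounded g ->
  ball_integral r (fun y => a * g y) = a * ball_integral r g.
Proof.
move=> mg; apply: RintegralZl; first exact: measurable_eball.
exact: integrable_eball.
Qed.

Lemma ball_integralB r g h : mloc_bounded g -> mloc_bounded h ->
  ball_integral r (fun y => g y - h y) = ball_integral r g - ball_integral r h.
Proof.
move=> mg mh; apply: RintegralB; first exact: measurable_eball.
- exact: integrable_eball.
- exact: integrable_eball.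
Qed.

Lemma eq_vol_integral (D : set 'rV[R]_n) g h : (forall y, D y -> g y = h y) ->
  vol_integral D g = vol_integral D h.
Proof. by move=> gh; apply: eq_Rintegral => t /set_mem /= /gh. Qed.

Lemma eq_ball_integral r g h : (forall y, enorm y < r -> g y = h y) ->
  ball_integral r g = ball_integral r h.
Proof. by move=> gh; apply: eq_vol_integral => y; rewrite /eball/= subr0; exact: gh. Qed.

Lemma le_ball_integral r g h : mloc_bounded g -> mloc_bounded h ->
  (forall y, enorm y < r -> g y <= h y) -> ball_integral r g <= ball_integral r h.
Proof.
move=> mg mh gh; apply: le_Rintegral; first exact: measurable_eball.
- exact: integrable_eball.
- exact: integrable_eball.
by move=> t; rewrite /eball/= subr0; exact: gh.
Qed.

Lemma le_norm_ball_integral r g K : mloc_bounded g ->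
  (forall y, enorm y < r -> `|g y| <= K) ->
  `|ball_integral r g| <= K * ball_integral r (fun _ => 1).
Proof.
move=> mg gK; have mn := mlb_norm mg.
apply: (@le_trans _ _ (ball_integral r (fun y => `|g y|))).
  by apply: le_normr_Rintegral; [exact: measurable_eball|exact: integrable_eball].
rewrite -ball_integralZ; last exact: mlb_cst.
apply: le_ball_integral => //; first by apply: mlbZ; exact: mlb_cst.
by move=> y /gK; rewrite mulr1.
Qed.

Lemma ball_integral_split r s g : r <= s -> mloc_bounded g ->
  ball_integral s g = ball_integral r g +
    vol_integral (eball 0 s `\` eball 0 r) g.
Proof.
move=> rs mg; rewrite /ball_integral /vol_integral.
have sub : rot @^-1` eball 0 r `<=` rot @^-1` eball 0 s.
  by move=> t /=; rewrite /eball/= => /lt_le_trans; apply.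
have mr := measurable_eball (0 : 'rV[R]_n) r.
have ms := measurable_eball (0 : 'rV[R]_n) s.
rewrite -Rintegral_setU//.
- by rewrite setDUK.
- exact: measurableD.
- by rewrite setDUK//; exact: integrable_eball.
- by apply/disj_setPS => t [] /= ? [].
Qed.

(** The bound is a multiple of the increment of the volume, which is the form of comparison that
    [is_derive0_squeeze] takes. *)
Lemma le_norm_shell r s g K : r <= s -> mloc_bounded g ->
  (forall y, r <= enorm y < s -> `|g y| <= K) ->
  `|ball_integral s g - ball_integral r g| <=
  K * (ball_integral s (fun _ => 1) - ball_integral r (fun _ => 1)).
Proof.
move=> rs mg gK.
have m1 : mloc_bounded (fun _ : 'rV[R]_n => 1 : R) by exact: mlb_cst.
rewrite (ball_integral_split rs mg) (ball_integral_split rs m1) !(addrC (ball_integral r _)) !addrK.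
have mD : measurable (rot @^-1` (eball 0 s `\` eball 0 r)).
  by apply: measurableD; exact: measurable_eball.
have DM : forall y : 'rV[R]_n, (eball 0 s `\` eball 0 r) y -> enorm y <= s.
  by move=> y [+ _]; rewrite /eball/= subr0 => /ltW.
have ig h : mloc_bounded h -> mu.-integrable (rot @^-1` (eball 0 s `\` eball 0 r)) (EFin \o (h \o rot)).
  by move=> mh; apply: (mlb_integrable mD DM).
rewrite /vol_integral -RintegralZl//; last exact: (ig _ m1).
apply: (le_trans (le_normr_Rintegral mD (ig _ mg))).
apply: le_Rintegral => //; first exact: (ig _ (mlb_norm mg)).
- by apply: (ig (fun y => K * 1)); exact: mlbZ.
by move=> t [] /=; rewrite /eball/= subr0 mulr1 => t1 /negP t2; apply: gK; rewrite leNgt t2.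
Qed.

End affine_change.

Section derive_helpers.
Variables (R : realType) (V : normedModType R).
Implicit Types (f g : V -> R) (x v : V).

Lemma is_derive_addr f g x v df dg : is_derive x v f df -> is_derive x v g dg ->
  is_derive x v (fun t => f t + g t) (df + dg).
Proof. by move=> hf hg; exact: is_deriveD. Qed.

Lemma is_derive_subr f g x v df dg : is_derive x v f df -> is_derive x v g dg ->
  is_derive x v (fun t => f t - g t) (df - dg).
Proof. by move=> hf hg; exact: is_deriveB. Qed.

Lemma is_derive_mulr f g x v df dg : is_derive x v f df -> is_derive x v g dg ->
  is_derive x v (fun t => f t * g t) (df * g x + f x * dg).
Proof.
move=> hf hg; have := is_deriveM hf hg; rewrite (_ : f * g = fun t => f t * g t)//.
by rewrite /GRing.scale/= addrC mulrC.
Qed.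

Lemma is_derive_scaler (a : R) f x v df : is_derive x v f df ->
  is_derive x v (fun t => a * f t) (a * df).
Proof.
move=> hf; have := is_derive_mulr (is_derive_cst a x v) hf.
by rewrite mul0r add0r.
Qed.

End derive_helpers.

Lemma is_derive_expr (R : realType) (r : R) n :
  is_derive r 1 (fun t : R => t ^+ n) (n%:R * r ^+ n.-1).
Proof.
have := is_deriveX n (is_derive_id r 1).
rewrite /GRing.scale/= mulr1 (_ : id ^+ n = (fun t : R => t ^+ n))//.
by apply/funext => t; elim: n => [|n ih]; rewrite ?expr0// !exprS -ih.
Qed.

Lemma is_derive_powR (R : realType) (a r : R) : 0 < r ->
  is_derive r 1 (fun t => t `^ a) (a * r `^ (a - 1)).
Proof. by move=> r0; apply: is_derive1_powR. Qed.

(** The difference quotients of [k] stay bounded, so those of [h] are eventually below any multiple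
    of [e]. In the application [k] is the volume of a ball and [h] the integral of a function that
    vanishes on the limiting sphere. *)
Lemma is_derive0_squeeze (R : realType) (h k : R -> R) (r : R) :
  derivable k r 1 ->
  (forall e : R, 0 < e -> \forall s \near r, `|h s - h r| <= e * `|k s - k r|) ->
  is_derive r 1 h 0.
Proof.
move=> dk hk.
have H : t^-1 *: ((h \o shift r) (t *: 1) - h r) @[t --> 0^'] --> (0 : R).
  apply/cvgrPdist_le => e e0.
  set K := `|'D_1 k r| + 1.
  have K0 : 0 < K by rewrite /K ltr_pwDr.
  have nk : \forall t \near 0^', `|t^-1 *: ((k \o shift r) (t *: 1) - k r)| <= K.
    apply: cvgr_norm_le; first exact: dk.
    by rewrite /K ltrDl.
  have eK : 0 < e / K by rewrite divr_gt0.
  have nh : \forall t \near 0^', `|h (t + r) - h r| <= e / K * `|k (t + r) - k r|.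
    apply: cvg_within; have := hk _ eK; rewrite (near_shift 0).
    by apply: filterS => z /=; rewrite subr0.
  near=> t.
  rewrite sub0r normrN /=.
  have h1 : `|t^-1 *: (k (t *: 1 + r) - k r)| <= K by near: t; exact: nk.
  have h2 : `|h (t + r) - h r| <= e / K * `|k (t + r) - k r| by near: t; exact: nh.
  move: h1; rewrite /GRing.scale/= mulr1 !normrM => h1.
  apply: (@le_trans _ _ (`|t^-1| * (e / K * `|k (t + r) - k r|))).
    by rewrite ler_wpM2l.
  rewrite mulrCA; apply: (@le_trans _ _ (e / K * K)); last by rewrite divfK ?gt_eqF.
  by rewrite ler_wpM2l// ltW.
split; first by apply/cvg_ex; exists 0.
exact: cvg_lim.
Unshelve. all: end_near. Qed.

(** * Polar coordinates: the derivative of a ball integral in the radius *)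

Section polar.
Variables (R : realType) (n : nat).
Implicit Types (g h : 'rV[R]_n -> R).

(** Uniformity in the direction of [y] comes from compactness: all directions lie in the cube with
    sides [-1, 1], and g (t th) is continuous in the pair (t, th). *)
Lemma near_sphere_osc (r e : R) g : 0 < r -> 0 < e -> continuous g ->
  \forall s \near r, forall y, Num.min r s <= enorm y <= Num.max r s ->
    `|g y - g ((r / enorm y) *: y)| <= e.
Proof.
move=> r0 e0 cg.
pose K := [set v : 'rV[R]_n | forall i, `[(-1), 1]%classic (v ord0 i)].
have cK : compact K by exact: (@rV_compact R n (fun _ => `[(-1), 1]%classic) (fun _ => @segment_compact R (-1) 1)).
have /compact_near_coveringP nc := cK.
have cont2 (th : 'rV[R]_n) : (g (z.1 *: z.2)) @[z --> (nbhs r, nbhs th)] --> g (r *: th).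
  apply: (@cvg_comp _ _ _ (fun z : R * 'rV[R]_n => z.1 *: z.2) g _ (nbhs (r *: th))); last exact: cg.
  by apply: cvgZ; [exact: cvg_fst|exact: cvg_snd].
have : \forall t \near r, K `<=` (fun th => `|g (t *: th) - g (r *: th)| <= e).
  apply: (nc R (nbhs r) (fun t th => `|g (t *: th) - g (r *: th)| <= e)) => th _.
  have e2 : 0 < e / 2 by rewrite divr_gt0.
  have /cvgrPdist_le/(_ _ e2) near1 := cont2 th.
  have near2 : \forall th' \near th & t \near r, `|g (r *: th) - g (t *: th')| <= e / 2.
    have := near1; case=> -[A B] /= [nA nB] AB.
    by exists (B, A) => //= -[a b] /= [Ba Ab]; exact: (AB (b, a)).
  have near3 : \forall th' \near th & t \near r, `|g (r *: th) - g (r *: th')| <= e / 2.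
    have := near1; case=> -[A B] /= [nA nB] AB.
    exists (B, setT) => /=; first by split => //; exact: filterT.
    move=> [a b] /= [Ba _]; apply: (AB (r, a)); split => //=; exact: nbhs_singleton nA.
  apply: filterS2 near2 near3 => -[th' t] /= h1 h2.
  rewrite -(subrKA (g (r *: th))) (le_trans (ler_normD _ _))//.
  by rewrite distrC (splitr e) lerD.
move=> /nbhs_ballP[d /= d0 dK].
near=> s => y /andP[y1 y2].
have y0 : 0 < enorm y.
  apply: lt_le_trans y1; rewrite lt_min r0 /=.
  by near: s; exact: lt_nbhsr.
have {1}-> : y = enorm y *: ((enorm y)^-1 *: y).
  by rewrite scalerA divff ?scale1r// gt_eqF.
rewrite -scalerA; apply: dK.
  have : `|r - s| < d by near: s; exact: (@near_ball _ _ r d).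
  rewrite /ball/= !ltr_distlC => /andP[? ?].
  move: y1 y2; rewrite ge_min le_max => /orP[?|?] /orP[?|?]; apply/andP; split; lra.
move=> i; rewrite /= in_itv/= -ler_norml.
rewrite (le_trans (coord_le_enorm _ _))// enormZ ger0_norm ?invr_ge0 ?enorm_ge0//.
by rewrite mulVf// gt_eqF.
Unshelve. all: end_near. Qed.

Lemma ball_integral1 s : 0 < s ->
  ball_integral s (fun _ : 'rV[R]_n => 1) = s ^+ n * ball_integral 1 (fun _ : 'rV[R]_n => 1).
Proof. by move=> s0; rewrite ball_integral_scale//; exact: mlb_cst. Qed.

(** Split [g] into [gn], which extends its values on the sphere of radius [r] constantly along rays,
    and a rest [f]. The integral of [gn] is exactly proportional to s^n, which yields the cone
    measure; that of [f] has derivative 0 because [f] is uniformly small near the sphere. *)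
Lemma ball_integral_is_derive (r : R) g : 0 < r -> continuous g ->
  is_derive r 1 (fun s => ball_integral s g) (sphere_integral 0 r g).
Proof.
move=> r0 cg; have r0' := ltW r0.
pose gn (y : 'rV[R]_n) := g ((r / enorm y) *: y).
have mg := mlb_continuous cg.
have mgn : mloc_bounded gn := mlb_normalize r0' mg.
pose f y := g y - gn y.
have mf : mloc_bounded f := mlbB mg mgn.
have df : is_derive r 1 (fun s => ball_integral s f) 0.
  pose k s := ball_integral s (fun _ : 'rV[R]_n => 1).
  apply: (@is_derive0_squeeze _ _ k).
    have : is_derive r 1 (fun s => s ^+ n * ball_integral 1 (fun _ : 'rV[R]_n => 1))
       ((n%:R * r ^+ n.-1) * ball_integral 1 (fun _ : 'rV[R]_n => 1) + r ^+ n * 0).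
      by apply: is_derive_mulr; exact: is_derive_expr.
    move=> H; suff [] : is_derive r 1 k ((n%:R * r ^+ n.-1) * ball_integral 1 (fun _ : 'rV[R]_n => 1) + r ^+ n * 0) by [].
    apply: near_eq_is_derive H.
    by apply: filterS (lt_nbhsr r0) => s s0; rewrite /k (ball_integral1 s0).
  move=> e e0; have := near_sphere_osc r0 e0 cg; apply: filterS => s Hs.
  have [rs|sr] := leP r s.
    have ks : k r <= k s.
      rewrite -subr_ge0 -(pmulr_rge0 _ e0); apply: le_trans (le_norm_shell rs mf _); first exact: normr_ge0.
      move=> y /andP[y1 y2]; apply: Hs; rewrite min_l// max_r// y1 ltW//.
    rewrite [X in e * X]ger0_norm ?subr_ge0//.
    apply: le_norm_shell => // y /andP[y1 y2]; apply: Hs.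
    by rewrite min_l// max_r// y1 ltW.
  have sr' := ltW sr.
  rewrite distrC (distrC (k s)).
  have ks : k s <= k r.
    rewrite -subr_ge0 -(pmulr_rge0 _ e0); apply: le_trans (le_norm_shell sr' mf _); first exact: normr_ge0.
    move=> y /andP[y1 y2]; apply: Hs; rewrite min_r// max_l// y1 ltW//.
  rewrite [X in e * X]ger0_norm ?subr_ge0//.
  apply: le_norm_shell => // y /andP[y1 y2]; apply: Hs.
  by rewrite min_r// max_l// y1 ltW.
have dgn : is_derive r 1 (fun s => ball_integral s gn) (sphere_integral 0 r g).
  have -> : sphere_integral 0 r g = (n%:R * r ^+ n.-1) * ball_integral 1 gn + r ^+ n * 0.
    rewrite mulr0 addr0 /sphere_integral mulrCA mulrA; congr (_ * vol_integral _ _).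
    by apply/funext => y; rewrite add0r.
  have : is_derive r 1 (fun s => s ^+ n * ball_integral 1 gn)
      ((n%:R * r ^+ n.-1) * ball_integral 1 gn + r ^+ n * 0).
    by apply: is_derive_mulr; exact: is_derive_expr.
  apply: near_eq_is_derive; near=> s.
  have s0 : 0 < s by near: s; exact: lt_nbhsr.
  rewrite [RHS]ball_integral_scale//; congr (_ * _); apply: eq_ball_integral => y _.
  rewrite /gn enormZ gtr0_norm// scalerA; congr g.
  have [->|y0] := eqVneq y 0; first by rewrite !scaler0.
  by congr (_ *: _); field; rewrite enorm_eq0 y0 gt_eqF.
have := is_derive_addr df dgn; rewrite add0r.
apply: near_eq_is_derive; near=> s.
rewrite -ball_integralD//; apply: eq_ball_integral => y _.
by rewrite /f subrK.
Unshelve. all: end_near. Qed.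

End polar.

(** * Smooth functions *)

Section smooth_theory.
Variables (R : realType) (n : nat).
Implicit Types (f g : 'rV[R]_n -> R) (y v : 'rV[R]_n).

Lemma smooth_differentiable g y : smooth g -> differentiable g y.
Proof. by move=> /(_ [::] y). Qed.

Lemma smooth_continuous g : smooth g -> continuous g.
Proof. by move=> sg y; apply: differentiable_continuous; exact: smooth_differentiable. Qed.

Lemma smooth_partial i g : smooth g -> smooth (partial i g).
Proof. by move=> sg s y; have := sg (rcons s i) y; rewrite foldr_rcons. Qed.

(** [smooth] quantifies over lists of partial derivatives and gives no induction for products. Here
    the order is the recursion variable, and the product rule lowers it by one. *)
Fixpoint Ck m g : Prop := (forall y, differentiable g y) /\
  match m with 0%N => True | m'.+1 => forall i, Ck m' (partial i g) end.

Lemma smoothP g : smooth g <-> forall m, Ck m g.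
Proof.
split=> [sg m|].
  elim: m g sg => [|m ih] g sg /=.
    by split=> // y; exact: smooth_differentiable.
  by split=> [y|i]; [exact: smooth_differentiable|apply: ih; exact: smooth_partial].
move=> cg s; elim/last_ind: s g cg => [|s i ih] g cg y /=.
  by have [] := cg 0%N.
by rewrite foldr_rcons; apply: ih => m; have [_] := cg m.+1; exact.
Qed.

Lemma CkW m g : Ck m.+1 g -> Ck m g.
Proof.
elim: m g => [|m ih] g; first by case.
by move=> [dg pg]; split=> // i; apply: ih; exact: pg.
Qed.

Lemma is_derive_partial i g y : differentiable g y ->
  is_derive y (delta_mx 0 i) g (partial i g y).
Proof. by move=> dg; apply: derivableP; exact: diff_derivable. Qed.

Lemma partialD i f g y : differentiable f y -> differentiable g y ->
  partial i (fun z => f z + g z) y = partial i f y + partial i g y.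
Proof.
by move=> df dg; have [] := is_derive_addr (is_derive_partial i df) (is_derive_partial i dg).
Qed.

Lemma partialM i f g y : differentiable f y -> differentiable g y ->
  partial i (fun z => f z * g z) y = partial i f y * g y + f y * partial i g y.
Proof.
by move=> df dg; have [] := is_derive_mulr (is_derive_partial i df) (is_derive_partial i dg).
Qed.

Lemma partial_cst i (a : R) : partial i (fun _ => a) = (fun _ : 'rV[R]_n => 0).
Proof. by apply/funext => y; rewrite /partial derive_cst. Qed.

Lemma CkD m f g : Ck m f -> Ck m g -> Ck m (fun y => f y + g y).
Proof.
elim: m f g => [|m ih] f g.
  by move=> [df _] [dg _]; split=> // y; exact: differentiableD.
move=> [df pf] [dg pg]; split=> [y|i]; first exact: differentiableD.
rewrite (_ : partial _ _ = fun y => partial i f y + partial i g y); first by apply: ih; [exact: pf|exact: pg].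
by apply/funext => y; rewrite partialD.
Qed.

Lemma CkM m f g : Ck m f -> Ck m g -> Ck m (fun y => f y * g y).
Proof.
elim: m f g => [|m ih] f g.
  by move=> [df _] [dg _]; split=> // y; exact: differentiableM.
move=> cf cg; have [df pf] := cf; have [dg pg] := cg.
split=> [y|i]; first exact: differentiableM.
rewrite (_ : partial _ _ = fun y => partial i f y * g y + f y * partial i g y).
  by apply: CkD; apply: ih; [exact: pf|exact: CkW|exact: CkW|exact: pg].
by apply/funext => y; rewrite partialM.
Qed.

Lemma smoothD f g : smooth f -> smooth g -> smooth (fun y => f y + g y).
Proof. by move=> /smoothP cf /smoothP cg; apply/smoothP => m; exact: CkD. Qed.

Lemma smoothM f g : smooth f -> smooth g -> smooth (fun y => f y * g y).
Proof. by move=> /smoothP cf /smoothP cg; apply/smoothP => m; exact: CkM. Qed.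

Lemma smooth_cst (a : R) : smooth (fun _ : 'rV[R]_n => a).
Proof.
apply/smoothP => m; elim: m a => [|m ih] a /=; split=> //; try exact: differentiable_cst.
by move=> i; rewrite partial_cst.
Qed.

Lemma partial_coord i j : partial i (fun y : 'rV[R]_n => y 0 j) = (fun _ => (i == j)%:R).
Proof.
apply/funext => y; rewrite /partial.
have : is_derive y (delta_mx 0 i) (fun y : 'rV[R]_n => y 0 j) ((i == j)%:R).
  split; first by apply: diff_derivable; exact: differentiable_coord.
  rewrite /derive; apply: cvg_lim => //.
  apply: cvg_near_cst; near=> t.
  rewrite /= !mxE addrK eqxx /= eq_sym /GRing.scale/= mulKf//.
  by near: t; exact: nbhs_dnbhs_neq.
by case.
Unshelve. all: end_near. Qed.

Lemma smooth_coord j : smooth (fun y : 'rV[R]_n => y 0 j).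
Proof.
have dj (y : 'rV[R]_n) : differentiable (fun y : 'rV[R]_n => y 0 j) y by exact: differentiable_coord.
apply/smoothP => -[|m]; split=> // i.
by rewrite partial_coord; move: m; apply/smoothP; exact: smooth_cst.
Qed.

Lemma smooth_sum (I : Type) (s : seq I) (F : I -> 'rV[R]_n -> R) :
  (forall i, smooth (F i)) -> smooth (fun y => \sum_(i <- s) F i y).
Proof.
move=> sF; elim: s => [|i s ih].
  by under eq_fun do rewrite big_nil; exact: smooth_cst.
by under eq_fun do rewrite big_cons; apply: smoothD.
Qed.

Lemma smoothZ (a : R) g : smooth g -> smooth (fun y => a * g y).
Proof. by move=> sg; apply: smoothM => //; exact: smooth_cst. Qed.

Lemma smoothN g : smooth g -> smooth (fun y => - g y).
Proof. by move=> /(smoothZ (-1)); under eq_fun do rewrite mulN1r. Qed.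

Lemma smoothB f g : smooth f -> smooth g -> smooth (fun y => f y - g y).
Proof. by move=> sf sg; apply: smoothD => //; exact: smoothN. Qed.

Lemma smoothX g m : smooth g -> smooth (fun y => g y ^+ m).
Proof.
move=> sg; elim: m => [|m ih]; first by under eq_fun do rewrite expr0; exact: smooth_cst.
by under eq_fun do rewrite exprS; apply: smoothM.
Qed.

Lemma smooth_dotpp : smooth (fun y : 'rV[R]_n => dotp y y).
Proof. by apply: smooth_sum => i; apply: smoothM; exact: smooth_coord. Qed.

Lemma is_derive_line g y v (t : R) : differentiable g (y + t *: v) ->
  is_derive t 1 (fun s => g (y + s *: v)) ('D_v g (y + t *: v)).
Proof.
move=> dg.
have E : (fun h : R => h^-1 *: (((fun s => g (y + s *: v)) \o shift t) (h *: 1) - g (y + t *: v))) =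
    (fun h : R => h^-1 *: ((g \o shift (y + t *: v)) (h *: v) - g (y + t *: v))).
  apply/funext => h /=; congr (_ *: (g _ - _)).
  by rewrite /GRing.scale/= mulr1 -/(GRing.scale _ _) scalerDl addrCA.
split; first by rewrite /derivable E; exact: diff_derivable.
by rewrite /derive E.
Qed.

Lemma derive_sum_partial g y v : differentiable g y ->
  'D_v g y = \sum_i v 0 i * partial i g y.
Proof.
move=> dg; rewrite deriveE// {1}(row_sum_delta v) linear_sum.
by apply: eq_bigr => i _; rewrite linearZ /= /partial deriveE.
Qed.

(** The mean value theorem twice: along [i] for the difference of [g] on two parallel lines, then
    along [j]. *)
Lemma second_difference g y i j (h : R) : smooth g -> 0 < h ->
  exists c d : R, [/\ c \in `[0, h], d \in `[0, h] &
   g (y + h *: delta_mx 0 i + h *: delta_mx 0 j) - g (y + h *: delta_mx 0 i)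
   - g (y + h *: delta_mx 0 j) + g y =
   h ^+ 2 * partial j (partial i g) (y + c *: delta_mx 0 i + d *: delta_mx 0 j)].
Proof.
move=> sg h0.
set ei := delta_mx 0 i; set ej := delta_mx 0 j.
have line (q : 'rV[R]_n) (f : 'rV[R]_n -> R) v : smooth f -> forall x : R, is_derive x 1 (fun s : R => f (q + s *: v)) ('D_v f (q + x *: v)).
  by move=> sf x; apply: is_derive_line; exact: smooth_differentiable.
pose phi s := g (y + h *: ej + s *: ei) - g (y + s *: ei).
have dphi (x : R) : is_derive x 1 phi (partial i g (y + h *: ej + x *: ei) - partial i g (y + x *: ei)).
  by apply: is_derive_subr; exact: line.
have cphi : {within `[0, h], continuous phi}.
  by apply: derivable_within_continuous => x _; case: (dphi x).
have [c c0h] := MVT_segment (ltW h0) (fun x _ => dphi x) cphi.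
rewrite subr0 => E1.
pose psi s := partial i g (y + c *: ei + s *: ej).
have dpsi (x : R) : is_derive x 1 psi (partial j (partial i g) (y + c *: ei + x *: ej)).
  by apply: line; exact: smooth_partial.
have cpsi : {within `[0, h], continuous psi}.
  by apply: derivable_within_continuous => x _; case: (dpsi x).
have [d d0h] := MVT_segment (ltW h0) (fun x _ => dpsi x) cpsi.
rewrite subr0 => E2.
exists c, d; split => //.
move: E1; rewrite /phi scale0r !addr0 => E1.
move: E2; rewrite /psi scale0r !addr0 => E2.
rewrite (addrAC y (h *: ej) (c *: ei)) E2 (addrAC y (h *: ej) (h *: ei)) in E1.
move: E1; move: (partial j _ _) (g _) (g _) (g _) (g _) => z g1 g2 g3 g4 E1.
rewrite (_ : h ^+ 2 * z = z * h * h); last by ring.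
by rewrite -E1; ring.
Qed.

(** The second difference is symmetric in the two directions, so the two mixed partials take a
    common value at two points near [y]; continuity moves both points to [y]. *)
Lemma partial_comm i j g : smooth g -> partial i (partial j g) = partial j (partial i g).
Proof.
move=> sg; apply/funext => y.
apply/eqP; rewrite -subr_eq0 -normr_le0; apply/ler_addgt0Pr => e e0; rewrite add0r.
set ei := delta_mx 0 i : 'rV[R]_n; set ej := delta_mx 0 j : 'rV[R]_n.
have e2 : 0 < e / 2 by rewrite divr_gt0.
have ca : {for y, continuous (partial i (partial j g))}.
  by apply: smooth_continuous; do 2 apply: smooth_partial.
have cb : {for y, continuous (partial j (partial i g))}.
  by apply: smooth_continuous; do 2 apply: smooth_partial.
have /cvgrPdist_le/(_ _ e2)/nbhs_ballP[d1 /= d10 H1] := ca.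
have /cvgrPdist_le/(_ _ e2)/nbhs_ballP[d2 /= d20 H2] := cb.
pose d := Num.min d1 d2; have d0 : 0 < d by rewrite lt_min d10 d20.
pose K := `|ei| + `|ej| + 1; have K0 : 0 < K by rewrite ltr_pwDr// addr_ge0.
(* With this side length the parallelogram spanned from [y] stays within [d] of [y] in the sup
   norm. *)
pose h := d / K / 2; have h0 : 0 < h by rewrite !divr_gt0.
have inb c c' : c \in `[0, h] -> c' \in `[0, h] -> `|y - (y + c *: ei + c' *: ej)| < d.
  rewrite !in_itv/= => /andP[c0 ch] /andP[c0' ch'].
  rewrite -addrA opprD addNKr normrN (le_lt_trans (ler_normD _ _))// !normrZ !ger0_norm//.
  apply: (@le_lt_trans _ _ (h * `|ei| + h * `|ej|)); first by rewrite lerD// ler_wpM2r.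
  rewrite -mulrDr; apply: (@le_lt_trans _ _ (h * K)).
    by rewrite ler_wpM2l ?(ltW h0)// /K lerDl.
  by rewrite /h mulrAC divfK ?gt_eqF// ltr_pdivrMr// mulr2n mulrDr mulr1 ltrDl.
have [a [b [ha hb E1]]] := second_difference y j i sg h0.
have [a' [b' [ha' hb' E2]]] := second_difference y i j sg h0.
have E : partial i (partial j g) (y + a *: ej + b *: ei) = partial j (partial i g) (y + a' *: ei + b' *: ej).
  apply: (mulfI (_ : h ^+ 2 != 0)); first by rewrite expf_neq0// gt_eqF.
  apply: (etrans (esym E1)); apply: (etrans _ E2).
  by congr (_ + _); rewrite addrAC; congr (g _ - _ - _); exact: addrAC.
have K1 : `|partial i (partial j g) y - partial i (partial j g) (y + a *: ej + b *: ei)| <= e / 2.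
  by apply: H1; rewrite -ball_normE /=; rewrite addrAC; apply: lt_le_trans (inb _ _ hb ha) _; rewrite ge_min lexx.
have K2 : `|partial j (partial i g) y - partial j (partial i g) (y + a' *: ei + b' *: ej)| <= e / 2.
  by apply: H2; rewrite -ball_normE /=; apply: lt_le_trans (inb _ _ ha' hb') _; rewrite ge_min lexx orbT.
rewrite -E in K2.
apply: (le_trans (ler_distD (partial i (partial j g) (y + a *: ej + b *: ei)) _ _)).
by rewrite [X in _ + X]distrC (splitr e); exact: lerD K1 K2.
Qed.

End smooth_theory.

(** * The divergence theorem on balls *)

Section weighted_identity.
Variables (R : realType) (n : nat).
Local Notation rot := (@row_of_tuple R n).
Implicit Types (f g : 'rV[R]_n -> R) (y v : 'rV[R]_n).

Lemma mlb_smooth g : smooth g -> mloc_bounded g.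
Proof. by move=> sg; apply: mlb_continuous; exact: smooth_continuous. Qed.

Lemma mlb_shift v g : mloc_bounded g -> mloc_bounded (fun y => g (y + v)).
Proof.
move=> mg; rewrite (_ : (fun y => _) = fun y => g (v + 1 *: y)); first exact: mlb_affine.
by apply/funext => y; rewrite scale1r addrC.
Qed.

Lemma mlb_max0 g : mloc_bounded g -> mloc_bounded (fun y => Num.max 0 (g y)).
Proof.
move=> [mg bg]; split; first exact: (@measurable_maxr _ _ _ _ (cst 0) (g \o rot)).
move=> M; have [K gK] := bg M; exists K => y /gK; apply: le_trans.
by case: (leP 0 (g y)) => // _; rewrite normr0.
Qed.

Lemma vol_integral_extend (D D' : set 'rV[R]_n) f g :
  D `<=` D' -> (forall y, D y -> f y = g y) -> (forall y, D' y -> ~ D y -> g y = 0) ->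
  vol_integral D f = vol_integral D' g.
Proof.
move=> DD' fg g0; rewrite (eq_vol_integral fg) /vol_integral.
have -> : rot @^-1` D = rot @^-1` D' `&` rot @^-1` D.
  by apply/seteqP; split => t /= => [Dt|[]//]; split => //; exact: DD'.
rewrite Rintegral_mkcondr; apply: eq_Rintegral => t /set_mem /= D't.
rewrite patchE; case: ifPn => //= /negP Dt; rewrite g0// => Dt'; apply: Dt.
by rewrite inE.
Qed.

(** The squared positive part has a Lipschitz derivative. Hence the weight, extended by 0 across the
    sphere, keeps a quadratic Taylor remainder. *)
Lemma max0_sqr_taylor (s d : R) :
  `|Num.max 0 (s + d) ^+ 2 - Num.max 0 s ^+ 2 - 2 * Num.max 0 s * d| <= d ^+ 2.
Proof.
rewrite ler_norml; case: (leP 0 (s + d)) => h1; case: (leP 0 s) => h2; apply/andP; split; nra.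
Qed.

Lemma enorm_delta (i : 'I_n) : enorm (delta_mx 0 i : 'rV[R]_n) = 1.
Proof.
rewrite /enorm /dotp (bigD1 i)//= big1 ?addr0 ?mxE ?eqxx ?mulr1 ?sqrtr1//.
by move=> j ji; rewrite mxE (negPf ji) andbF mul0r.
Qed.

Lemma partial_taylor2 g (i : 'I_n) y (h K M : R) : smooth g ->
  (forall z, enorm z <= M + 1 -> `|partial i (partial i g) z| <= K) ->
  enorm y <= M -> 0 < h <= 1 ->
  `|g (y + h *: delta_mx 0 i) - g y - h * partial i g y| <= K * h ^+ 2.
Proof.
move=> sg bK yM /andP[h0 h1]; set e := delta_mx 0 i.
have line (f : 'rV[R]_n -> R) : smooth f -> forall x : R, is_derive x 1 (fun s : R => f (y + s *: e)) (partial i f (y + x *: e)).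
  by move=> sf x; apply: is_derive_line; exact: smooth_differentiable.
have cline (f : 'rV[R]_n -> R) (b : R) : smooth f -> {within `[0, b], continuous (fun s : R => f (y + s *: e))}.
  by move=> sf; apply: derivable_within_continuous => x _; case: (line f sf x).
have [c ch E1] := MVT_segment (ltW h0) (fun x _ => line g sg x) (cline g h sg).
move: (ch); rewrite in_itv/= => /andP[c0 ch'].
have si := smooth_partial i sg.
have [d dh E2] := MVT_segment c0 (fun x _ => line _ si x) (cline _ c si).
move: dh; rewrite in_itv/= => /andP[d0 dc].
move: E1 E2; rewrite scale0r !addr0 !subr0 => E1 E2.
rewrite E1 (mulrC h) -mulrBl E2 !normrM (gtr0_norm h0) (ger0_norm c0) expr2 -mulrA.
apply: ler_pM => //; first by rewrite mulr_ge0// ltW.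
  apply: bK; rewrite (le_trans (enorm_leD _ _))// lerD//.
  by rewrite enormZ enorm_delta mulr1 ger0_norm// (le_trans dc)// (le_trans ch').
by rewrite ler_wpM2r// ltW.
Qed.

(* The weight vanishes to second order on the sphere of radius [l], so this
   integration by parts only uses the translation invariance of the measure;
   differentiating it twice in [l] gives the divergence theorem. *)
Lemma weighted_divergence (l : R) (i : 'I_n) g : 0 < l -> smooth g ->
  ball_integral l (fun y => (l ^+ 2 - dotp y y) ^+ 2 * partial i g y) =
  ball_integral l (fun y => 4 * (l ^+ 2 - dotp y y) * (y 0 i * g y)).
Proof.
move=> l0 sg; set e := delta_mx 0 i : 'rV[R]_n.
pose s y := l ^+ 2 - dotp y y.
pose w y := s y ^+ 2.
pose sp y := Num.max 0 (s y).
pose wp y := sp y ^+ 2.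
have ss : smooth s by apply: smoothB; [exact: smooth_cst|exact: smooth_dotpp].
have sw : smooth w by exact: smoothX.
have msp : mloc_bounded sp by apply: mlb_max0; exact: mlb_smooth.
have mwp : mloc_bounded wp by apply: mlbM.
have mg := mlb_smooth sg.
have spE y : enorm y < l -> sp y = s y.
  move=> yl; rewrite /sp max_r// subr_ge0 -sqr_enorm ler_pXn2r ?nnegrE ?enorm_ge0//; exact: ltW.
have sp0 y : ~ enorm y < l -> sp y = 0.
  move=> /negP; rewrite -leNgt => ly; rewrite /sp max_l// subr_le0 -sqr_enorm.
  by rewrite ler_pXn2r ?nnegrE ?enorm_ge0//; exact: ltW.
(* [A] is expanded at 0 in two ways: with the shift on [g] its derivative is [P], with the shift on
   the weight it is [Q]. Both remainders are O(h^2), so P = Q. *)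
pose A h := ball_integral l (fun y => w y * g (y + h *: e)).
have sub0 : eball 0 l `<=` eball (0 : 'rV[R]_n) (l + 1).
  by move=> y; rewrite /eball/= => /lt_trans; apply; rewrite ltrDl.
(* For [h] up to 1 every shifted ball lies in the ball of radius [l + 1], and the positive part
   kills the weight outside the shifted ball; the domain no longer depends on [h]. *)
have A1 h : 0 <= h <= 1 -> A h = ball_integral (l + 1) (fun y => wp (y - h *: e) * g y).
  move=> /andP[h0 h1].
  have mF : mloc_bounded (fun y => w (y - h *: e) * g y).
    by apply: mlbM => //; apply: (mlb_shift (- (h *: e))); exact: mlb_smooth.
  transitivity (vol_integral (eball (h *: e) l) (fun y => w (y - h *: e) * g y)).
    rewrite vol_integral_shift//; apply: eq_ball_integral => y _.
    by rewrite (addrC (h *: e)) addrK.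
  apply: vol_integral_extend.
  - move=> y; rewrite /eball/= subr0 => yl.
    rewrite -(subrK (h *: e) y) (le_lt_trans (enorm_leD _ _))// ltr_leD//.
    by rewrite enormZ enorm_delta mulr1 ger0_norm.
  - by move=> y; rewrite /eball/= => yl; rewrite /wp spE.
  - by move=> y _ yl; rewrite /wp sp0// expr0n mul0r.
pose P := ball_integral l (fun y => w y * partial i g y).
pose Q := ball_integral (l + 1) (fun y => 4 * sp y * y 0 i * g y).
have QE : Q = ball_integral l (fun y => 4 * (l ^+ 2 - dotp y y) * (y 0 i * g y)).
  apply/esym/vol_integral_extend => //.
  - by move=> y; rewrite /eball/= subr0 => yl; rewrite spE// mulrA.
  - by move=> y _; rewrite /eball/= subr0 => yl; rewrite sp0// mulr0 !mul0r.
rewrite -QE -/P.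
have mA h : mloc_bounded (fun y => w y * g (y + h *: e)).
  by apply: mlbM; [exact: mlb_smooth|exact: mlb_shift].
have mpg : mloc_bounded (fun y => w y * partial i g y).
  by apply: mlb_smooth; apply: smoothM => //; exact: smooth_partial.
have mB h : mloc_bounded (fun y => wp (y - h *: e) * g y).
  by apply: mlbM => //; exact: (mlb_shift (- (h *: e))).
have mQ : mloc_bounded (fun y => 4 * sp y * y 0 i * g y).
  apply: mlbM => //; apply: mlbM; last by apply: mlb_smooth; exact: smooth_coord.
  exact: mlbZ.
have mA0 : mloc_bounded (fun y => w y * g y) by apply: mlbM => //; exact: mlb_smooth.
have mB0 : mloc_bounded (fun y => wp y * g y) by apply: mlbM.
have A0E : A 0 = ball_integral l (fun y => w y * g y).
  by apply: eq_ball_integral => y _; rewrite scale0r addr0.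
have A0E' : A 0 = ball_integral (l + 1) (fun y => wp y * g y).
  by rewrite A1 ?lexx ?ler01//; apply: eq_ball_integral => y _; rewrite scale0r subr0.
have [K1 HK1] : exists K1, forall h, 0 < h <= 1 -> `|A h - A 0 - h * P| <= K1 * h ^+ 2.
  have [Kw wK] := (mlb_smooth sw).2 l.
  have [Kg gK] := (mlb_smooth (smooth_partial i (smooth_partial i sg))).2 (l + 1).
  exists (Kw * Kg * ball_integral l (fun _ : 'rV[R]_n => 1)) => h h01.
  rewrite A0E /A /P -ball_integralB// -(ball_integralZ _ h)// -ball_integralB//; last 2 first.
  - by apply: mlbB => //.
  - exact: mlbZ.
  rewrite [leRHS]mulrAC; apply: le_norm_ball_integral; first by apply: mlbB; [exact: mlbB|exact: mlbZ].
  move=> y /ltW yl.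
  rewrite (_ : _ - _ = w y * (g (y + h *: e) - g y - h * partial i g y)); last by ring.
  rewrite normrM -mulrA; apply: ler_pM => //; first exact: wK.
  exact: (partial_taylor2 sg gK).
have [K2 HK2] : exists K2, forall h, 0 < h <= 1 -> `|A h - A 0 - h * Q| <= K2 * h ^+ 2.
  have [Kg gK] := (mlb_smooth sg).2 (l + 1).
  (* The shift changes [s y] by d = 2 h y_i - h^2, of size at most (2 (l + 1) + 1) h. The second
     summand bounds the contribution 2 (sp y) h^2 of the h^2 in [d] to the linear term. *)
  pose C := (2 * (l + 1) + 1) ^+ 2 + 2 * l ^+ 2.
  exists (C * Kg * ball_integral (l + 1) (fun _ : 'rV[R]_n => 1)) => h h01.
  have /andP[h0 h1] := h01.
  rewrite A0E' A1; last by rewrite (ltW h0).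
  rewrite /Q -ball_integralB// -(ball_integralZ _ h)// -ball_integralB//; last 2 first.
  - by apply: mlbB => //.
  - exact: mlbZ.
  rewrite [leRHS]mulrAC; apply: le_norm_ball_integral; first by apply: mlbB; [exact: mlbB|exact: mlbZ].
  move=> y /ltW yl.
  rewrite (_ : _ - _ = (wp (y - h *: e) - wp y - h * (4 * sp y * y 0 i)) * g y); last by ring.
  rewrite normrM [leRHS]mulrAC; apply: ler_pM => //; last exact: gK.
  pose d := 2 * h * y 0 i - h ^+ 2.
  have dE : dotp y e = y 0 i.
    rewrite /dotp (bigD1 i)//= big1 ?addr0 ?mxE ?eqxx ?mulr1//.
    by move=> j ji; rewrite mxE (negPf ji) andbF mulr0.
  have eE : dotp e e = 1 by rewrite -sqr_enorm enorm_delta expr1n.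
  have wpE : wp (y - h *: e) = Num.max 0 (s y + d) ^+ 2.
    rewrite /wp /sp; congr (Num.max _ _ ^+ 2); rewrite /s /d.
    by rewrite !(dotpBl, dotpBr, dotpZl, dotpZr) (dotpC e) dE eE; ring.
  have yi : `|y 0 i| <= l + 1 by apply: le_trans yl; exact: coord_le_enorm.
  have T := max0_sqr_taylor (s y) d.
  have sp1 : 0 <= sp y <= l ^+ 2.
    rewrite le_max lexx /= ge_max sqr_ge0 /= /s lerBlDr lerDl; exact: dotpp_ge0.
  move: T; rewrite wpE /wp -/(sp y).
  set X := Num.max 0 _ ^+ 2 - _ => T.
  rewrite (_ : X - _ = (X - 2 * sp y * d) - 2 * sp y * h ^+ 2); last by rewrite /d; ring.
  apply: (le_trans (ler_normB _ _)); rewrite /C [leRHS]mulrDl; apply: lerD.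
    have hd : `|d| <= (2 * (l + 1) + 1) * h.
      rewrite /d (_ : _ - _ = (2 * y 0 i - h) * h); last by ring.
      rewrite normrM (gtr0_norm h0) ler_wpM2r ?(ltW h0)//.
      apply: (le_trans (ler_normB _ _)); rewrite normrM (gtr0_norm h0) ger0_norm//.
      by rewrite lerD// ler_wpM2l.
    apply: (le_trans T); rewrite -exprMn -(real_normK (num_real d)).
    by apply: lerXn2r => //; rewrite nnegrE; apply: le_trans hd.
  have /andP[s0 s1] := sp1.
  have z0 : 0 <= 2 * sp y * h ^+ 2 by rewrite mulr_ge0 ?sqr_ge0// mulr_ge0.
  by rewrite (ger0_norm z0) ler_wpM2r ?sqr_ge0// ler_wpM2l.
apply/eqP; rewrite -subr_eq0 -normr_le0.
have H h : 0 < h <= 1 -> `|P - Q| <= (K1 + K2) * h.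
  move=> h01; have /andP[h0 h1] := h01.
  rewrite -(ler_pM2l h0) -{1}(gtr0_norm h0) -normrM.
  rewrite (_ : h * (P - Q) = (A h - A 0 - h * Q) - (A h - A 0 - h * P)); last by ring.
  apply: (le_trans (ler_normB _ _)).
  rewrite (_ : h * ((K1 + K2) * h) = K2 * h ^+ 2 + K1 * h ^+ 2); last by ring.
  by rewrite lerD// ?HK1// HK2.
apply/ler_addgt0Pr => eps eps0; rewrite add0r.
pose h := Num.min 1 (eps / (`|K1 + K2| + 1)).
have K0 : 0 < `|K1 + K2| + 1 by rewrite ltr_pwDr.
have h0 : 0 < h by rewrite lt_min ltr01 divr_gt0.
apply: (le_trans (H h _)); first by rewrite h0 ge_min lexx.
apply: (@le_trans _ _ ((`|K1 + K2| + 1) * h)).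
  by rewrite ler_wpM2r ?(ltW h0)// (le_trans (ler_norm _))// lerDl.
by rewrite mulrC -ler_pdivlMr// ge_min lexx orbT.
Qed.

End weighted_identity.

(** * Spherical means and the divergence theorem *)

Section null_origin.
Variables (R : realType) (n : nat).
Hypothesis n0 : (0 < n)%N.
Local Notation rot := (@row_of_tuple R n).
Implicit Types (f g h : 'rV[R]_n -> R) (y v : 'rV[R]_n).

(* [0 `^ enorm y], the indicator function of the origin, lets the convention
   [1 / 0 = 0] at the center of the cone measure be ignored. *)
Lemma powR0_enorm y : 0 `^ enorm y = (y == 0)%:R :> R.
Proof.
have [->|y0] := eqVneq y 0; first by rewrite enorm0 powRr0.
by rewrite powR0// enorm_eq0.
Qed.

Lemma mlb_origin : mloc_bounded (fun y => 0 `^ enorm y).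
Proof.
split.
  apply: (measurableT_comp (measurable_powRr 0)).
  exact: (continuous_measurable_row (@continuous_enorm R n)).
by move=> M; exists 1 => y _; rewrite powR0_enorm; case: (_ == _); rewrite ?normr1 ?normr0.
Qed.

Lemma ball_integral_origin (r : R) : 0 < r -> ball_integral r (fun y => 0 `^ enorm y) = 0.
Proof.
have scale (s : R) : 0 < s -> ball_integral s (fun y => 0 `^ enorm y) =
    s ^+ n * ball_integral 1 (fun y => 0 `^ enorm y).
  move=> s0; have := ball_integral_scale s0 mlb_origin.
  rewrite (_ : (fun y => 0 `^ enorm (s *: y)) = (fun y => 0 `^ enorm y)) => [->//|].
  apply/funext => y.
  by rewrite !powR0_enorm scaler_eq0 (gt_eqF s0).
have z : ball_integral 1 (fun y => 0 `^ enorm y) = 0.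
  (* Scaling multiplies this value by 2^n, yet both balls see the same single point; since n > 0 the
     value is 0. *)
  have e : ball_integral 1 (fun y => 0 `^ enorm y) = ball_integral 2 (fun y => 0 `^ enorm y).
    apply: vol_integral_extend => //.
      by move=> y; rewrite /eball/= => /lt_trans; apply; rewrite ltr1n.
    move=> y _; rewrite /eball/= subr0 powR0_enorm; have [->|//] := eqVneq y 0.
    by rewrite enorm0 ltr01.
  move: e; rewrite (scale 2)// => /eqP; rewrite -subr_eq0 -{1}(mul1r (ball_integral _ _)) -mulrBl mulf_eq0.
  move=> /orP[|/eqP//]; rewrite subr_eq0 -natrX -[X in X == _]/(1%:R) eqr_nat.
  by rewrite eq_sym gtn_eqF// -{1}(expn0 2) ltn_exp2l.
by move=> r0; rewrite scale// z mulr0.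
Qed.

Lemma eq_ball_integral_origin (r : R) g h : 0 < r -> mloc_bounded h ->
  (forall y, y != 0 -> g y = h y) -> ball_integral r g = ball_integral r h.
Proof.
move=> r0 mh gh.
transitivity (ball_integral r (fun y => h y + (g 0 - h 0) * 0 `^ enorm y)).
  apply: eq_ball_integral => y _; rewrite powR0_enorm.
  have [->|y0] := eqVneq y 0; first by rewrite mulr1 addrC subrK.
  by rewrite mulr0 addr0 gh.
have mo := mlb_origin.
rewrite ball_integralD//; last exact: mlbZ.
by rewrite ball_integralZ// ball_integral_origin// mulr0 addr0.
Qed.

Lemma eq_sphere_integral (r : R) g h : 0 < r -> mloc_bounded h ->
  (forall y, enorm y = r -> g y = h y) ->
  sphere_integral 0 r g = sphere_integral 0 r h.
Proof.
move=> r0 mh gh; rewrite /sphere_integral; congr (_ * (_ * _)).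
apply: (eq_ball_integral_origin ltr01) => [|y y0].
  rewrite (_ : (fun y => _) = fun y => h ((r / enorm y) *: y)).
    by apply: mlb_normalize; [exact: ltW|].
  by apply/funext => y; rewrite add0r.
rewrite !add0r; apply: gh; rewrite enormZ ger0_norm ?divr_ge0 ?enorm_ge0 ?(ltW r0)//.
by rewrite divfK// enorm_eq0.
Qed.

(** Not normalized: it is the average over the sphere of radius [r] times the area of the unit
    sphere. Without the factor r^(n-1) its derivative involves only [dil g]. *)
Definition sphere_mean g (r : R) : R := sphere_integral 0 1 (fun y => g (r *: y)).

Lemma sphere_integral_mean r g : sphere_integral 0 r g = r ^+ n.-1 * sphere_mean g r.
Proof.
rewrite /sphere_mean /sphere_integral expr1n mul1r; congr (_ * (_ * vol_integral _ _)).
by apply/funext => y; rewrite !add0r scalerA div1r.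
Qed.

Lemma sphere_meanE r g : sphere_mean g r =
  n%:R * ball_integral 1 (fun y => g ((r / enorm y) *: y)).
Proof.
rewrite /sphere_mean /sphere_integral expr1n mul1r; congr (_ * vol_integral _ _).
by apply/funext => y; rewrite !add0r scalerA div1r.
Qed.

Lemma eq_sphere_mean (r : R) g h : 0 < r -> mloc_bounded h ->
  (forall y, enorm y = r -> g y = h y) -> sphere_mean g r = sphere_mean h r.
Proof.
move=> r0 mh /(eq_sphere_integral r0 mh); rewrite !sphere_integral_mean.
by apply: mulfI; rewrite expf_neq0// gt_eqF.
Qed.

Lemma sphere_meanD (r : R) g h : 0 <= r -> mloc_bounded g -> mloc_bounded h ->
  sphere_mean (fun y => g y + h y) r = sphere_mean g r + sphere_mean h r.
Proof.
move=> r0 mg mh; rewrite !sphere_meanE -mulrDr -ball_integralD//.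
- exact: (mlb_normalize r0 mg).
- exact: (mlb_normalize r0 mh).
Qed.

Lemma sphere_meanZ (r : R) a g : 0 <= r -> mloc_bounded g ->
  sphere_mean (fun y => a * g y) r = a * sphere_mean g r.
Proof.
move=> r0 mg; rewrite !sphere_meanE mulrCA -(ball_integralZ _ a)//.
exact: (mlb_normalize r0 mg).
Qed.

Lemma sphere_mean_ge0 (r : R) g : (forall y, 0 <= g y) -> 0 <= sphere_mean g r.
Proof.
by move=> g0; rewrite sphere_meanE mulr_ge0//; apply: Rintegral_ge0 => t _; exact: g0.
Qed.

Lemma is_derive_zero (F : R -> R) (r d : R) : 0 < r -> (forall s, 0 < s -> F s = 0) ->
  is_derive r 1 F d -> d = 0.
Proof.
move=> r0 F0 dF; have : is_derive r 1 (fun _ : R => 0 : R) d.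
  by apply: near_eq_is_derive dF; apply: filterS (lt_nbhsr r0) => s /F0.
by case=> _ <-; rewrite derive_cst.
Qed.

Lemma sphere_integral_dotpp (r : R) g : 0 < r -> smooth g ->
  sphere_integral 0 r (fun y => dotp y y * g y) = r ^+ 2 * sphere_integral 0 r g.
Proof.
move=> r0 sg; have mg := mlb_smooth sg.
rewrite (@eq_sphere_integral _ _ (fun y => r ^+ 2 * g y))//.
- by rewrite !sphere_integral_mean sphere_meanZ ?(ltW r0)//; ring.
- exact: mlbZ.
by move=> y yr; rewrite -sqr_enorm yr.
Qed.

(** Expanded in powers of the radius, the weighted identity is a relation between ball integrals. In
    its first derivative all surface integrals cancel, as [dotp y y] is constant on a sphere; the
    second derivative leaves only the one of y_i g. *)
Lemma divergence_partial (r : R) i g : 0 < r -> smooth g ->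
  ball_integral r (partial i g) = r^-1 * sphere_integral 0 r (fun y => y 0 i * g y).
Proof.
move=> r0 sg.
pose a := partial i g; have sa : smooth a by exact: smooth_partial.
pose b y := y 0 i * g y; have sb : smooth b by apply: smoothM => //; exact: smooth_coord.
pose r2 y := dotp y y : R.
have sr : smooth r2 by exact: smooth_dotpp.
have sra : smooth (fun y => r2 y * a y) by exact: smoothM.
have srra : smooth (fun y => r2 y * (r2 y * a y)) by exact: smoothM.
have srb : smooth (fun y => r2 y * b y) by exact: smoothM.
have dV (s : R) (h : 'rV[R]_n -> R) : 0 < s -> smooth h -> is_derive s 1 (fun s => ball_integral s h) (sphere_integral 0 s h).
  by move=> s0 sh; apply: ball_integral_is_derive => //; exact: smooth_continuous.
pose V (s : R) (h : 'rV[R]_n -> R) := ball_integral s h.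
have E1 s : 0 < s -> s ^+ 4 * V s a - 2 * s ^+ 2 * V s (fun y => r2 y * a y)
    + V s (fun y => r2 y * (r2 y * a y)) - (4 * s ^+ 2 * V s b - 4 * V s (fun y => r2 y * b y)) = 0.
  move=> s0; apply/eqP; rewrite subr_eq0; apply/eqP.
  have := weighted_divergence i s0 sg.
  rewrite (_ : (fun y => _) = fun y => (s ^+ 4 * a y + (- (2 * s ^+ 2)) * (r2 y * a y)) + r2 y * (r2 y * a y)); last first.
    by apply/funext => y; rewrite /a /r2; ring.
  rewrite [in RHS](_ : (fun y => _) = fun y => 4 * s ^+ 2 * b y + (- 4) * (r2 y * b y)); last first.
    by apply/funext => y; rewrite /b /r2; ring.
  have ma := mlb_smooth sa; have mra := mlb_smooth sra; have mrra := mlb_smooth srra.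
  have mb := mlb_smooth sb; have mrb := mlb_smooth srb.
  rewrite !ball_integralD//; try by repeat (first [exact: mlbZ | apply: mlbD]).
  by rewrite !ball_integralZ// !mulNr.
(* This is the derivative of [E1], divided by 4 s. *)
have E2 s : 0 < s -> s ^+ 2 * V s a - V s (fun y => r2 y * a y) - 2 * V s b = 0.
  move=> s0; have := is_derive_zero s0 E1.
  have d1 := is_derive_mulr (is_derive_expr s 4) (dV s _ s0 sa).
  have d2 := is_derive_mulr (is_derive_scaler 2 (is_derive_expr s 2)) (dV s _ s0 sra).
  have d3 := dV s _ s0 srra.
  have d4 := is_derive_mulr (is_derive_scaler 4 (is_derive_expr s 2)) (dV s _ s0 sb).
  have d5 := is_derive_scaler 4 (dV s _ s0 srb).
  have D := is_derive_subr (is_derive_addr (is_derive_subr d1 d2) d3) (is_derive_subr d4 d5).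
  move=> /(_ _ D); rewrite !sphere_integral_dotpp// -!/(V _ _) /=.
  set S := sphere_integral 0 s a; set S' := sphere_integral 0 s b.
  move: (V s a) (V s (fun y => r2 y * a y)) (V s b) S S' => v1 v2 v3 S S' H.
  have : 4 * s * (s ^+ 2 * v1 - v2 - 2 * v3) = 0 by rewrite -[RHS]H; ring.
  have s4 : 4 * s != 0 by rewrite mulf_neq0// gt_eqF.
  by rewrite -[RHS](mulr0 (4 * s)) => /(mulfI s4).
have := is_derive_zero r0 E2.
have d1 := is_derive_mulr (is_derive_expr r 2) (dV r _ r0 sa).
have d2 := dV r _ r0 sra.
have d3 := is_derive_scaler 2 (dV r _ r0 sb).
move=> /(_ _ (is_derive_subr (is_derive_subr d1 d2) d3)).
rewrite !sphere_integral_dotpp// -/a -/b -!/(V _ _) /=.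
move: (sphere_integral 0 r a) (sphere_integral 0 r b) (V r a) => S S' v H.
have : 2 * r * (v - r^-1 * S') = 0.
  by rewrite -[RHS]H; field; rewrite gt_eqF.
have r2' : 2 * r != 0 by rewrite mulf_neq0// gt_eqF.
by rewrite -[RHS](mulr0 (2 * r)) => /(mulfI r2')/eqP; rewrite subr_eq0 => /eqP.
Qed.

End null_origin.

(** * Dilation generator and spherical operators *)

Section operators.
Variables (R : realType) (n : nat).
Implicit Types (f g h : 'rV[R]_n -> R) (y v : 'rV[R]_n).

Lemma partial_coord1 i : partial i (fun y : 'rV[R]_n => y 0 i) = (fun _ => 1).
Proof. by rewrite partial_coord eqxx. Qed.

Lemma partial_coord0 i j : j != i -> partial i (fun y : 'rV[R]_n => y 0 j) = (fun _ => 0).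
Proof. by move=> ji; rewrite partial_coord eq_sym (negPf ji). Qed.

(** The operator D of the overview; [carre] and [ang] below are G and L. *)
Definition dil g : 'rV[R]_n -> R := fun y => \sum_i y 0 i * partial i g y.

Definition gdot g h : 'rV[R]_n -> R := fun y => \sum_i partial i g y * partial i h y.

Definition carre g h : 'rV[R]_n -> R := fun y => dotp y y * gdot g h y - dil g y * dil h y.

Definition ang g : 'rV[R]_n -> R :=
  fun y => dotp y y * lap g y - dil (dil g) y - (n%:R - 2) * dil g y.

Lemma smooth_dil g : smooth g -> smooth (dil g).
Proof.
move=> sg; apply: smooth_sum => i; apply: smoothM; first exact: smooth_coord.
exact: smooth_partial.
Qed.

Lemma smooth_lap g : smooth g -> smooth (lap g).
Proof. by move=> sg; apply: smooth_sum => i; do 2 apply: smooth_partial. Qed.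

Lemma smooth_gdot g h : smooth g -> smooth h -> smooth (gdot g h).
Proof. by move=> sg sh; apply: smooth_sum => i; apply: smoothM; exact: smooth_partial. Qed.

Lemma smooth_carre g h : smooth g -> smooth h -> smooth (carre g h).
Proof.
move=> sg sh; apply: smoothB; apply: smoothM; try exact: smooth_dil.
- exact: smooth_dotpp.
- exact: smooth_gdot.
Qed.

Lemma smooth_ang g : smooth g -> smooth (ang g).
Proof.
move=> sg; apply: smoothB; last by apply: smoothZ; exact: smooth_dil.
apply: smoothB; last by do 2 apply: smooth_dil.
by apply: smoothM; [exact: smooth_dotpp|exact: smooth_lap].
Qed.

Lemma eq_partialD i f g : smooth f -> smooth g ->
  partial i (fun y => f y + g y) = fun y => partial i f y + partial i g y.
Proof. by move=> sf sg; apply/funext => y; apply: partialD; exact: smooth_differentiable. Qed.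

Lemma eq_partialM i f g : smooth f -> smooth g ->
  partial i (fun y => f y * g y) = fun y => partial i f y * g y + f y * partial i g y.
Proof. by move=> sf sg; apply/funext => y; apply: partialM; exact: smooth_differentiable. Qed.

Lemma eq_partialZ i (a : R) g : smooth g ->
  partial i (fun y => a * g y) = fun y => a * partial i g y.
Proof.
move=> sg; rewrite eq_partialM//; last exact: smooth_cst.
by apply/funext => y; rewrite partial_cst mul0r add0r.
Qed.

Lemma eq_partialB i f g : smooth f -> smooth g ->
  partial i (fun y => f y - g y) = fun y => partial i f y - partial i g y.
Proof.
move=> sf sg; rewrite (_ : (fun y => f y - g y) = (fun y => f y + -1 * g y)).
  rewrite eq_partialD ?eq_partialZ//; last exact: smoothZ.
  by apply/funext => y; rewrite mulN1r.
by apply/funext => y; rewrite mulN1r.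
Qed.

Lemma eq_partial_sum (I : Type) (s : seq I) i (F : I -> 'rV[R]_n -> R) :
  (forall j, smooth (F j)) ->
  partial i (fun y => \sum_(j <- s) F j y) = fun y => \sum_(j <- s) partial i (F j) y.
Proof.
move=> sF; elim: s => [|j s ih].
  rewrite (_ : (fun y => _) = fun _ => 0); last by apply/funext => y; rewrite big_nil.
  by rewrite partial_cst; apply/funext => y; rewrite big_nil.
rewrite (_ : (fun y => _) = fun y => F j y + \sum_(j <- s) F j y); last first.
  by apply/funext => y; rewrite big_cons.
rewrite eq_partialD//; last exact: smooth_sum.
by apply/funext => y; rewrite ih big_cons.
Qed.

Lemma partial_dotpp i : partial i (fun y => dotp y y) = fun y => 2 * y 0 i.
Proof.
rewrite eq_partial_sum; last by move=> j; apply: smoothM; exact: smooth_coord.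
apply/funext => y; rewrite (bigD1 i)//= big1 => [|j ji].
  rewrite eq_partialM; try exact: smooth_coord.
  by rewrite partial_coord1; ring.
rewrite eq_partialM; try exact: smooth_coord.
by rewrite partial_coord0//; ring.
Qed.

Lemma dilD f g : smooth f -> smooth g -> dil (fun y => f y + g y) = fun y => dil f y + dil g y.
Proof.
move=> sf sg; apply/funext => y; rewrite /dil -big_split; apply: eq_bigr => i _ /=.
by rewrite eq_partialD// mulrDr.
Qed.

Lemma dilM f g : smooth f -> smooth g ->
  dil (fun y => f y * g y) = fun y => dil f y * g y + f y * dil g y.
Proof.
move=> sf sg; apply/funext => y; rewrite /dil mulr_suml mulr_sumr -big_split.
by apply: eq_bigr => i _ /=; rewrite eq_partialM//; ring.
Qed.

Lemma dilZ (a : R) g : smooth g -> dil (fun y => a * g y) = fun y => a * dil g y.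
Proof.
move=> sg; apply/funext => y; rewrite /dil mulr_sumr; apply: eq_bigr => i _.
by rewrite eq_partialZ// mulrCA.
Qed.

Lemma dilB f g : smooth f -> smooth g -> dil (fun y => f y - g y) = fun y => dil f y - dil g y.
Proof.
move=> sf sg; apply/funext => y; rewrite /dil -sumrB; apply: eq_bigr => i _.
by rewrite eq_partialB// mulrBr.
Qed.

Lemma dil_sum (I : Type) (s : seq I) (F : I -> 'rV[R]_n -> R) :
  (forall j, smooth (F j)) ->
  dil (fun y => \sum_(j <- s) F j y) = fun y => \sum_(j <- s) dil (F j) y.
Proof.
move=> sF; apply/funext => y; rewrite /dil exchange_big/=; apply: eq_bigr => i _.
by rewrite eq_partial_sum// mulr_sumr.
Qed.

Lemma dil_dotpp : dil (fun y => dotp y y) = fun y => 2 * dotp y y.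
Proof.
apply/funext => y; rewrite /dil /dotp mulr_sumr; apply: eq_bigr => i _.
by rewrite -/(dotp _ _) partial_dotpp; ring.
Qed.

Lemma partial_dil i g : smooth g ->
  partial i (dil g) = fun y => partial i g y + dil (partial i g) y.
Proof.
move=> sg; have sp j : smooth (partial j g) by exact: smooth_partial.
rewrite {1}/dil eq_partial_sum; last by move=> j; apply: smoothM => //; exact: smooth_coord.
apply/funext => y; rewrite /dil (bigD1 i)//= [X in _ = _ + X](bigD1 i)//= addrA; congr (_ + _).
  rewrite eq_partialM//; last exact: smooth_coord.
  by rewrite partial_coord1 mul1r.
apply: eq_bigr => j ji; rewrite eq_partialM//; last exact: smooth_coord.
by rewrite partial_coord0// mul0r add0r (partial_comm i j sg).
Qed.

Lemma dil_partial i g : smooth g -> dil (partial i g) = fun y => partial i (dil g) y - partial i g y.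
Proof. by move=> sg; rewrite partial_dil//; apply/funext => y; rewrite addrC addKr. Qed.

Lemma lapD f g : smooth f -> smooth g -> lap (fun y => f y + g y) = fun y => lap f y + lap g y.
Proof.
move=> sf sg; apply/funext => y; rewrite /lap -big_split; apply: eq_bigr => i _ /=.
by rewrite !eq_partialD//; exact: smooth_partial.
Qed.

Lemma lapZ (a : R) g : smooth g -> lap (fun y => a * g y) = fun y => a * lap g y.
Proof.
move=> sg; apply/funext => y; rewrite /lap mulr_sumr; apply: eq_bigr => i _.
by rewrite !eq_partialZ//; exact: smooth_partial.
Qed.

Lemma lap_dil g : smooth g -> lap (dil g) = fun y => dil (lap g) y + 2 * lap g y.
Proof.
move=> sg; have sp j : smooth (partial j g) by exact: smooth_partial.
have spp j : smooth (partial j (partial j g)) by exact: smooth_partial.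
apply/funext => y; rewrite [in dil (lap g)]/lap dil_sum// /lap mulr_sumr -big_split.
apply: eq_bigr => i _ /=.
rewrite partial_dil// eq_partialD//; last exact: smooth_dil.
by rewrite partial_dil//; ring.
Qed.

Lemma lap_dotppM g : smooth g ->
  lap (fun y => dotp y y * g y) = fun y => dotp y y * lap g y + 4 * dil g y + 2 * n%:R * g y.
Proof.
move=> sg; have sr := @smooth_dotpp R n.
have sp j : smooth (partial j g) by exact: smooth_partial.
have sc (j : 'I_n) : smooth (fun y : 'rV[R]_n => y 0 j) by exact: smooth_coord.
apply/funext => y.
transitivity (\sum_i (dotp y y * partial i (partial i g) y + 4 * (y 0 i * partial i g y) + 2 * g y)).
  apply: eq_bigr => i _; rewrite eq_partialM// partial_dotpp.
  have s1 := smoothZ 2 (sc i).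
  rewrite (eq_partialD i (smoothM s1 sg) (smoothM sr (sp i))).
  rewrite (eq_partialM i s1 sg) (eq_partialM i sr (sp i)).
  by rewrite (eq_partialZ i 2 (sc i)) partial_coord1 partial_dotpp; ring.
rewrite !big_split /= -!mulr_sumr /lap /dil; congr (_ + _).
by rewrite sumr_const card_ord -mulr_natr; ring.
Qed.

Lemma gdotC g h y : gdot g h y = gdot h g y.
Proof. by apply: eq_bigr => i _; rewrite mulrC. Qed.

Lemma gdotZl (a : R) f h y : smooth f -> gdot (fun y => a * f y) h y = a * gdot f h y.
Proof.
by move=> sf; rewrite /gdot mulr_sumr; apply: eq_bigr => i _; rewrite eq_partialZ// mulrA.
Qed.

Lemma gdotDl f g h y : smooth f -> smooth g ->
  gdot (fun y => f y + g y) h y = gdot f h y + gdot g h y.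
Proof.
move=> sf sg; rewrite /gdot -big_split; apply: eq_bigr => i _ /=.
by rewrite eq_partialD// mulrDl.
Qed.

Lemma carreC g h : carre g h = carre h g.
Proof. by apply/funext => y; rewrite /carre gdotC (mulrC (dil g y)). Qed.

(** Cauchy-Schwarz for the position vector and the gradient. *)
Lemma carre_ge0 g y : 0 <= carre g g y.
Proof.
rewrite /carre subr_ge0 -expr2.
by have := cauchy_schwarz y (grad g y); rewrite /dotp /gdot /dil; under eq_bigr do rewrite mxE;
   under [X in _ <= _ * X -> _]eq_bigr do rewrite !mxE.
Qed.

Lemma carreZl (a : R) f h : smooth f -> carre (fun y => a * f y) h = fun y => a * carre f h y.
Proof. by move=> sf; apply/funext => y; rewrite /carre dilZ// gdotZl//; ring. Qed.

Lemma carreDl f g h : smooth f -> smooth g ->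
  carre (fun y => f y + g y) h = fun y => carre f h y + carre g h y.
Proof. by move=> sf sg; apply/funext => y; rewrite /carre dilD// gdotDl//; ring. Qed.

Lemma dil_gdot g h : smooth g -> smooth h ->
  dil (gdot g h) = fun y => gdot (dil g) h y + gdot g (dil h) y - 2 * gdot g h y.
Proof.
move=> sg sh; have sP j f : smooth f -> smooth (partial j f) by exact: smooth_partial.
rewrite /gdot dil_sum; last by move=> i; apply: smoothM; exact: sP.
apply/funext => y; rewrite mulr_sumr -big_split -sumrB; apply: eq_bigr => i _ /=.
rewrite (dilM (sP i _ sg) (sP i _ sh)) (dil_partial i sg) (dil_partial i sh).
move: (partial i (dil g) y) (partial i g y) (partial i (dil h) y) (partial i h y) => a b c d.
by ring.
Qed.

(** The form [carre] is invariant under dilations, so their generator acts on it by the Leibniz rule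
    alone, without the extra term of [dil_gdot]. *)
Lemma dil_carre g h : smooth g -> smooth h ->
  dil (carre g h) = fun y => carre (dil g) h y + carre g (dil h) y.
Proof.
move=> sg sh; have sr := @smooth_dotpp R n.
have sdg := smooth_dil sg; have sdh := smooth_dil sh; have sG := smooth_gdot sg sh.
rewrite {1}/carre (dilB (smoothM sr sG) (smoothM sdg sdh)).
rewrite (dilM sr sG) (dilM sdg sdh) dil_gdot// dil_dotpp.
apply/funext => y; rewrite /carre.
move: (gdot (dil g) h y) (gdot g (dil h) y) (gdot g h y) => a b c.
by move: (dil g y) (dil h y) (dil (dil g) y) (dil (dil h) y) (dotp y y) => *; ring.
Qed.

(** Invariance under dilations again: the factor |y|^2 in front of [lap] makes [ang] commute with
    their generator. *)
Lemma dil_ang g : smooth g -> dil (ang g) = ang (dil g).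
Proof.
move=> sg; have sr := @smooth_dotpp R n.
have sD f : smooth f -> smooth (dil f) by exact: smooth_dil.
have sl := smooth_lap sg; have sd := sD _ sg; have sdd := sD _ sd.
rewrite /ang dilB; [|by apply: smoothB => //; exact: smoothM|exact: smoothZ].
rewrite dilB//; last exact: smoothM.
rewrite dilM// dilZ// dil_dotpp lap_dil//; apply/funext => y.
move: (dil (dil (dil g)) y) (dil (dil g) y) (dil (lap g) y) (lap g y) (dotp y y) => *.
by ring.
Qed.

Lemma angD f g : smooth f -> smooth g -> ang (fun y => f y + g y) = fun y => ang f y + ang g y.
Proof.
move=> sf sg; have sD h : smooth h -> smooth (dil h) by exact: smooth_dil.
have sdf := sD _ sf; have sdg := sD _ sg.
apply/funext => y; rewrite /ang lapD// !dilD//.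
move: (dil (dil f) y) (dil (dil g) y) (dil f y) (dil g y) (lap f y) (lap g y) (dotp y y) => *.
by ring.
Qed.

Lemma angZ (a : R) g : smooth g -> ang (fun y => a * g y) = fun y => a * ang g y.
Proof.
move=> sg; have sd := smooth_dil sg.
apply/funext => y; rewrite /ang lapZ// !dilZ//.
by move: (dil (dil g) y) (dil g y) (lap g y) (dotp y y) => *; ring.
Qed.

End operators.

(** * Integration by parts on spheres *)

Section sphere_calculus.
Variables (R : realType) (n : nat).
Hypothesis n0 : (0 < n)%N.
Implicit Types (f g h : 'rV[R]_n -> R) (y v : 'rV[R]_n).

Lemma ball_integral_sum (r : R) (I : Type) (s : seq I) (F : I -> 'rV[R]_n -> R) :
  (forall i, smooth (F i)) ->
  ball_integral r (fun y => \sum_(i <- s) F i y) = \sum_(i <- s) ball_integral r (F i).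
Proof.
move=> sF; elim: s => [|i s ih].
  rewrite big_nil (_ : (fun y => _) = fun y => 0 * (0 : R)).
    by rewrite ball_integralZ ?mul0r//; exact: mlb_cst.
  by apply/funext => y; rewrite big_nil mul0r.
rewrite big_cons -ih -ball_integralD//; try exact: mlb_smooth.
- by congr ball_integral; apply/funext => y; rewrite big_cons.
- by apply: mlb_smooth; exact: smooth_sum.
Qed.

Lemma sphere_mean_sum (r : R) (I : Type) (s : seq I) (F : I -> 'rV[R]_n -> R) :
  0 <= r -> (forall i, smooth (F i)) ->
  sphere_mean (fun y => \sum_(i <- s) F i y) r = \sum_(i <- s) sphere_mean (F i) r.
Proof.
move=> r0 sF; elim: s => [|i s ih].
  rewrite big_nil (_ : (fun y => _) = fun y => 0 * (0 : R)).
    by rewrite sphere_meanZ ?mul0r//; exact: mlb_cst.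
  by apply/funext => y; rewrite big_nil mul0r.
rewrite big_cons -ih -sphere_meanD//; try exact: mlb_smooth.
- by congr sphere_mean; apply/funext => y; rewrite big_cons.
- by apply: mlb_smooth; exact: smooth_sum.
Qed.

Lemma divergence_ball (r : R) (X : 'I_n -> 'rV[R]_n -> R) : 0 < r ->
  (forall i, smooth (X i)) ->
  ball_integral r (fun y => \sum_i partial i (X i) y) =
  r^-1 * sphere_integral 0 r (fun y => \sum_i y 0 i * X i y).
Proof.
move=> r0 sX; rewrite ball_integral_sum; last by move=> i; exact: smooth_partial.
rewrite sphere_integral_mean sphere_mean_sum ?(ltW r0)//; last first.
  by move=> i; apply: smoothM => //; exact: smooth_coord.
rewrite !mulr_sumr; apply: eq_bigr => i _.
by rewrite divergence_partial// sphere_integral_mean.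
Qed.

(** The divergence theorem for the field y g(y). It makes a spherical mean differentiable in the
    radius without differentiating under the integral sign. *)
Lemma sphere_mean_ball (s : R) g : 0 < s -> smooth g ->
  s ^+ n * sphere_mean g s = ball_integral s (fun y => n%:R * g y + dil g y).
Proof.
move=> s0 sg; have sc (j : 'I_n) : smooth (fun y : 'rV[R]_n => y 0 j) by exact: smooth_coord.
rewrite (_ : (fun y => n%:R * g y + dil g y) = fun y => \sum_i partial i (fun y => y 0 i * g y) y).
  rewrite divergence_ball//; last by move=> i; exact: smoothM.
  rewrite (_ : (fun y => \sum_i y 0 i * (y 0 i * g y)) = fun y => dotp y y * g y).
    rewrite sphere_integral_dotpp// sphere_integral_mean.
    by rewrite -{1}(prednK n0) exprS; field; rewrite gt_eqF.
  by apply/funext => y; rewrite /dotp mulr_suml; apply: eq_bigr => i _; rewrite mulrA.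
apply/funext => y; rewrite /dil -[X in X%:R](card_ord n) mulr_natl -sumr_const -big_split.
by apply: eq_bigr => i _ /=; rewrite eq_partialM// partial_coord1 mul1r.
Qed.

Lemma is_derive_sphere_mean (r : R) g : 0 < r -> smooth g ->
  is_derive r 1 (sphere_mean g) (r^-1 * sphere_mean (dil g) r).
Proof.
move=> r0 sg; have sd := smooth_dil sg.
have sH : smooth (fun y => n%:R * g y + dil g y) by apply: smoothD => //; exact: smoothZ.
have dV : is_derive r 1 (fun s => ball_integral s (fun y => n%:R * g y + dil g y))
    (sphere_integral 0 r (fun y => n%:R * g y + dil g y)).
  by apply: ball_integral_is_derive => //; exact: smooth_continuous.
have rn : r ^+ n != 0 by rewrite expf_neq0// gt_eqF.
have dI := @is_deriveV R (fun s : R => s ^+ n) r (n%:R * r ^+ n.-1) 1 rn (is_derive_expr r n).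
have := is_derive_mulr dI dV.
rewrite sphere_integral_mean sphere_meanD ?(ltW r0)//; last 2 first.
- by apply: mlb_smooth; exact: smoothZ.
- exact: mlb_smooth.
rewrite sphere_meanZ ?(ltW r0)//; last exact: mlb_smooth.
rewrite -sphere_mean_ball// /GRing.scale/=.
rewrite [X in is_derive _ _ _ X -> _](_ : _ = r^-1 * sphere_mean (dil g) r); last first.
  rewrite (_ : r ^+ n = r * r ^+ n.-1); last by rewrite -exprS prednK.
  move: (sphere_mean _ _) (sphere_mean _ _) => a b.
  by field; rewrite expf_neq0 gt_eqF.
apply: near_eq_is_derive; apply: filterS (lt_nbhsr r0) => s s0.
by rewrite -sphere_mean_ball// mulKf// expf_neq0// gt_eqF.
Qed.

(** The field has no flux through any sphere, so its divergence integrates to 0 over every ball;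
    differentiate in the radius. *)
Lemma sphere_mean_tangent (r : R) (X : 'I_n -> 'rV[R]_n -> R) : 0 < r ->
  (forall i, smooth (X i)) -> (forall y, \sum_i y 0 i * X i y = 0) ->
  sphere_mean (fun y => \sum_i partial i (X i) y) r = 0.
Proof.
move=> r0 sX X0.
have sD : smooth (fun y => \sum_i partial i (X i) y).
  by apply: smooth_sum => i; exact: smooth_partial.
have z s : 0 < s -> ball_integral s (fun y => \sum_i partial i (X i) y) = 0.
  move=> s0; rewrite divergence_ball// (_ : (fun y => _) = fun y => 0 * (0 : R)); last first.
    by apply/funext => y; rewrite X0 mul0r.
  by rewrite sphere_integral_mean sphere_meanZ ?(ltW s0) ?mul0r ?mulr0//; exact: mlb_cst.
have := is_derive_zero r0 z (ball_integral_is_derive r0 (smooth_continuous sD)).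
rewrite sphere_integral_mean => /eqP; rewrite mulf_eq0 => /orP[|/eqP//].
by rewrite expf_eq0 (gt_eqF r0) andbF.
Qed.

(** Green's formula on spheres: the field g (|y|^2 grad h - y D h) is tangent to every sphere, and
    the integrand is its divergence. *)
Lemma sphere_mean_carre (r : R) g h : 0 < r -> smooth g -> smooth h ->
  sphere_mean (fun y => carre g h y + g y * ang h y) r = 0.
Proof.
move=> r0 sg sh.
have sr := @smooth_dotpp R n.
have sc (j : 'I_n) : smooth (fun y : 'rV[R]_n => y 0 j) by exact: smooth_coord.
have sd := smooth_dil sh.
have sp i : smooth (partial i h) by exact: smooth_partial.
pose Y i y := dotp y y * partial i h y - y 0 i * dil h y.
have sY i : smooth (Y i) by apply: smoothB; apply: smoothM.
have sX i : smooth (fun y => g y * Y i y) by apply: smoothM.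
have X0 y : \sum_i y 0 i * (g y * Y i y) = 0.
  transitivity (g y * (dotp y y * (\sum_i y 0 i * partial i h y) - (\sum_i y 0 i * y 0 i) * dil h y)); last first.
    by rewrite /dil /dotp subrr mulr0.
  rewrite /Y; move: (dil h y) (g y) => d c.
  rewrite mulr_sumr mulr_suml -sumrB mulr_sumr; apply: eq_bigr => i _.
  by move: (partial i h y) => *; ring.
rewrite -(sphere_mean_tangent r0 sX X0); congr sphere_mean; apply/funext => y.
transitivity (\sum_i (partial i g y * Y i y + g y * partial i (Y i) y)); last first.
  by apply: eq_bigr => i _; rewrite (eq_partialM i sg (sY i)).
rewrite big_split /=; congr (_ + _).
  rewrite /carre /gdot [dil g y]/dil /Y; move: (dil h y) => d.
  rewrite mulr_sumr mulr_suml -sumrB; apply: eq_bigr => i _.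
  by move: (partial i h y) (partial i g y) => *; ring.
rewrite -mulr_sumr; congr (_ * _).
transitivity (\sum_i (dotp y y * partial i (partial i h) y + y 0 i * partial i h y
    - dil h y - y 0 i * dil (partial i h) y)).
  rewrite !(sumrB, big_split) /= -mulr_sumr sumr_const card_ord -mulr_natl /ang -/(lap h y) -/(dil h y).
  rewrite (_ : \sum_(i < n) y 0 i * dil (partial i h) y = dil (dil h) y - dil h y).
    by move: (dil (dil h) y) (dil h y) (lap h y) => *; ring.
  rewrite {2}/dil -[X in _ - X]/(\sum_i y 0 i * partial i h y) -sumrB.
  by apply: eq_bigr => i _; rewrite dil_partial// mulrBr.
apply: eq_bigr => i _; rewrite /Y (eq_partialB i (smoothM sr (sp i)) (smoothM (sc i) sd)).
rewrite (eq_partialM i sr (sp i)) (eq_partialM i (sc i) sd) partial_coord1 partial_dotpp partial_dil//.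
by move: (partial i h y) (partial i (partial i h) y) (dil (partial i h) y) (dil h y) => *; ring.
Qed.

End sphere_calculus.

(** * Real powers, scaling and the operators of the unit sphere *)

Section powers.
Variable R : realType.
Implicit Types (a b l : R).

Lemma powR_addn a l n : 0 < l -> l `^ (a + n%:R) = l `^ a * l ^+ n.
Proof. by move=> l0; rewrite powRD ?(gt_eqF l0) ?implybT// powR_mulrn// ltW. Qed.

Lemma powR_subn a l n : 0 < l -> l `^ (a - n%:R) = l `^ a / l ^+ n.
Proof.
move=> l0; rewrite -[in RHS](subrK n%:R a) powR_addn// mulfK//.
by rewrite expf_neq0// gt_eqF.
Qed.

Lemma powR_double a l : 0 < l -> l `^ (2 * a) = l `^ a ^+ 2.
Proof. by move=> l0; rewrite mulr_natl mulr2n powRD ?(gt_eqF l0) ?implybT// expr2. Qed.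

End powers.

Section scaling.
Variables (R : realType) (n : nat).
Implicit Types (f g h u : 'rV[R]_n -> R) (x y v : 'rV[R]_n) (a c l : R).

Lemma partial_shift i x g : partial i (fun y => g (x + y)) = fun y => partial i g (x + y).
Proof.
apply/funext => y; rewrite /partial /derive.
rewrite (_ : (fun t : R => t^-1 *: (((fun y => g (x + y)) \o shift y) (t *: delta_mx 0 i) - g (x + y))) =
  (fun t : R => t^-1 *: ((g \o shift (x + y)) (t *: delta_mx 0 i) - g (x + y))))//.
by apply/funext => t /=; rewrite addrCA.
Qed.

Lemma differentiable_shift x g y : (forall z, differentiable g z) ->
  differentiable (fun y => g (x + y)) y.
Proof.
move=> dg; apply: (@differentiable_comp _ _ _ _ (cst x + id) g); last exact: dg.
by apply: differentiableD.
Qed.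

Lemma smooth_shift x g : smooth g -> smooth (fun y => g (x + y)).
Proof.
move=> /smoothP cg; apply/smoothP => m; elim: m g cg => [|m ih] g cg /=.
  by split=> // y; apply: differentiable_shift; have [] := cg 0%N.
split=> [y|i]; first by apply: differentiable_shift; have [] := cg 0%N.
by rewrite partial_shift; apply: ih => k; have [_] := cg k.+1; exact.
Qed.

Lemma lap_shift x g : lap (fun y => g (x + y)) = fun y => lap g (x + y).
Proof. by apply/funext => y; apply: eq_bigr => i _; rewrite !partial_shift. Qed.

Definition dilation (a : R) g (l : R) : 'rV[R]_n -> R := fun y => l `^ a * g (l *: y).

Lemma rescale0 p u l : rescale p 0 u l = dilation (kexp p) u l.
Proof. by apply/funext => y; rewrite /rescale add0r. Qed.

Lemma derive_dilation g a l i y : differentiable g (l *: y) ->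
  'D_(delta_mx 0 i) (fun y => g (l *: y)) y = l * partial i g (l *: y).
Proof.
move=> dg; rewrite /partial.
transitivity ('D_(l *: delta_mx 0 i) g (l *: y)); last by rewrite !deriveE// linearZ.
rewrite /derive (_ : (fun t : R => t^-1 *: (((fun y => g (l *: y)) \o shift y) (t *: delta_mx 0 i) - g (l *: y))) =
  (fun t : R => t^-1 *: ((g \o shift (l *: y)) (t *: (l *: delta_mx 0 i)) - g (l *: y))))//.
by apply/funext => t /=; rewrite [in LHS](scalerDr l) !scalerA (mulrC t).
Qed.

Lemma partial_dilation a g l i : 0 < l -> smooth g ->
  partial i (dilation a g l) = dilation (a + 1) (partial i g) l.
Proof.
move=> l0 sg; apply/funext => y.
have dg := smooth_differentiable (l *: y) sg.
have dgl : differentiable (fun y => g (l *: y)) y.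
  by apply: (@differentiable_comp _ _ _ _ (fun y => l *: y) g) => //; exact: differentiableZ.
rewrite /dilation (powR_addn a 1 l0) expr1 -mulrA -derive_dilation//.
by have [] := is_derive_scaler (l `^ a) (is_derive_partial i dgl).
Qed.

Lemma smooth_dilation a g l : 0 < l -> smooth g -> smooth (dilation a g l).
Proof.
move=> l0 sg.
have dd b f y : smooth f -> differentiable (dilation b f l) y.
  move=> sf; apply: differentiableM; first exact: differentiable_cst.
  apply: (@differentiable_comp _ _ _ _ (fun y => l *: y) f); first exact: differentiableZ.
  exact: smooth_differentiable.
apply/smoothP => m; elim: m a g sg => [|m ih] a g sg; (split; first by move=> y; exact: dd) => // i.
by rewrite partial_dilation//; apply: ih; exact: smooth_partial.
Qed.

Lemma lap_dilation a g l y : 0 < l -> smooth g ->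
  lap (dilation a g l) y = l `^ a * l ^+ 2 * lap g (l *: y).
Proof.
move=> l0 sg; rewrite /lap mulr_sumr; apply: eq_bigr => i _.
have sp := smooth_partial i sg.
rewrite !partial_dilation// /dilation -addrA -[1 + 1]/(2%:R) powR_addn//.
Qed.

Lemma dil_dilation a g l : 0 < l -> smooth g -> dil (dilation a g l) = dilation a (dil g) l.
Proof.
move=> l0 sg; apply/funext => y; rewrite /dilation /dil mulr_sumr; apply: eq_bigr => i _.
rewrite -/(dilation a g l) partial_dilation// /dilation (powR_addn a 1 l0) expr1 mxE.
by move: (partial _ _ _) => *; ring.
Qed.

Lemma dotpp_scale l y : dotp (l *: y) (l *: y) = l ^+ 2 * dotp y y.
Proof. by rewrite dotpZl dotpZr mulrA expr2. Qed.

Lemma ang_dilation a g l y : 0 < l -> smooth g ->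
  ang (dilation a g l) y = l `^ a * ang g (l *: y).
Proof.
move=> l0 sg; have sd := smooth_dil sg.
rewrite /ang lap_dilation// (dil_dilation a l0 sg) (dil_dilation a l0 sd) /dilation dotpp_scale.
by move: (lap g (l *: y)) (dil (dil g) (l *: y)) (dil g (l *: y)) => *; ring.
Qed.

Lemma gdot_dilation a g l y : 0 < l -> smooth g ->
  gdot (dilation a g l) (dilation a g l) y = (l `^ a) ^+ 2 * l ^+ 2 * gdot g g (l *: y).
Proof.
move=> l0 sg; rewrite /gdot mulr_sumr; apply: eq_bigr => i _.
rewrite partial_dilation// /dilation (powR_addn a 1 l0) expr1.
by move: (partial _ _ _) => *; ring.
Qed.

Lemma carre_dilation a g l y : 0 < l -> smooth g ->
  carre (dilation a g l) (dilation a g l) y = (l `^ a) ^+ 2 * carre g g (l *: y).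
Proof.
move=> l0 sg; rewrite /carre gdot_dilation// dil_dilation// /dilation dotpp_scale.
by ring.
Qed.

Lemma dotp_grad g h y : dotp (grad g y) (grad h y) = gdot g h y.
Proof. by apply: eq_bigr => i _; rewrite !mxE. Qed.

Lemma dotp_grad_dil g y : dotp (grad g y) y = dil g y.
Proof. by apply: eq_bigr => i _; rewrite !mxE mulrC. Qed.

Lemma enorm1_dotpp y : enorm y = 1 -> dotp y y = 1.
Proof. by move=> y1; rewrite -sqr_enorm y1 expr1n. Qed.

Lemma sph_grad_sqr g y : enorm y = 1 -> dotp (sph_grad g y) (sph_grad g y) = carre g g y.
Proof.
move=> /enorm1_dotpp y1; rewrite /sph_grad !(dotpBl, dotpBr, dotpZl, dotpZr).
rewrite (dotpC y) dotp_grad dotp_grad_dil /carre y1.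
by ring.
Qed.

Lemma sph_lap_ang g y : enorm y = 1 -> smooth g -> sph_lap g y = ang g y.
Proof.
move=> /enorm1_dotpp y1 sg.
have sd := smooth_dil sg.
have sc (j : 'I_n) : smooth (fun y : 'rV[R]_n => y 0 j) by exact: smooth_coord.
have sp i : smooth (partial i g) by exact: smooth_partial.
have XE i : (fun z => sph_grad g z 0 i) = (fun z => partial i g z - dil g z * z 0 i).
  by apply/funext => z; rewrite /sph_grad !mxE dotp_grad_dil.
transitivity (\sum_i (partial i (partial i g) y - (y 0 i * partial i (dil g) y) - dil g y
   - y 0 i * partial i (dil g) y + y 0 i * partial i g y
   + (dil (dil g) y + dil g y) * (y 0 i * y 0 i))).
  apply: eq_bigr => i _; rewrite XE /sph_grad !mxE dotp_grad_dil.
  rewrite (eq_partialB i (sp i) (smoothM sd (sc i))) (dilB (sp i) (smoothM sd (sc i))).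
  rewrite (eq_partialM i sd (sc i)) (dilM sd (sc i)) partial_coord1 dil_partial//.
  have -> : dil (fun y0 : 'rV[R]_n => y0 0 i) = fun y => y 0 i.
    apply/funext => z; rewrite /dil (bigD1 i)//= partial_coord1 mulr1 big1 ?addr0//.
    by move=> j ji; rewrite partial_coord0 ?mulr0// eq_sym.
  by move: (dil (dil g) y) (dil g y) (partial i (dil g) y) (partial i g y) (partial i (partial i g) y) => *; ring.
rewrite !(sumrB, big_split) /= -mulr_sumr sumr_const card_ord -mulr_natl.
rewrite -/(dotp y y) -/(lap g y) -/(dil g y) -/(dil (dil g) y) y1 /ang y1.
by move: (dil (dil g) y) (dil g y) (lap g y) => *; ring.
Qed.

Lemma is_derive_dilation a g l y : 0 < l -> smooth g ->
  is_derive l 1 (fun s => dilation a g s y)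
    (l `^ (a - 1) * (a * g (l *: y) + dil g (l *: y))).
Proof.
move=> l0 sg; have d1 := is_derive_powR a l0.
have dg : differentiable g (0 + l *: y) by exact: smooth_differentiable.
have d2 := is_derive_line dg.
have := is_derive_mulr d1 d2; rewrite derive_sum_partial// !add0r.
have -> : \sum_i y 0 i * partial i g (l *: y) = l^-1 * dil g (l *: y).
  rewrite /dil mulr_sumr; apply: eq_bigr => i _; rewrite mxE.
  by move: (partial _ _ _) => *; field; rewrite gt_eqF.
rewrite (_ : _ + _ = l `^ (a - 1) * (a * g (l *: y) + dil g (l *: y))); last first.
  rewrite (powR_subn a 1 l0) expr1; move: (g _) (dil _ _) => *.
  by field; rewrite gt_eqF.
by rewrite (_ : (fun t => _) = fun s => dilation a g s y)//; apply/funext => t; rewrite add0r.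
Qed.

Lemma dlam1_dilation (F : R -> 'rV[R]_n -> R) a g l y : 0 < l -> smooth g ->
  (forall s, 0 < s -> F s y = dilation a g s y) ->
  dlam 1 F l y = l `^ (a - 1) * (a * g (l *: y) + dil g (l *: y)).
Proof.
move=> l0 sg FE; rewrite /dlam derive1n1 derive1E.
have : is_derive l 1 (F^~ y) (l `^ (a - 1) * (a * g (l *: y) + dil g (l *: y))).
  apply: near_eq_is_derive (is_derive_dilation a y l0 sg).
  by apply: filterS (lt_nbhsr l0) => s s0; rewrite FE.
by case.
Qed.

(** Dilations are closed under differentiation in the scale: the exponent drops by one and [g] is
    replaced by a g + D g. This allows iteration up to the fourth derivative. *)
Lemma dlamS_dilation (F : R -> 'rV[R]_n -> R) j a g l y : smooth g ->
  (forall s, 0 < s -> dlam j F s y = dilation a g s y) -> 0 < l ->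
  dlam j.+1 F l y = dilation (a - 1) (fun z => a * g z + dil g z) l y.
Proof.
move=> sg FE l0; rewrite [RHS]/(dilation _ _ _ _) /dilation -(dlam1_dilation l0 sg FE).
by rewrite /dlam derive1nS derive1n1.
Qed.

End scaling.

(** * The volume term *)

Section energy.
Variables (R : realType) (n : nat) (p : R).
Hypothesis n0 : (0 < n)%N.
Hypothesis p1 : 1 < p.
Implicit Types (f g h u : 'rV[R]_n -> R) (x y v : 'rV[R]_n) (a c l : R).
Local Notation k := (kexp p).

Lemma lapN g : smooth g -> lap (fun y => - g y) = fun y => - lap g y.
Proof.
move=> sg; have := lapZ (-1) sg.
rewrite (_ : (fun y => -1 * g y) = fun y => - g y); last by apply/funext => y; rewrite mulN1r.
by move=> ->; apply/funext => y; rewrite mulN1r.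
Qed.

Lemma triharmonicE u : smooth u -> triharmonic_solution p u ->
  forall y, lap (lap (lap u)) y = - (`|u y| `^ (p - 1) * u y).
Proof.
move=> su pde y; have s1 := smooth_lap su.
have e : (fun z => - lap (fun z => - lap u z) z) = lap (lap u).
  by rewrite (lapN s1); apply/funext => z; rewrite opprK.
by rewrite -pde /= e opprK.
Qed.

(** The factor [u y] makes the rule for differentiating the power hold at zeros of [u] too, where
    both sides vanish. As [q] is assumed smooth, the power itself is differentiated only where [u]
    is nonzero. *)
Lemma partial_power i u q y : smooth u -> smooth q ->
  (forall y, q y = - (`|u y| `^ (p - 1) * u y)) ->
  u y * partial i q y = p * q y * partial i u y.
Proof.
move=> su sq qE.
have [uy0|uy0] := eqVneq (u y) 0; first by rewrite qE uy0 !mulr0 oppr0 mulr0 !mul0r.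
set e := delta_mx 0 i : 'rV[R]_n.
pose s := Num.sg (u y).
have sn : s * s = 1 by rewrite /s -expr2 sqr_sg uy0.
(* Near [y] the function [u] keeps its sign [s], so on the line [q] equals - s h^p with h > 0. *)
pose h (t : R) := s * u (y + t *: e).
have [t0 yt0] : exists t0 : R, y + t0 *: e = y by exists 0; rewrite scale0r addr0.
have line (f : 'rV[R]_n -> R) : smooth f -> is_derive t0 1 (fun t : R => f (y + t *: e)) (partial i f y).
  move=> sf; have := @is_derive_line R n f y e t0 (smooth_differentiable _ sf).
  by rewrite yt0.
have dh : is_derive t0 1 h (s * partial i u y) := is_derive_scaler s (line u su).
have h0 : h t0 = `|u y| by rewrite /h yt0 /s -normrEsg.
have h0p : 0 < h t0 by rewrite h0 normr_gt0.
have ch : {for t0, continuous h}.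
  by apply: differentiable_continuous; apply/derivable1_diffP; case: dh.
have nh : \forall t \near t0, 0 < h t.
  have /cvgrPdist_lt/(_ _ h0p) := ch; apply: filterS => t.
  by rewrite ltr_distlC subrr => /andP[].
have d1 : is_derive t0 1 (fun t => - s * h t `^ p) (- s * (p * h t0 `^ (p - 1) * (s * partial i u y))).
  apply: is_derive_scaler.
  exact: (is_derive1_comp (is_derive_powR p h0p) dh).
have d2 : is_derive t0 1 (fun t : R => q (y + t *: e)) (- s * (p * h t0 `^ (p - 1) * (s * partial i u y))).
  apply: near_eq_is_derive d1; apply: filterS nh => t ht.
  rewrite qE.
  have sh : u (y + t *: e) = s * h t by rewrite /h mulrA sn mul1r.
  rewrite sh normrM (gtr0_norm ht) /s normr_sg uy0 mul1r -/s mulNr; congr (- _).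
  rewrite mulrCA; congr (_ * _); rewrite -{3}(powRr1 (ltW ht)) -powRD ?subrK//.
  by rewrite (gt_eqF ht) implybT.
have [_ e1] := line q sq; have [_ e2] := d2.
rewrite -e1 e2 qE h0; move: (`|u y| `^ (p - 1)) => b; move: (partial i u y) => a.
by transitivity (- (s * s) * (p * (b * u y) * a)); [ring|rewrite sn; ring].
Qed.

Lemma dil_triharmonic u y : smooth u -> triharmonic_solution p u ->
  u y * dil (lap (lap (lap u))) y = p * lap (lap (lap u)) y * dil u y.
Proof.
move=> su pde; have s3 := smooth_lap (smooth_lap (smooth_lap su)).
have H i := partial_power i y su s3 (triharmonicE su pde).
move: H; rewrite /dil; move: (p * _) (u y) => c d H.
by rewrite !mulr_sumr; apply: eq_bigr => i _; rewrite mulrCA H mulrCA.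
Qed.

(** The map k + D, the infinitesimal generator of the rescaling of u; F_j is its j-th iterate on
    u. *)
Definition tdil g : 'rV[R]_n -> R := fun y => k * g y + dil g y.

Lemma smooth_tdil g : smooth g -> smooth (tdil g).
Proof. by move=> sg; apply: smoothD; [exact: smoothZ|exact: smooth_dil]. Qed.

(** The equation replaces |u|^(p+1) by - u lap (lap (lap u)), which makes the density smooth and
    explains the plus sign. *)
Definition energy_density u : 'rV[R]_n -> R := fun y =>
  2^-1 * gdot (lap u) (lap u) y + (p + 1)^-1 * (u y * lap (lap (lap u)) y).

Lemma smooth_energy_density u : smooth u -> smooth (energy_density u).
Proof.
move=> su; have s1 := smooth_lap su; have s3 := smooth_lap (smooth_lap s1).
by apply: smoothD; apply: smoothZ; [exact: smooth_gdot|exact: smoothM].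
Qed.

Lemma sum_partialM f g y : smooth f -> smooth g ->
  \sum_i partial i (fun z => f z * partial i g z) y = gdot f g y + f y * lap g y.
Proof.
move=> sf sg; rewrite /gdot /lap mulr_sumr -big_split; apply: eq_bigr => i _ /=.
by rewrite (eq_partialM i sf (smooth_partial i sg)).
Qed.

(** With w = [tdil u], its divergence is grad (lap w) . grad (lap u) + w lap (lap (lap u)), the
    first variation of the energy in the direction w of the rescaling. *)
Definition pohozaev_field u (i : 'I_n) : 'rV[R]_n -> R := fun z =>
  lap (tdil u) z * partial i (lap u) z - lap (lap u) z * partial i (tdil u) z
  + tdil u z * partial i (lap (lap u)) z.

Lemma smooth_pohozaev_field u i : smooth u -> smooth (pohozaev_field u i).
Proof.
move=> su; have s1 := smooth_lap su; have s2 := smooth_lap s1; have sw := smooth_tdil su.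
have swl := smooth_lap sw.
by apply: smoothD; [apply: smoothB|]; apply: smoothM => //; exact: smooth_partial.
Qed.

Lemma lap_tdil u : smooth u -> lap (tdil u) = fun y => (k + 2) * lap u y + dil (lap u) y.
Proof.
move=> su; have sd := smooth_dil su.
rewrite /tdil (lapD (smoothZ k su) sd) (lapZ k su) (lap_dil su); apply/funext => z.
by move: (lap u z) (dil (lap u) z) => *; ring.
Qed.

Lemma pohozaev_algebra (a b q d c e f g1 g2 g3 w E dE : R) :
  E = 2^-1 * a + (p + 1)^-1 * (c * q) -> dE = b - a + q * d ->
  g1 = (k + 2) * a + b -> g3 = g2 -> w = k * c + d ->
  (2 * k + 6) * E + dE = (g1 + e * f) - (g2 + f * e) + (g3 + w * q).
Proof.
move=> -> -> -> -> ->; rewrite /kexp; field.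
by rewrite !gt_eqF// ?subr_gt0// addr_gt0// (lt_trans _ p1).
Qed.

(** Rescaling multiplies both parts of the energy density by the same power 2k + 6, because k (p +
    1) = 2k + 6; so its infinitesimal change is the first variation in the direction [tdil u]. *)
Lemma divergence_pohozaev u : smooth u -> triharmonic_solution p u ->
  (fun y => (2 * k + 6) * energy_density u y + dil (energy_density u) y) =
  (fun y => \sum_i partial i (pohozaev_field u i) y).
Proof.
move=> su pde; apply/funext => y.
have s1 := smooth_lap su; have s2 := smooth_lap s1; have s3 := smooth_lap s2.
have sw := smooth_tdil su; have slw := smooth_lap sw; have sd := smooth_dil su.
have sd1 := smooth_dil s1; have sp f i : smooth f -> smooth (partial i f) by exact: smooth_partial.
transitivity ((gdot (lap (tdil u)) (lap u) y + lap (tdil u) y * lap (lap u) y)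
   - (gdot (lap (lap u)) (tdil u) y + lap (lap u) y * lap (tdil u) y)
   + (gdot (tdil u) (lap (lap u)) y + tdil u y * lap (lap (lap u)) y)); last first.
  transitivity (\sum_i partial i (fun z => lap (tdil u) z * partial i (lap u) z) y
    - \sum_i partial i (fun z => lap (lap u) z * partial i (tdil u) z) y
    + \sum_i partial i (fun z => tdil u z * partial i (lap (lap u)) z) y).
    congr (_ - _ + _); apply/esym.
    - exact: sum_partialM slw s1.
    - exact: sum_partialM s2 sw.
    - exact: sum_partialM sw s2.
  rewrite -sumrB -big_split; apply: eq_bigr => i _.
  have m1 := smoothM slw (sp _ i s1); have m2 := smoothM s2 (sp _ i sw).
  have m3 := smoothM sw (sp _ i s2).
  by rewrite /pohozaev_field (eq_partialD i (smoothB m1 m2) m3) (eq_partialB i m1 m2).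
have lw := lap_tdil su.
have gw : gdot (lap (tdil u)) (lap u) y = (k + 2) * gdot (lap u) (lap u) y + gdot (dil (lap u)) (lap u) y.
  by rewrite lw (gdotDl _ _ (smoothZ (k + 2) s1) sd1) (gdotZl _ _ _ s1).
have de : dil (energy_density u) y = gdot (dil (lap u)) (lap u) y - gdot (lap u) (lap u) y
    + lap (lap (lap u)) y * dil u y.
  have m1 := smooth_gdot s1 s1; have m2 := smoothM su s3.
  rewrite /energy_density (dilD (smoothZ _ m1) (smoothZ _ m2)) (dilZ _ m1) (dilZ _ m2).
  rewrite (dilM su s3) (dil_gdot s1 s1) [gdot (lap u) (dil (lap u)) y]gdotC.
  have uq := dil_triharmonic y su pde.
  rewrite uq; move: (gdot _ _ y) (gdot _ _ y) (lap _ y) (dil u y) => a b c d.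
  by field; rewrite gt_eqF// addr_gt0// (lt_trans _ p1).
exact: (@pohozaev_algebra (gdot (lap u) (lap u) y) (gdot (dil (lap u)) (lap u) y)
  (lap (lap (lap u)) y) (dil u y) (u y) (lap (tdil u) y) (lap (lap u) y)
  (gdot (lap (tdil u)) (lap u) y) (gdot (lap (lap u)) (tdil u) y)
  (gdot (tdil u) (lap (lap u)) y) (tdil u y) (energy_density u y)
  (dil (energy_density u) y) (erefl _) de gw (gdotC _ _ _) (erefl _)).
Qed.

(** This is |y|^4 times the product of [pohozaev_field] with y. The power of |y| matches the order
    of the derivatives, so that the flux becomes a polynomial in dilation-invariant operators. *)
Definition pohozaev_flux u : 'rV[R]_n -> R := fun y => dotp y y ^+ 2 *
  (lap (tdil u) y * dil (lap u) y - lap (lap u) y * dil (tdil u) y + tdil u y * dil (lap (lap u)) y).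

Lemma sum_lincomb3 (a b c : R) (t f g h : 'I_n -> R) :
  \sum_i t i * (a * f i - b * g i + c * h i) =
  a * (\sum_i t i * f i) - b * (\sum_i t i * g i) + c * (\sum_i t i * h i).
Proof.
rewrite !mulr_sumr -sumrB -big_split; apply: eq_bigr => i _ /=.
by move: (t i) (f i) (g i) (h i) => *; ring.
Qed.

Lemma is_derive_energy u l : 0 < l -> smooth u -> triharmonic_solution p u ->
  is_derive l 1 (fun s => s `^ (2 * k + 6 - n%:R) * ball_integral s (energy_density u))
    (l `^ (2 * k - 1) * sphere_mean (pohozaev_flux u) l).
Proof.
move=> l0 su pde; have se := smooth_energy_density su; have sde := smooth_dil se.
have mse := mlb_smooth se; have msde := mlb_smooth sde.
have dV := ball_integral_is_derive l0 (smooth_continuous se).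
have := is_derive_mulr (is_derive_powR (2 * k + 6 - n%:R) l0) dV.
rewrite sphere_integral_mean.
(* By [sphere_mean_ball] the first term is the ball integral of n e + D e; together with the second
   it gives (2k + 6) e + D e, a divergence. *)
have H : l ^+ n * sphere_mean (energy_density u) l + (2 * k + 6 - n%:R) * ball_integral l (energy_density u) =
    l^-1 * (l ^+ n.-1 * (l^-1 ^+ 4 * sphere_mean (pohozaev_flux u) l)).
  rewrite (sphere_mean_ball n0 l0 se) -ball_integralZ// -ball_integralD//; last 2 first.
  - by apply: mlbD => //; exact: mlbZ.
  - exact: mlbZ.
  transitivity (ball_integral l (fun y => \sum_i partial i (pohozaev_field u i) y)).
    rewrite -divergence_pohozaev//; congr ball_integral; apply/funext => y.
    by move: (energy_density u y) (dil _ y) => *; ring.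
  rewrite divergence_ball//; last by move=> i; exact: smooth_pohozaev_field.
  rewrite sphere_integral_mean; congr (_ * (_ * _)).
  have sx : smooth (fun y => \sum_i y 0 i * pohozaev_field u i y).
    by apply: smooth_sum => i; apply: smoothM; [exact: smooth_coord|exact: smooth_pohozaev_field].
  rewrite (@eq_sphere_mean _ _ n0 l (pohozaev_flux u) (fun y => l ^+ 4 * \sum_i y 0 i * pohozaev_field u i y))//.
  - rewrite sphere_meanZ ?(ltW l0)//; last exact: mlb_smooth.
    by rewrite mulrA -exprMn mulVf ?gt_eqF// expr1n mul1r.
  - by apply: mlbZ; exact: mlb_smooth.
  move=> y yl; rewrite /pohozaev_flux -sqr_enorm yl -exprM; congr (_ * _).
  exact: (esym (sum_lincomb3 _ _ _ (fun i => y 0 i) (fun i => partial i (lap u) y)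
    (fun i => partial i (tdil u) y) (fun i => partial i (lap (lap u)) y))).
rewrite [X in is_derive _ _ _ X](_ : _ = l `^ (2 * k - 1) * sphere_mean (pohozaev_flux u) l)//.
rewrite (powR_subn (2 * k + 6 - n%:R) 1 l0) (powR_subn (2 * k + 6) n l0) (powR_addn (2 * k) 6 l0).
rewrite (powR_subn (2 * k) 1 l0).
have ln : l ^+ n != 0 by rewrite expf_neq0// gt_eqF.
have E : l ^+ n.-1 = l ^+ n / l by rewrite -{2}(prednK n0) exprS mulrC mulKf// gt_eqF.
rewrite E in H *.
move: (l `^ (2 * k)) (ball_integral _ _) (sphere_mean (energy_density u) l) (sphere_mean (pohozaev_flux u) l) (l ^+ n) ln H => A V S Z L L0 H.
transitivity ((A * l ^+ 5 / L) * (L * S + (2 * k + 6 - n%:R) * V)).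
  by field; rewrite L0 gt_eqF.
by rewrite H; field; rewrite L0 gt_eqF.
Qed.

End energy.

(** * The quadratic form *)

Section quadratic_form.
Variables (R : realType) (n : nat) (p : R).
Implicit Types (f g h u : 'rV[R]_n -> R) (x y v : 'rV[R]_n) (a c l : R).
Local Notation k := (kexp p).
Local Notation N := (n%:R : R).
Local Notation tdil := (@tdil R n p).

(** The factor |y|^2 makes it commute with [tdil], as [ang] does; [bilapr] is the analogue of order
    four. *)
Definition lapr g : 'rV[R]_n -> R := fun y => dotp y y * lap g y.

Lemma smooth_lapr g : smooth g -> smooth (lapr g).
Proof. by move=> sg; apply: smoothM; [exact: smooth_dotpp|exact: smooth_lap]. Qed.

Lemma tdilE g y : tdil g y = k * g y + dil g y.
Proof. by []. Qed.

Lemma dil_tdil g y : dil g y = tdil g y - k * g y.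
Proof. by rewrite /tdil addrC addKr. Qed.

Lemma tdil_ang g : smooth g -> tdil (ang g) = ang (tdil g).
Proof.
move=> sg; rewrite /tdil (angD (smoothZ k sg) (smooth_dil sg)) (angZ k sg).
by rewrite (dil_ang sg).
Qed.

Lemma tdil_lapr g : smooth g -> tdil (lapr g) = lapr (tdil g).
Proof.
move=> sg; apply/funext => y; rewrite /lapr (lap_tdil p sg) {1}/tdil.
rewrite (dilM (@smooth_dotpp R n) (smooth_lap sg)) dil_dotpp.
by move: (lap g y) (dil (lap g) y) => *; ring.
Qed.

Lemma lapr_expand g : smooth g -> lapr g = fun y =>
  ang g y + tdil (tdil g) y + (N - 2 - 2 * k) * tdil g y + (k ^+ 2 - (N - 2) * k) * g y.
Proof.
move=> sg; have sd := smooth_dil sg; apply/funext => y.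
have dt : dil (tdil g) y = k * dil g y + dil (dil g) y.
  by rewrite (dilD (smoothZ k sg) sd) (dilZ k sg).
rewrite /ang /lapr (tdilE (tdil g)) dt tdilE.
by move: (dil (dil g) y) (dil g y) (lap g y) => *; ring.
Qed.

Definition bilapr g : 'rV[R]_n -> R := fun y => dotp y y ^+ 2 * lap (lap g) y.

Lemma dotpp_dil_lap g y : smooth g ->
  dotp y y * dil (lap g) y = lapr (tdil g) y - (k + 2) * lapr g y.
Proof.
move=> sg; rewrite /lapr (lap_tdil p sg).
by move: (lap g y) (dil (lap g) y) => *; ring.
Qed.

Lemma dotpp_dil_bilap g y : smooth g ->
  dotp y y ^+ 2 * dil (lap (lap g)) y = bilapr (tdil g) y - (k + 4) * bilapr g y.
Proof.
move=> sg; have s1 := smooth_lap sg; rewrite /bilapr (lap_tdil p sg).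
rewrite (lapD (smoothZ (k + 2) s1) (smooth_dil s1)) (lapZ (k + 2) s1) (lap_dil s1).
by move: (lap (lap g) y) (dil (lap (lap g)) y) => *; ring.
Qed.

(** The outer Laplacian in [lapr (lapr g)] also hits the factor |y|^2; the terms of lower order
    subtracted here come from that. *)
Lemma bilapr_expand g y : smooth g -> bilapr g y =
  lapr (lapr g) y - 4 * (lapr (tdil g) y - k * lapr g y) + (8 - 2 * N) * lapr g y.
Proof.
move=> sg; have s1 := smooth_lap sg.
have -> : lapr (lapr g) y = dotp y y ^+ 2 * lap (lap g) y + 4 * (dotp y y * dil (lap g) y) + 2 * N * lapr g y.
  rewrite {1}/lapr [in lap (lapr g)]/lapr (lap_dotppM s1) /lapr.
  by move: (lap (lap g) y) (dil (lap g) y) (lap g y) => *; ring.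
rewrite (dotpp_dil_lap y sg) /bilapr.
by move: (lap (lap g) y) (lapr (tdil g) y) (lapr g y) => *; ring.
Qed.

Lemma ang_lapr g y : smooth g -> ang (lapr g) y =
  ang (ang g) y + ang (tdil (tdil g)) y + (N - 2 - 2 * k) * ang (tdil g) y
  + (k ^+ 2 - (N - 2) * k) * ang g y.
Proof.
move=> sg; have s1 := smooth_tdil p sg; have s2 := smooth_tdil p s1; have sa := smooth_ang sg.
have t1 := smoothD sa s2.
have t2 := smoothZ (N - 2 - 2 * k) s1; have t3 := smoothZ (k ^+ 2 - (N - 2) * k) sg.
rewrite (lapr_expand sg) (angD (smoothD t1 t2) t3) (angD t1 t2) (angD sa s2).
by rewrite (angZ _ s1) (angZ _ sg).
Qed.

Lemma lapr_lapr g y : smooth g -> lapr (lapr g) y =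
  ang (lapr g) y + lapr (tdil (tdil g)) y + (N - 2 - 2 * k) * lapr (tdil g) y
  + (k ^+ 2 - (N - 2) * k) * lapr g y.
Proof.
move=> sg; rewrite {1}(lapr_expand (smooth_lapr sg)).
by rewrite (tdil_lapr sg) (tdil_lapr (smooth_tdil p sg)).
Qed.

(* [h'] is the density of [l d/dl] of the spherical integral of [l ^ (2 k) h (l y)] *)
Definition scaling_derivative h h' : Prop :=
  smooth h /\ forall y, 2 * k * h y + dil h y = h' y.

Lemma scaling_derivativeD f f' g g' :
  scaling_derivative f f' -> scaling_derivative g g' ->
  scaling_derivative (fun y => f y + g y) (fun y => f' y + g' y).
Proof.
move=> [sf fE] [sg gE]; split; first exact: smoothD.
by move=> y; rewrite (dilD sf sg) -fE -gE; ring.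
Qed.

Lemma scaling_derivativeZ a f f' : scaling_derivative f f' ->
  scaling_derivative (fun y => a * f y) (fun y => a * f' y).
Proof.
move=> [sf fE]; split; first exact: smoothZ.
by move=> y; rewrite (dilZ a sf) -fE; ring.
Qed.

Lemma scaling_derivativeM f g : smooth f -> smooth g ->
  scaling_derivative (fun y => f y * g y) (fun y => tdil f y * g y + f y * tdil g y).
Proof.
move=> sf sg; split; first exact: smoothM.
by move=> y; rewrite (dilM sf sg) /tdil; ring.
Qed.

Lemma carre_tdil f g y : smooth f -> carre (tdil f) g y = k * carre f g y + carre (dil f) g y.
Proof.
move=> sf; rewrite -[carre (tdil f) g]/(carre (fun y => k * f y + dil f y) g).
by rewrite (carreDl g (smoothZ k sf) (smooth_dil sf)) (carreZl k g sf).
Qed.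

Lemma scaling_derivative_carre f g : smooth f -> smooth g ->
  scaling_derivative (carre f g) (fun y => carre (tdil f) g y + carre f (tdil g) y).
Proof.
move=> sf sg; split; first exact: smooth_carre.
move=> y; rewrite (dil_carre sf sg) (carre_tdil _ _ sf) (carreC f (tdil g)) (carre_tdil _ _ sg).
rewrite (carreC g f) (carreC (dil g) f).
by move: (carre f g y) (carre (dil f) g y) (carre f (dil g) y) => *; ring.
Qed.

End quadratic_form.

(** * The pointwise identity for the derivative *)

Section monotonicity_identity.
Variables (R : realType) (n : nat) (p : R).
Implicit Types (f g h u : 'rV[R]_n -> R) (x y v : 'rV[R]_n) (a c l : R).
Local Notation k := (kexp p).
Local Notation N := (n%:R : R).
Local Notation tdil := (@tdil R n p).
Local Notation d1 := (delta1 n p).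
Local Notation d2 := (delta2 n p).
Local Notation d4 := (delta4 n p).
Local Notation b := (beta n p - N + 4).

Variable al : R.

(* [a_ij] and [b_ij] are the coefficients of F_i F_j and of G(F_i, F_j) in the
   derivative of the uncorrected functional, after elimination of [lap] by
   |y|^2 lap u = L u + F_2 + (N - 2 - 2 k) F_1 + (k^2 - (N - 2) k) u;
   [corr_ij] are the corrections, as coefficients of F_i F_j. *)
Definition a11 : R := 3 * N ^+ 2 * k ^+ 2 + 12 * N ^+ 2 * k + 8 * N ^+ 2 - 6 * N * k ^+ 3
  - 48 * N * k ^+ 2 - 104 * N * k - 48 * N + 3 * k ^+ 4 + 36 * k ^+ 3 + 140 * k ^+ 2
  + 192 * k + 64.
Definition a12 : R := - 2 * N ^+ 2 * k + 4 * N ^+ 2 + 6 * N * k ^+ 2 - 16 * N * k - 56 * N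
  - 4 * k ^+ 3 + 12 * k ^+ 2 + 120 * k + 140.
Definition a13 : R := - 2 * N * k + 2 * k ^+ 2 + 4 * k + 8.
Definition a23 : R := 2 * N - 4 * k - 16.
Definition a22 : R := - N ^+ 2 + 8 * N * k + 24 * N - 8 * k ^+ 2 - 56 * k - 60.
Definition b11 : R := 6 * N * k + 12 * N - 6 * k ^+ 2 - 36 * k - 48.
Definition b12 : R := 4 * k - 2 * N - 4.

Definition corr11 : R := a12 / 2.
Definition corr12 : R := a13 - al.
Definition corr22 : R := a23 / 2.

(** Completing the square in F_3 costs al^2 / 12 in F_1^2. It also creates (al / 3) F_1 L F_1, whose
    mean is that of - (al / 3) G(F_1, F_1) and which [coef_carre1] restores. The correction [corr12]
    of F_1 F_2 removes a13 - al from the coefficient of F_2^2. *)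
Definition coef_sq1 : R := a11 - al ^+ 2 / 12.
Definition coef_sq2 : R := a22 - a13 + al.
Definition coef_carre1 : R := b11 + al / 3.

Definition boundary_density u : 'rV[R]_n -> R := fun y =>
  ((k + 2) / 2) * (lapr u y * lapr u y)
  + (-1) * (tdil u y * tdil (tdil (tdil (tdil u))) y)
  + (10 - d1) * (tdil u y * tdil (tdil (tdil u)) y)
  + (7 * d1 - d2 - 27 - corr12) * (tdil u y * tdil (tdil u) y)
  + (66 - 16 * d1 + 4 * d2 - corr11) * (tdil u y * tdil u y)
  + (2) * (tdil (tdil u) y * tdil (tdil (tdil u)) y)
  + (d1 - 14 - corr22) * (tdil (tdil u) y * tdil (tdil u) y)
  + (d4) * (u y * tdil u y)
  + (2 * d4) * (u y * u y)
  + (2) * (ang u y * ang u y)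
  + (1) * (ang u y * ang (tdil u) y)
  + (- (4 * b)) * carre u u y
  + (- (2 * b)) * carre u (tdil u) y
  + (-8) * carre (tdil u) (tdil u) y
  + (2) * carre (tdil u) (tdil (tdil u)) y.

Lemma boundary_density_derivative u : smooth u -> scaling_derivative p (boundary_density u) (fun y =>
  ((k + 2) / 2) * (tdil (lapr u) y * lapr u y + lapr u y * tdil (lapr u) y)
  + (-1) * (tdil (tdil u) y * tdil (tdil (tdil (tdil u))) y + tdil u y * tdil (tdil (tdil (tdil (tdil u)))) y)
  + (10 - d1) * (tdil (tdil u) y * tdil (tdil (tdil u)) y + tdil u y * tdil (tdil (tdil (tdil u))) y)
  + (7 * d1 - d2 - 27 - corr12) * (tdil (tdil u) y * tdil (tdil u) y + tdil u y * tdil (tdil (tdil u)) y)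
  + (66 - 16 * d1 + 4 * d2 - corr11) * (tdil (tdil u) y * tdil u y + tdil u y * tdil (tdil u) y)
  + (2) * (tdil (tdil (tdil u)) y * tdil (tdil (tdil u)) y + tdil (tdil u) y * tdil (tdil (tdil (tdil u))) y)
  + (d1 - 14 - corr22) * (tdil (tdil (tdil u)) y * tdil (tdil u) y + tdil (tdil u) y * tdil (tdil (tdil u)) y)
  + (d4) * (tdil u y * tdil u y + u y * tdil (tdil u) y)
  + (2 * d4) * (tdil u y * u y + u y * tdil u y)
  + (2) * (tdil (ang u) y * ang u y + ang u y * tdil (ang u) y)
  + (1) * (tdil (ang u) y * ang (tdil u) y + ang u y * tdil (ang (tdil u)) y)
  + (- (4 * b)) * (carre (tdil u) u y + carre u (tdil u) y)
  + (- (2 * b)) * (carre (tdil u) (tdil u) y + carre u (tdil (tdil u)) y)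
  + (-8) * (carre (tdil (tdil u)) (tdil u) y + carre (tdil u) (tdil (tdil u)) y)
  + (2) * (carre (tdil (tdil u)) (tdil (tdil u)) y + carre (tdil u) (tdil (tdil (tdil u))) y)).
Proof.
move=> su; have s1 := smooth_tdil p su; have s2 := smooth_tdil p s1; have s3 := smooth_tdil p s2.
have s4 := smooth_tdil p s3; have sl := smooth_lapr su; have sa := smooth_ang su; have sa1 := smooth_ang s1.
do 14 (apply: scaling_derivativeD; last by apply: scaling_derivativeZ;
  first [exact: scaling_derivativeM | exact: scaling_derivative_carre]).
by apply: scaling_derivativeZ; exact: scaling_derivativeM.
Qed.

Definition remainder_density u : 'rV[R]_n -> R := fun y =>
  3 * (tdil (tdil (tdil u)) y + (al * tdil u y + 2 * ang (tdil u) y) / 6) ^+ 2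
  + coef_sq1 * tdil u y ^+ 2 + coef_carre1 * carre (tdil u) (tdil u) y
  + b12 * carre (tdil u) (tdil (tdil u)) y + 4 * carre (tdil (tdil u)) (tdil (tdil u)) y
  + coef_sq2 * tdil (tdil u) y ^+ 2 + 8 / 3 * ang (tdil u) y ^+ 2.

(* Every summand has zero mean on spheres, as [ang] is symmetric with Dirichlet
   form [- carre]. *)
Definition null_density u : 'rV[R]_n -> R := fun y =>
  (8 * N * k + 8 * N - 8 * k ^+ 2 - 32 * k - 32) * (carre u (tdil u) y + u y * ang (tdil u) y)
  + (2 * N * k + 2 * N - 2 * k ^+ 2 - 8 * k - 8) * (carre u (tdil (tdil u)) y + u y * ang (tdil (tdil u)) y)
  + (- 4 * N * k - 10 * N + 4 * k ^+ 2 + 28 * k - al / 3 + 40) * (carre (tdil u) (tdil u) y + tdil u y * ang (tdil u) y)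
  + (2 * N - 4 * k - 12) * (carre (tdil u) (tdil (tdil u)) y + tdil u y * ang (tdil (tdil u)) y)
  + (2) * (carre (tdil u) (tdil (tdil (tdil u))) y + tdil u y * ang (tdil (tdil (tdil u))) y)
  + (-2) * (carre (tdil (tdil u)) (tdil (tdil u)) y + tdil (tdil u) y * ang (tdil (tdil u)) y)
  + (8 * N * k + 8 * N - 8 * k ^+ 2 - 32 * k - 32) * (tdil u y * ang u y - u y * ang (tdil u) y)
  + (2 * N * k + 2 * N - 2 * k ^+ 2 - 8 * k - 8) * (tdil (tdil u) y * ang u y - u y * ang (tdil (tdil u)) y)
  + (4) * (tdil (tdil u) y * ang (tdil u) y - tdil u y * ang (tdil (tdil u)) y)
  + (-4) * (tdil u y * ang (ang u) y - ang u y * ang (tdil u) y)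
  + (1) * (tdil u y * ang (ang (tdil u)) y - ang (tdil u) y * ang (tdil u) y)
  + (-1) * (tdil (tdil u) y * ang (ang u) y - ang u y * ang (tdil (tdil u)) y).

(** All values at one point are replaced by real variables: [fj] for F_j, [lj] for L F_j, [mj] for
    |y|^2 lap F_j, [bj] for |y|^4 lap (lap F_j), [gij] for G(F_i, F_j), a doubled letter for an
    operator applied twice. The hypotheses encode the commutation rules and the elimination of
    [lap]; a polynomial identity remains. *)
Lemma monotonicity_algebra (tm0 tl0 tl1 f0 f1 f2 f3 f4 f5 l0 l1 l2 l3 ll0 ll1 m0 m1 m2 m3 mm0 mm1 b0 b1
    g01 g10 g02 g11 g12 g21 g13 g22 : R) :
  tm0 = m1 ->
  tl0 = l1 ->
  tl1 = l2 ->
  m0 = l0 + f2 + (N - 2 - 2 * k) * f1 + (k ^+ 2 - (N - 2) * k) * f0 ->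
  m1 = l1 + f3 + (N - 2 - 2 * k) * f2 + (k ^+ 2 - (N - 2) * k) * f1 ->
  m2 = l2 + f4 + (N - 2 - 2 * k) * f3 + (k ^+ 2 - (N - 2) * k) * f2 ->
  m3 = l3 + f5 + (N - 2 - 2 * k) * f4 + (k ^+ 2 - (N - 2) * k) * f3 ->
  mm0 = ll0 + l2 + (N - 2 - 2 * k) * l1 + (k ^+ 2 - (N - 2) * k) * l0 + m2 + (N - 2 - 2 * k) * m1 + (k ^+ 2 - (N - 2) * k) * m0 ->
  mm1 = ll1 + l3 + (N - 2 - 2 * k) * l2 + (k ^+ 2 - (N - 2) * k) * l1 + m3 + (N - 2 - 2 * k) * m2 + (k ^+ 2 - (N - 2) * k) * m1 ->
  b0 = mm0 - 4 * (m1 - k * m0) + (8 - 2 * N) * m0 ->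
  b1 = mm1 - 4 * (m2 - k * m1) + (8 - 2 * N) * m1 ->
  g10 = g01 ->
  g21 = g12 ->
  (m1 * (m1 - (k + 2) * m0) - b0 * (f2 - k * f1) + f1 * (b1 - (k + 4) * b0))
  + (((k + 2) / 2) * (tm0 * m0 + m0 * tm0)
  + (-1) * (f2 * f4 + f1 * f5)
  + (10 - d1) * (f2 * f3 + f1 * f4)
  + (7 * d1 - d2 - 27 - corr12) * (f2 * f2 + f1 * f3)
  + (66 - 16 * d1 + 4 * d2 - corr11) * (f2 * f1 + f1 * f2)
  + (2) * (f3 * f3 + f2 * f4)
  + (d1 - 14 - corr22) * (f3 * f2 + f2 * f3)
  + (d4) * (f1 * f1 + f0 * f2)
  + (2 * d4) * (f1 * f0 + f0 * f1)
  + (2) * (tl0 * l0 + l0 * tl0)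
  + (1) * (tl0 * l1 + l0 * tl1)
  + (- (4 * b)) * (g10 + g01)
  + (- (2 * b)) * (g11 + g02)
  + (-8) * (g21 + g12)
  + (2) * (g22 + g13)) =
  (3 * (f3 + (al * f1 + 2 * l1) / 6) ^+ 2
  + coef_sq1 * f1 ^+ 2 + coef_carre1 * g11 + b12 * g12 + 4 * g22
  + coef_sq2 * f2 ^+ 2 + 8 / 3 * l1 ^+ 2)
  + ((8 * N * k + 8 * N - 8 * k ^+ 2 - 32 * k - 32) * (g01 + f0 * l1)
  + (2 * N * k + 2 * N - 2 * k ^+ 2 - 8 * k - 8) * (g02 + f0 * l2)
  + (- 4 * N * k - 10 * N + 4 * k ^+ 2 + 28 * k - al / 3 + 40) * (g11 + f1 * l1)
  + (2 * N - 4 * k - 12) * (g12 + f1 * l2)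
  + (2) * (g13 + f1 * l3)
  + (-2) * (g22 + f2 * l2)
  + (8 * N * k + 8 * N - 8 * k ^+ 2 - 32 * k - 32) * (f1 * l0 - f0 * l1)
  + (2 * N * k + 2 * N - 2 * k ^+ 2 - 8 * k - 8) * (f2 * l0 - f0 * l2)
  + (4) * (f2 * l1 - f1 * l2)
  + (-4) * (f1 * ll0 - l0 * l1)
  + (1) * (f1 * ll1 - l1 * l1)
  + (-1) * (f2 * ll0 - l0 * l2)).
Proof.
move=> -> -> -> -> -> -> -> -> -> -> -> -> ->.
rewrite /coef_sq1 /coef_sq2 /coef_carre1 /corr11 /corr12 /corr22 /a11 /a12 /a13 /a22 /a23 /b11 /b12.
rewrite /delta1 /delta2 /delta4 /beta; move: k N => K M.
by field.
Qed.

End monotonicity_identity.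

(** * Integration of the identity over spheres *)

Section monotonicity_mean.
Variables (R : realType) (n : nat) (p : R).
Hypothesis n0 : (0 < n)%N.
Implicit Types (f g h u : 'rV[R]_n -> R) (x y v : 'rV[R]_n) (a c l : R).
Local Notation k := (kexp p).
Local Notation N := (n%:R : R).
Local Notation tdil := (@tdil R n p).
Variable al : R.

Lemma flux_algebra (d a b c e f g x1 x2 x3 : R) :
  d * b = x1 -> d ^+ 2 * g = x2 -> e = x3 ->
  d ^+ 2 * (a * b - c * e + f * g) = (d * a) * x1 - (d ^+ 2 * c) * x3 + f * x2.
Proof. by move=> <- <- <-; ring. Qed.

Lemma pohozaev_flux_expand u y : smooth u -> pohozaev_flux p u y =
  lapr (tdil u) y * (lapr (tdil u) y - (k + 2) * lapr u y)
  - bilapr u y * (tdil (tdil u) y - k * tdil u y)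
  + tdil u y * (bilapr (tdil u) y - (k + 4) * bilapr u y).
Proof.
move=> su.
exact: (@flux_algebra (dotp y y) (lap (tdil u) y) (dil (lap u) y) (lap (lap u) y)
  (dil (tdil u) y) (tdil u y) (dil (lap (lap u)) y) _ _ _
  (dotpp_dil_lap p y su) (dotpp_dil_bilap p y su) (dil_tdil p (tdil u) y)).
Qed.

Lemma monotonicity_density u y : smooth u ->
  pohozaev_flux p u y + (2 * k * boundary_density p al u y + dil (boundary_density p al u) y) =
  remainder_density p al u y + null_density p al u y.
Proof.
move=> su; have [_ dE] := boundary_density_derivative p al su.
have s1 := smooth_tdil p su; have s2 := smooth_tdil p s1; have s3 := smooth_tdil p s2.
have M g : smooth g -> lapr g y = ang g y + tdil (tdil g) y
    + (N - 2 - 2 * k) * tdil g y + (k ^+ 2 - (N - 2) * k) * g y.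
  by move=> sg; rewrite {1}(lapr_expand p sg).
have MM g : smooth g -> lapr (lapr g) y =
    ang (ang g) y + ang (tdil (tdil g)) y + (N - 2 - 2 * k) * ang (tdil g) y
    + (k ^+ 2 - (N - 2) * k) * ang g y + lapr (tdil (tdil g)) y + (N - 2 - 2 * k) * lapr (tdil g) y
    + (k ^+ 2 - (N - 2) * k) * lapr g y.
  by move=> sg; rewrite (lapr_lapr p y sg) (ang_lapr p y sg).
apply: (etrans (congr1 (fun z => pohozaev_flux p u y + z) (dE y))).
apply: (etrans (congr1 (fun z => z + _) (pohozaev_flux_expand y su))).
exact: (@monotonicity_algebra R n p al
    (tdil (lapr u) y) (tdil (ang u) y) (tdil (ang (tdil u)) y) (u y) ((tdil u) y)
    ((tdil (tdil u)) y) ((tdil (tdil (tdil u))) y) ((tdil (tdil (tdil (tdil u)))) y)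
    ((tdil (tdil (tdil (tdil (tdil u))))) y) (ang u y) (ang (tdil u) y) (ang (tdil (tdil u)) y)
    (ang (tdil (tdil (tdil u))) y) (ang (ang u) y) (ang (ang (tdil u)) y) (lapr u y)
    (lapr (tdil u) y) (lapr (tdil (tdil u)) y) (lapr (tdil (tdil (tdil u))) y) (lapr (lapr u) y)
    (lapr (lapr (tdil u)) y) (bilapr u y) (bilapr (tdil u) y) (carre u (tdil u) y)
    (carre (tdil u) u y) (carre u (tdil (tdil u)) y) (carre (tdil u) (tdil u) y)
    (carre (tdil u) (tdil (tdil u)) y) (carre (tdil (tdil u)) (tdil u) y)
    (carre (tdil u) (tdil (tdil (tdil u))) y) (carre (tdil (tdil u)) (tdil (tdil u)) y)
    (congr1 (@^~ y) (tdil_lapr p su)) (congr1 (@^~ y) (tdil_ang p su)) (congr1 (@^~ y) (tdil_ang p s1))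
    (M _ su) (M _ s1) (M _ s2) (M _ s3) (MM _ su) (MM _ s1)
    (bilapr_expand p y su) (bilapr_expand p y s1)
    (congr1 (@^~ y) (carreC _ _)) (congr1 (@^~ y) (carreC _ _))).
Qed.

Definition null_mean h : Prop := smooth h /\ forall r : R, 0 < r -> sphere_mean h r = 0.

Lemma null_meanD f g : null_mean f -> null_mean g -> null_mean (fun y => f y + g y).
Proof.
move=> [sf f0] [sg g0]; split; first exact: smoothD.
move=> r r0; rewrite (sphere_meanD (ltW r0) (mlb_smooth sf) (mlb_smooth sg)).
by rewrite (f0 r r0) (g0 r r0) addr0.
Qed.

Lemma null_meanZ a f : null_mean f -> null_mean (fun y => a * f y).
Proof.
move=> [sf f0]; split; first exact: smoothZ.
by move=> r r0; rewrite (sphere_meanZ a (ltW r0) (mlb_smooth sf)) (f0 r r0) mulr0.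
Qed.

Lemma null_mean_carre f g : smooth f -> smooth g -> null_mean (fun y => carre f g y + f y * ang g y).
Proof.
move=> sf sg; split; last by move=> r r0; exact: sphere_mean_carre.
by apply: smoothD; [exact: smooth_carre|apply: smoothM => //; exact: smooth_ang].
Qed.

(** Two Green formulas are subtracted; the Dirichlet terms cancel by symmetry of [carre]. *)
Lemma null_mean_ang f g : smooth f -> smooth g -> null_mean (fun y => f y * ang g y - g y * ang f y).
Proof.
move=> sf sg.
have H := null_meanD (null_mean_carre sf sg) (null_meanZ (-1) (null_mean_carre sg sf)).
rewrite (_ : (fun y => f y * ang g y - g y * ang f y) =
  (fun y => carre f g y + f y * ang g y + -1 * (carre g f y + g y * ang f y)))//.
apply/funext => y; rewrite (carreC g f).
by move: (carre f g y) (f y * ang g y) (g y * ang f y) => *; ring.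
Qed.

Lemma null_mean_null_density u : smooth u -> null_mean (null_density p al u).
Proof.
move=> su; have s1 := smooth_tdil p su; have s2 := smooth_tdil p s1; have s3 := smooth_tdil p s2.
have a0 := smooth_ang su; have a1 := smooth_ang s1.
do 11 (apply: null_meanD; last by apply: null_meanZ;
  first [exact: null_mean_carre | exact: null_mean_ang]).
by apply: null_meanZ; exact: null_mean_carre.
Qed.

Lemma smooth_remainder_density u : smooth u -> smooth (remainder_density p al u).
Proof.
move=> su; have s1 := smooth_tdil p su; have s2 := smooth_tdil p s1; have s3 := smooth_tdil p s2.
have a1 := smooth_ang s1.
have m1 : smooth (fun y => (al * tdil u y + 2 * ang (tdil u) y) / 6).
  by apply: smoothM; [apply: smoothD; exact: smoothZ|exact: smooth_cst].
have c11 := smooth_carre s1 s1; have c12 := smooth_carre s1 s2; have c22 := smooth_carre s2 s2.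
do 6 (apply: smoothD; last by apply: smoothZ => //; exact: smoothX).
by apply: smoothZ; apply: smoothX; exact: smoothD.
Qed.

Lemma remainder_density_ge u y : smooth u ->
  0 <= coef_sq2 n p al -> (b12 n p / 4) ^+ 2 <= coef_carre1 n p al ->
  coef_sq1 n p al * tdil u y ^+ 2 <= remainder_density p al u y.
Proof.
move=> su q0 q1; have s1 := smooth_tdil p su; have s2 := smooth_tdil p s1.
(* The value for which 4 G(F_2 + s F_1, F_2 + s F_1) has the cross term [b12]; its G(F_1, F_1) part
   is then (b12 / 4)^2, which [coef_carre1] dominates. *)
pose s := b12 n p / 8.
have H : 0 <= carre (tdil (tdil u)) (tdil (tdil u)) y + 2 * s * carre (tdil u) (tdil (tdil u)) y
     + s ^+ 2 * carre (tdil u) (tdil u) y.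
  have := carre_ge0 (fun z => tdil (tdil u) z + s * tdil u z) y.
  have ss := smoothZ s s1.
  rewrite (carreDl _ s2 ss) (carreZl _ _ s1).
  rewrite (carreC (tdil (tdil u)) (fun z => _)) (carreC (tdil u) (fun z => _)).
  rewrite !(carreDl _ s2 ss) !(carreZl _ _ s1) (carreC (tdil (tdil u)) (tdil u)).
  by move: (carre _ _ y) (carre _ _ y) (carre _ _ y) => x1 x2 x3; congr (0 <= _); ring.
have G := carre_ge0 (tdil u) y.
rewrite /remainder_density; move: H G; rewrite /s.
move: (carre (tdil (tdil u)) (tdil (tdil u)) y) (carre (tdil u) (tdil (tdil u)) y) (carre (tdil u) (tdil u) y).
move: (tdil (tdil (tdil u)) y) (tdil (tdil u) y) (tdil u y) (ang (tdil u) y).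
move: (coef_sq1 n p al) (coef_sq2 n p al) (coef_carre1 n p al) (b12 n p) q0 q1.
move=> A1 A2 P1 B q0 q1 f3 f2 f1 l1 x1 x2 x3 H G.
have h1 := mulr_ge0 q0 (sqr_ge0 f2).
have h2 : 0 <= (P1 - (B / 4) ^+ 2) * x3 by rewrite mulr_ge0// subr_ge0.
have h3 := sqr_ge0 (f3 + (al * f1 + 2 * l1) / 6); have h4 := sqr_ge0 l1.
move: (f3 + _) h3 => X h3.
have e : (B / 4) ^+ 2 = 4 * (B / 8) ^+ 2 by field.
rewrite e mulrBl in h2; rewrite -subr_ge0.
have e2 : 3 * X ^+ 2 + A1 * f1 ^+ 2 + P1 * x3 + B * x2 + 4 * x1 + A2 * f2 ^+ 2 + 8 / 3 * l1 ^+ 2 - A1 * f1 ^+ 2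
  = 3 * X ^+ 2 + (P1 * x3 - 4 * (B / 8) ^+ 2 * x3) + 4 * (x1 + 2 * (B / 8) * x2 + (B / 8) ^+ 2 * x3)
    + A2 * f2 ^+ 2 + 8 / 3 * l1 ^+ 2 by field.
rewrite e2; apply: addr_ge0; first (apply: addr_ge0; first (apply: addr_ge0; first apply: addr_ge0)) => //.
- exact: mulr_ge0.
- exact: mulr_ge0.
- by apply: mulr_ge0; rewrite ?divr_ge0.
Qed.

Lemma sphere_mean_monotonicity u (r : R) : 0 < r -> smooth u ->
  0 <= coef_sq2 n p al -> (b12 n p / 4) ^+ 2 <= coef_carre1 n p al ->
  coef_sq1 n p al * sphere_mean (fun y => tdil u y ^+ 2) r <=
  sphere_mean (pohozaev_flux p u) r +
  sphere_mean (fun y => 2 * k * boundary_density p al u y + dil (boundary_density p al u) y) r.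
Proof.
move=> r0 su q0 q1; have r0' := ltW r0.
have [sN N0] := null_mean_null_density su; have sR := smooth_remainder_density su.
have s1 := smooth_tdil p su; have s11 : smooth (fun y => tdil u y ^+ 2) by exact: smoothX.
have sf : smooth (pohozaev_flux p u).
  have l1 := smooth_lap s1; have l0 := smooth_lap su; have ll := smooth_lap l0.
  apply: smoothM; first by apply: smoothX; exact: smooth_dotpp.
  by apply: smoothD; [apply: smoothB|]; apply: smoothM => //; exact: smooth_dil.
have [sB BE] := boundary_density_derivative p al su.
have sB' : smooth (fun y => 2 * k * boundary_density p al u y + dil (boundary_density p al u) y).
  by apply: smoothD; [exact: smoothZ|exact: smooth_dil].
rewrite -(sphere_meanD r0' (mlb_smooth sf) (mlb_smooth sB')).
have -> : (fun y => pohozaev_flux p u y + (2 * k * boundary_density p al u y + dil (boundary_density p al u) y)) =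
   (fun y => remainder_density p al u y + null_density p al u y).
  by apply/funext => y; exact: monotonicity_density.
rewrite (sphere_meanD r0' (mlb_smooth sR) (mlb_smooth sN)) (N0 r r0) addr0.
rewrite -(sphere_meanZ _ r0' (mlb_smooth s11)) -subr_ge0.
have sD := smoothZ (-1) (smoothZ (coef_sq1 n p al) s11).
have := sphere_meanD r0' (mlb_smooth sR) (mlb_smooth sD).
rewrite (sphere_meanZ (-1) r0' (mlb_smooth (smoothZ (coef_sq1 n p al) s11))) mulN1r => <-.
apply: sphere_mean_ge0 => y; rewrite mulN1r subr_ge0; exact: remainder_density_ge.
Qed.

End monotonicity_mean.

(** * The boundary term *)

Section boundary_term.
Variables (R : realType) (n : nat) (p : R).
Implicit Types (f g h u : 'rV[R]_n -> R) (x y v : 'rV[R]_n) (a c l : R).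
Local Notation k := (kexp p).
Local Notation N := (n%:R : R).
Local Notation tdil := (@tdil R n p).
Variable al : R.

(* The form [corr11 F1^2 + corr12 F1 F2 + corr22 F2^2] expressed through
   [l f' = F1] and [l^2 f'' = F2 - F1], up to the factor [l ^ k]. *)
Definition correction (i j : 'I_3) : R :=
  match nat_of_ord i, nat_of_ord j with
  | 1, 1 => corr11 n p + corr12 n p al + corr22 n p
  | 1, 2 | 2, 1 => (corr12 n p al + 2 * corr22 n p) / 2
  | 2, 2 => corr22 n p
  | _, _ => 0
  end.

Lemma eq_dilation a a' g g' l y : a = a' -> (forall z, g z = g' z) ->
  dilation a g l y = dilation a' g' l y.
Proof. by move=> -> gE; rewrite /dilation gE. Qed.

(** [P] stands for l^k, [qj] for the j-th derivative of u^l, [fj] for F_j. The numbers 3, 2 and 6,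
    11, 6 are Stirling numbers: l^j d^j/dl^j is a falling factorial of l d/dl, which acts on u^l as
    [tdil] acts on u. *)
Lemma E_boundary_algebra (b d1 d2 d4 K x11 x12 x22 l P P1 P2 P3 P4 L q0 q1 q2 q3 q4 m c00 c01 c11 c12 a0 a1
    f0 f1 f2 f3 f4 S dS G0 dG0 G1 dG1 : R) : l != 0 ->
  P1 = P / l -> P2 = P / l ^+ 2 -> P3 = P / l ^+ 3 -> P4 = P / l ^+ 4 ->
  q0 = P * f0 -> q1 = P1 * f1 -> q2 = P2 * (f2 - f1) -> q3 = P3 * (f3 - 3 * f2 + 2 * f1) ->
  q4 = P4 * (f4 - 6 * f3 + 11 * f2 - 6 * f1) -> L = P * m ->
  S = P * a0 -> dS = P ^+ 2 / l * (2 * (a0 * a1)) ->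
  G0 = P ^+ 2 * c00 -> dG0 = P ^+ 2 / l * (2 * c01) ->
  G1 = P1 ^+ 2 * c11 -> dG1 = P1 ^+ 2 / l * (2 * c12 - 2 * c11) ->
  (K + 2) / 2 * L ^+ 2 - l ^+ 5 * q4 * q1 + 2 * l ^+ 5 * q3 * q2 - (d1 - 6) * l ^+ 4 * q3 * q1
  - (24 - 6 * d1 + d2) * l ^+ 3 * q2 * q1 - (9 * d1 - 3 * d2 - 36) * l ^+ 2 * q1 ^+ 2
  + (d1 - 8) * l ^+ 4 * q2 ^+ 2 + d4 * l * q0 * q1 + 2 * d4 * q0 ^+ 2 + 2 * S ^+ 2
  + 2^-1 * l * dS - 4 * b * G0 - b * l * dG0 - 6 * l ^+ 2 * G1 + l ^+ 3 * dG1
  - ((x11 + x12 + x22) * l ^+ 2 * q1 * q1 + (x12 + 2 * x22) / 2 * l ^+ 3 * q1 * q2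
     + ((x12 + 2 * x22) / 2 * l ^+ 3 * q2 * q1 + x22 * l ^+ 4 * q2 * q2)) =
  P ^+ 2 * ((K + 2) / 2 * (m * m) + -1 * (f1 * f4) + (10 - d1) * (f1 * f3)
    + (7 * d1 - d2 - 27 - x12) * (f1 * f2) + (66 - 16 * d1 + 4 * d2 - x11) * (f1 * f1)
    + 2 * (f2 * f3) + (d1 - 14 - x22) * (f2 * f2) + d4 * (f0 * f1) + 2 * d4 * (f0 * f0)
    + 2 * (a0 * a0) + 1 * (a0 * a1) + - (4 * b) * c00 + - (2 * b) * c01 + -8 * c11 + 2 * c12).
Proof.
move=> l0 -> -> -> -> -> -> -> -> -> -> -> -> -> -> -> ->.
by field.
Qed.

Section radial_derivatives.
Variable u : 'rV[R]_n -> R.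
Hypothesis su : smooth u.
Let F := rescale p 0 u.
Let s1 := smooth_tdil p su.
Let s2 := smooth_tdil p s1.
Let s3 := smooth_tdil p s2.

Lemma dlam1_rescale l y : 0 < l -> dlam 1 F l y = dilation (k - 1) (tdil u) l y.
Proof.
move=> l0; have F0 (s : R) (_ : 0 < s) : dlam 0 F s y = dilation k u s y.
  by rewrite /F /dlam /= rescale0.
exact: (dlamS_dilation su F0 l0).
Qed.

Lemma dlam2_rescale l y : 0 < l ->
  dlam 2 F l y = dilation (k - 2) (fun z => tdil (tdil u) z - tdil u z) l y.
Proof.
move=> l0; have F1 (s : R) (s0 : 0 < s) := dlam1_rescale y s0.
rewrite (dlamS_dilation s1 F1 l0); apply: eq_dilation => [|z]; first by ring.
by rewrite (dil_tdil p (tdil u)); move: (tdil (tdil u) z) (tdil u z) => *; ring.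
Qed.

Lemma dlam3_rescale l y : 0 < l -> dlam 3 F l y = dilation (k - 3)
  (fun z => tdil (tdil (tdil u)) z - 3 * tdil (tdil u) z + 2 * tdil u z) l y.
Proof.
move=> l0; have F2 (s : R) (s0 : 0 < s) := dlam2_rescale y s0.
rewrite (dlamS_dilation (smoothB s2 s1) F2 l0); apply: eq_dilation => [|z]; first by ring.
rewrite (dilB s2 s1).
have H (f1 f2 f3 e1 e2 : R) : e2 = f3 - k * f2 -> e1 = f2 - k * f1 ->
    (k - 2) * (f2 - f1) + (e2 - e1) = f3 - 3 * f2 + 2 * f1.
  by move=> -> ->; ring.
exact: (H _ _ _ _ _ (dil_tdil p (tdil (tdil u)) z) (dil_tdil p (tdil u) z)).
Qed.

Lemma dlam4_rescale l y : 0 < l -> dlam 4 F l y = dilation (k - 4)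
  (fun z => tdil (tdil (tdil (tdil u))) z - 6 * tdil (tdil (tdil u)) z
     + 11 * tdil (tdil u) z - 6 * tdil u z) l y.
Proof.
move=> l0; have F3 (s : R) (s0 : 0 < s) := dlam3_rescale y s0.
have t2 := smoothZ 3 s2; have t1 := smoothZ 2 s1.
rewrite (dlamS_dilation (smoothD (smoothB s3 t2) t1) F3 l0); apply: eq_dilation => [|z]; first by ring.
rewrite (dilD (smoothB s3 t2) t1) (dilB s3 t2) (dilZ 3 s2) (dilZ 2 s1).
have H (f1 f2 f3 f4 e1 e2 e3 : R) : e3 = f4 - k * f3 -> e2 = f3 - k * f2 -> e1 = f2 - k * f1 ->
    (k - 3) * (f3 - 3 * f2 + 2 * f1) + (e3 - 3 * e2 + 2 * e1) = f4 - 6 * f3 + 11 * f2 - 6 * f1.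
  by move=> -> -> ->; ring.
exact: (H _ _ _ _ _ _ _ (dil_tdil p (tdil (tdil (tdil u))) z) (dil_tdil p (tdil (tdil u)) z)
  (dil_tdil p (tdil u) z)).
Qed.

Lemma scaling_derivative_dlam (G : R -> 'rV[R]_n -> R) (q : R) h h' l y : 0 < l ->
  scaling_derivative p h h' ->
  (forall s, 0 < s -> G s y = (s `^ q) ^+ 2 * h (s *: y)) ->
  dlam 1 G l y = (l `^ q) ^+ 2 / l * (h' (l *: y) + 2 * (q - k) * h (l *: y)).
Proof.
move=> l0 [sh hE] GE.
have GE' (s : R) (s0 : 0 < s) : G s y = dilation (2 * q) h s y.
  by rewrite (GE s s0) /dilation powR_double.
rewrite (dlam1_dilation l0 sh GE') (powR_subn _ 1 l0) (powR_double _ l0) expr1 -hE.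
by move: (h _) (dil h _) => *; congr (_ * _); ring.
Qed.

Variables (l : R) (y : 'rV[R]_n).
Hypotheses (l0 : 0 < l) (y1 : enorm y = 1).

Lemma lap_rescale : lap (F l) y = l `^ k * lapr u (l *: y).
Proof.
rewrite /F rescale0 (lap_dilation k y l0 su) /lapr dotpp_scale (enorm1_dotpp y1).
by rewrite mulr1 mulrA.
Qed.

Lemma sph_lap_rescale (s : R) : 0 < s -> sph_lap (F s) y = s `^ k * ang u (s *: y).
Proof.
move=> s0; rewrite /F rescale0 (sph_lap_ang y1 (smooth_dilation k s0 su)).
exact: (ang_dilation k y s0 su).
Qed.

Lemma sph_grad_rescale (s : R) : 0 < s -> dotp (sph_grad (F s) y) (sph_grad (F s) y) =
  (s `^ k) ^+ 2 * carre u u (s *: y).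
Proof.
move=> s0; rewrite /F rescale0 (sph_grad_sqr _ y1).
exact: (carre_dilation k y s0 su).
Qed.

Lemma sph_grad_dlam1_rescale (s : R) : 0 < s ->
  dotp (sph_grad (dlam 1 F s) y) (sph_grad (dlam 1 F s) y) =
  (s `^ (k - 1)) ^+ 2 * carre (tdil u) (tdil u) (s *: y).
Proof.
move=> s0; have -> : dlam 1 F s = dilation (k - 1) (tdil u) s.
  by apply/funext => z; rewrite dlam1_rescale.
by rewrite (sph_grad_sqr _ y1); exact: (carre_dilation (k - 1) y s0 s1).
Qed.

Lemma dlam_sph_lap_rescale : dlam 1 (fun s z => sph_lap (F s) z ^+ 2) l y =
  (l `^ k) ^+ 2 / l * (2 * (ang u (l *: y) * ang (tdil u) (l *: y))).
Proof.
have sa := smooth_ang su.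
have GE (s : R) (s0 : 0 < s) : sph_lap (F s) y ^+ 2 = (s `^ k) ^+ 2 * (ang u (s *: y) * ang u (s *: y)).
  by rewrite sph_lap_rescale// exprMn -(expr2 (ang u _)).
rewrite (scaling_derivative_dlam l0 (scaling_derivativeM p sa sa) GE) (tdil_ang p su).
by move: (ang _ _) (ang _ _) => *; congr (_ * _); ring.
Qed.

Lemma dlam_sph_grad_rescale :
  dlam 1 (fun s z => dotp (sph_grad (F s) z) (sph_grad (F s) z)) l y =
  (l `^ k) ^+ 2 / l * (2 * carre u (tdil u) (l *: y)).
Proof.
rewrite (scaling_derivative_dlam l0 (scaling_derivative_carre p su su) sph_grad_rescale).
rewrite (carreC (tdil u) u).
by move: (carre _ _ _) (carre _ _ _) => *; congr (_ * _); ring.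
Qed.

Lemma dlam_sph_grad_dlam1_rescale :
  dlam 1 (fun s z => dotp (sph_grad (dlam 1 F s) z) (sph_grad (dlam 1 F s) z)) l y =
  (l `^ (k - 1)) ^+ 2 / l *
  (2 * carre (tdil u) (tdil (tdil u)) (l *: y) - 2 * carre (tdil u) (tdil u) (l *: y)).
Proof.
rewrite (scaling_derivative_dlam l0 (scaling_derivative_carre p s1 s1) sph_grad_dlam1_rescale).
rewrite (carreC (tdil (tdil u)) (tdil u)).
by move: (carre _ _ _) (carre _ _ _) => *; congr (_ * _); ring.
Qed.

Lemma E_boundary_correction :
  E_boundary p 0 u l y
  - \sum_(i < 3) \sum_(j < 3) correction i j * l ^+ (i + j)%N * dlam i F l y * dlam j F l y
  = l `^ (2 * k) * boundary_density p al u (l *: y).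
Proof.
have e0 : F l y = l `^ k * u (l *: y) by rewrite /F rescale0.
rewrite !big_ord_recr !big_ord0 /= /correction /= !mul0r !add0r.
rewrite (powR_double _ l0).
exact: (E_boundary_algebra _ _ _ _ _ _ _ _ (lt0r_neq0 l0) (powR_subn k 1 l0) (powR_subn k 2 l0) (powR_subn k 3 l0)
  (powR_subn k 4 l0) e0 (dlam1_rescale y l0) (dlam2_rescale y l0) (dlam3_rescale y l0) (dlam4_rescale y l0)
  lap_rescale (sph_lap_rescale l0) dlam_sph_lap_rescale (sph_grad_rescale l0) dlam_sph_grad_rescale
  (sph_grad_dlam1_rescale l0) dlam_sph_grad_dlam1_rescale).
Qed.

End radial_derivatives.
End boundary_term.

(** * The derivative of the corrected functional *)

Section monotonicity_formula.
Variables (R : realType) (n : nat) (p : R).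
Hypothesis n0 : (0 < n)%N.
Hypothesis p1 : 1 < p.
Implicit Types (f g h u v : 'rV[R]_n -> R) (x y : 'rV[R]_n) (a c l : R).
Local Notation k := (kexp p).
Local Notation N := (n%:R : R).
Local Notation tdil := (@tdil R n p).
Variable al : R.

Lemma triharmonic_shift x u : triharmonic_solution p u ->
  triharmonic_solution p (fun y => u (x + y)).
Proof.
have H (m : nat) f : iter m (fun g z => - lap g z) (fun y => f (x + y)) =
    fun y => iter m (fun g z => - lap g z) f (x + y).
  elim: m => [|m ih]; first exact: erefl.
  by rewrite iterS ih; apply/funext => y; rewrite (lap_shift x (iter m (fun g z => - lap g z) f)) iterS.
by move=> pde y; rewrite H; exact: pde.
Qed.

Lemma gdot_shift x f : gdot (fun y => f (x + y)) (fun y => f (x + y)) = fun y => gdot f f (x + y).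
Proof. by apply/funext => y; apply: eq_bigr => i _; rewrite (partial_shift i x f). Qed.

Lemma rescale_shift x u : rescale p x u = rescale p 0 (fun y => u (x + y)).
Proof. by apply/funext => l; apply/funext => y; rewrite /rescale add0r. Qed.

Lemma power_triharmonic u : smooth u -> triharmonic_solution p u ->
  forall y, `|u y| `^ (p + 1) = - (u y * lap (lap (lap u)) y).
Proof.
move=> su pde y; rewrite (triharmonicE su pde y) mulrN opprK.
have [->|uy0] := eqVneq (u y) 0.
  by rewrite normr0 mul0r powR0// gt_eqF// addr_gt0// (lt_trans _ p1).
have P : 0 < `|u y| by rewrite normr_gt0.
have -> : p + 1 = p - 1 + 2%:R by ring.
rewrite (powR_addn _ 2 P) real_normK ?num_real//.
by move: (_ `^ _) => ?; ring.
Qed.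

Lemma volume_term x u l : 0 < l -> smooth u -> triharmonic_solution p u ->
  vol_integral (eball x l) (fun y => 2^-1 * dotp (grad (lap u) y) (grad (lap u) y))
  - (p + 1)^-1 * vol_integral (eball x l) (fun y => `|u y| `^ (p + 1))
  = ball_integral l (energy_density p (fun y => u (x + y))).
Proof.
move=> l0 su pde; have s1 := smooth_lap su; have s3 := smooth_lap (smooth_lap s1).
have sg := smoothZ 2^-1 (smooth_gdot s1 s1).
have sq := smoothZ (-1) (smoothM su s3).
have -> : (fun y => 2^-1 * dotp (grad (lap u) y) (grad (lap u) y)) =
    fun y => 2^-1 * gdot (lap u) (lap u) y.
  by apply/funext => y; rewrite (dotp_grad (lap u) (lap u)).
have -> : (fun y => `|u y| `^ (p + 1)) = fun y => -1 * (u y * lap (lap (lap u)) y).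
  by apply/funext => y; rewrite (power_triharmonic su pde) mulN1r.
rewrite (vol_integral_shift x l0 (mlb_smooth sg)) (vol_integral_shift x l0 (mlb_smooth sq)).
have sg' := smooth_shift x sg; have sq' := smooth_shift x sq.
rewrite -(ball_integralZ l (p + 1)^-1 (mlb_smooth sq')).
rewrite -(ball_integralB l (mlb_smooth sg') (mlb_smooth (smoothZ (p + 1)^-1 sq'))).
have e1 := lap_shift x u; have e2 := etrans (congr1 (@lap R n) e1) (lap_shift x (lap u)).
have e3 := etrans (congr1 (@lap R n) e2) (lap_shift x (lap (lap u))).
have eg := etrans (congr1 (fun f => gdot f f) e1) (gdot_shift x (lap u)).
have H (a a' b c c' q : R) : a' = a -> c' = c ->
    2^-1 * a - q * (-1 * (b * c)) = 2^-1 * a' + q * (b * c') by move=> -> ->; ring.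
congr (ball_integral l _); apply/funext => y.
exact: (H _ _ _ _ _ _ (congr1 (@^~ y) eg) (congr1 (@^~ y) e3)).
Qed.

Lemma smooth_dlam_rescale (i : 'I_3) u l : 0 < l -> smooth u -> smooth (dlam i (rescale p 0 u) l).
Proof.
move=> l0 su; have s1 := smooth_tdil p su; have s2 := smooth_tdil p s1.
case: i => -[|[|[|//]]] /= _.
- rewrite [dlam 0 _ _](_ : _ = dilation k u l); first exact: smooth_dilation.
  by rewrite -rescale0.
- rewrite [dlam 1 _ _](_ : _ = dilation (k - 1) (tdil u) l); first exact: smooth_dilation.
  by apply/funext => y; exact: dlam1_rescale.
- rewrite [dlam 2 _ _](_ : _ = dilation (k - 2) (fun z => tdil (tdil u) z - tdil u z) l).
    by apply: smooth_dilation => //; exact: smoothB.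
  by apply/funext => y; exact: dlam2_rescale.
Qed.

Lemma sphere_integral1 g : sphere_integral 0 1 g = sphere_mean g 1.
Proof. by rewrite sphere_integral_mean expr1n mul1r. Qed.

Lemma boundary_term u l : 0 < l -> smooth u ->
  sphere_integral 0 1 (E_boundary p 0 u l)
  - sphere_integral 0 1 (fun y => \sum_(i < 3) \sum_(j < 3) correction n p al i j * l ^+ (i + j)%N
      * dlam i (rescale p 0 u) l y * dlam j (rescale p 0 u) l y)
  = l `^ (2 * k) * sphere_mean (boundary_density p al u) l.
Proof.
move=> l0 su; set B := fun y : 'rV[R]_n => \sum_(i < 3) _.
have sB : smooth B.
  apply: smooth_sum => i; apply: smooth_sum => j.
  have si := smooth_dlam_rescale i l0 su; have sj := smooth_dlam_rescale j l0 su.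
  exact: smoothM (smoothZ _ si) sj.
have [sb _] := boundary_density_derivative p al su.
have sD := smooth_dilation (2 * k) l0 sb.
have mb : mloc_bounded (fun y => boundary_density p al u (l *: y)).
  have -> : (fun y => boundary_density p al u (l *: y)) = fun y => boundary_density p al u (0 + l *: y).
    by apply/funext => y; exact: (congr1 (boundary_density p al u) (esym (add0r (l *: y)))).
  exact: (mlb_affine 0 l (mlb_smooth sb)).
(* The identity is available only on the unit sphere. That suffices to exchange [E_boundary] for a
   smooth integrand before the integral is split. *)
have E y : enorm y = 1 -> E_boundary p 0 u l y = dilation (2 * k) (boundary_density p al u) l y + B y.
  by move=> y1; have /eqP := E_boundary_correction p al su l0 y1; rewrite subr_eq => /eqP.
rewrite (eq_sphere_integral n0 ltr01 (mlb_smooth (smoothD sD sB)) E) !sphere_integral1.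
rewrite (sphere_meanD ler01 (mlb_smooth sD) (mlb_smooth sB)) addrK.
exact: (etrans (sphere_meanZ (l `^ (2 * k)) ler01 mb)
  (congr1 (fun t => l `^ (2 * k) * t) (esym (sphere_integral1 (fun y => boundary_density p al u (l *: y)))))).
Qed.

Lemma exponent_energy : 6 * ((p + 1) / (p - 1)) = 2 * k + 6.
Proof. by rewrite /kexp; field; rewrite subr_eq0 gt_eqF. Qed.

Lemma Ec_functionalE x u l : 0 < l -> smooth u -> triharmonic_solution p u ->
  let v := fun y => u (x + y) in
  Ec_functional p (correction n p al) l x u =
  l `^ (2 * k + 6 - N) * ball_integral l (energy_density p v)
  + l `^ (2 * k) * sphere_mean (boundary_density p al v) l.
Proof.
move=> l0 su pde v; have sv := smooth_shift x su.
rewrite /Ec_functional /E_functional (volume_term x l0 su pde) exponent_energy.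
have eB : E_boundary p x u l = E_boundary p 0 v l by rewrite /E_boundary (rescale_shift x u).
rewrite eB (rescale_shift x u).
have H (a b c d : R) : b - c = d -> a + b - c = a + d by move=> <-; rewrite addrA.
exact: (H _ _ _ _ (boundary_term l0 sv)).
Qed.

Lemma is_derive_Ec x u l : 0 < l -> smooth u -> triharmonic_solution p u ->
  let v := fun y => u (x + y) in
  is_derive l 1 (fun s => Ec_functional p (correction n p al) s x u)
   (l `^ (2 * k - 1) * (sphere_mean (pohozaev_flux p v) l +
      sphere_mean (fun y => 2 * k * boundary_density p al v y + dil (boundary_density p al v) y) l)).
Proof.
move=> l0 su pde v; have sv : smooth v := smooth_shift x su.
have pv : triharmonic_solution p v := triharmonic_shift x pde.
have [sb _] := boundary_density_derivative p al sv; have sdb := smooth_dil sb.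
have d1 := is_derive_energy n0 p1 l0 sv pv.
have d2 := is_derive_mulr (is_derive_powR (2 * k) l0) (is_derive_sphere_mean n0 l0 sb).
apply: (@is_derive_eq _ _ _ _ _ _ _ _ (near_eq_is_derive _ (is_derive_addr d1 d2))).
  by apply: filterS (lt_nbhsr l0) => s s0; rewrite (Ec_functionalE x s0 su pde).
rewrite (sphere_meanD (ltW l0) (mlb_smooth (smoothZ (2 * k) sb)) (mlb_smooth sdb)).
rewrite (sphere_meanZ (2 * k) (ltW l0) (mlb_smooth sb)) (powR_subn _ 1 l0) expr1.
by move: (sphere_mean _ _) (sphere_mean _ _) (sphere_mean _ _) => *; field; rewrite gt_eqF.
Qed.

(** On the sphere of radius [l] the operator l times the radial derivative is D, so the integrand is
    F_1^2; the factor l^(n-1) of the surface measure accounts for the change of exponent. *)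
Lemma sphere_integral_radial x u l : 0 < l -> smooth u ->
  l `^ (6 * ((p + 1) / (p - 1)) - 6 - N) *
    sphere_integral x l (fun y => (6 / (p - 1) * u y + l * radial_derivative x u y) ^+ 2) =
  l `^ (2 * k - 1) * sphere_mean (fun y => tdil (fun z => u (x + z)) y ^+ 2) l.
Proof.
move=> l0 su; have sv := smooth_shift x su; have s1 := smooth_tdil p sv.
have -> : sphere_integral x l (fun y => (6 / (p - 1) * u y + l * radial_derivative x u y) ^+ 2) =
    sphere_integral 0 l (fun y => (6 / (p - 1) * u (x + y) + l * radial_derivative x u (x + y)) ^+ 2).
  by rewrite /sphere_integral; congr (_ * (_ * vol_integral _ _)); apply/funext => y; rewrite add0r.
have E y : enorm y = l -> (6 / (p - 1) * u (x + y) + l * radial_derivative x u (x + y)) ^+ 2 =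
    tdil (fun z => u (x + z)) y ^+ 2.
  move=> yl; congr (_ ^+ 2); rewrite (tdilE p (fun z => u (x + z)) y); congr (_ + _).
  rewrite /radial_derivative (addrC x) addrK yl.
  rewrite (derive_sum_partial _ (smooth_differentiable _ su)) mulr_sumr.
  apply: eq_bigr => i _; rewrite (partial_shift i x u) mxE (addrC y).
  by rewrite mulrA mulrA divff ?gt_eqF// mul1r.
rewrite (eq_sphere_integral n0 l0 (mlb_smooth (smoothX 2 s1)) E) sphere_integral_mean mulrA; congr (_ * _).
have -> : 6 * ((p + 1) / (p - 1)) - 6 - N = 2 * k - N by rewrite exponent_energy; ring.
rewrite (powR_subn _ 1 l0) (powR_subn _ n l0) expr1.
rewrite -(prednK n0) exprS /=.
by move: (l `^ _) => ?; field; rewrite gt_eqF//= expf_neq0// gt_eqF.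
Qed.

End monotonicity_formula.

(** * Positivity of the coefficients *)

Section coefficients.
Variables (R : realType) (n : nat) (p : R).
Local Notation k := (kexp p).
Local Notation N := (n%:R : R).
Hypothesis hn : (7 <= n)%N.
Hypothesis hp : (N + 6) / (N - 6) < p.
Hypothesis hpm : (p%:E < p_m R n)%E.

Let hN : 7 <= N. Proof. by rewrite (ler_nat R 7). Qed.

Lemma supercritical_gt1 : 1 < p.
Proof. by have := hN; move: N hp => M pM M7; apply: lt_trans pM; rewrite ltr_pdivlMr; lra. Qed.

Lemma kexp_gt0 : 0 < k.
Proof. by rewrite divr_gt0// subr_gt0 supercritical_gt1. Qed.

Let kp : k * (p - 1) = 6.
Proof. by rewrite /kexp divfK// subr_eq0 gt_eqF// supercritical_gt1. Qed.

Lemma kexp_lt : 2 * k < N - 6.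
Proof.
have N7 := hN.
have := hp; rewrite ltr_pdivrMr; last by lra.
by have := kexp_gt0; have := supercritical_gt1; have := kp; move: k => K e p1 K0 h; nra.
Qed.

(** With [s] the square root in [p_m], one has p_m - 1 = 60 / (5 n - 30 - s), so k (p - 1) = 6 gives
    10 k > 5 n - 30 - s. At equality 10 k (n - 6 - k) is exactly n^2 - 24 n + 71, and k (n - 6 - k)
    increases in k as long as 2 k < n - 6. *)
Lemma kexp_subcritical_bound : (30 < n)%N ->
  N ^+ 2 - 24 * N + 71 < 10 * (k * (N - 6 - k)).
Proof.
have N7 := hN.
move=> n30; have N31 : 31 <= N by rewrite (ler_nat R 31).
have := hpm; rewrite /p_m leqNgt n30 /= lte_fin.
set s := Num.sqrt _ => ps.
have s0 : 0 <= s by exact: sqrtr_ge0.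
have s2 : s ^+ 2 = 15 * N ^+ 2 - 60 * N + 190 by rewrite sqr_sqrtr//; nra.
have sN : s < 5 * N - 30.
  rewrite -(@ltr_pXn2r _ 2) ?nnegrE//; last by lra.
  by rewrite s2; nra.
move: ps; rewrite ltr_pdivlMr; last by lra.
move=> ps; have k10 : 5 * N - 30 - s < 10 * k.
  have := kexp_gt0; have := supercritical_gt1; have := kp; move: ps.
  by move: k => K ps e p1 K0; nra.
have := kexp_lt; move: k k10 => K k10 k2; nra.
Qed.

(** For n <= 30 the exponent p may be arbitrarily large, so X may be arbitrarily small. Then q_2
    requires al >= n^2 - 24 n + 68 and q_1 requires al^2 < 96 (n - 2) (n - 4). For al = c (n - 3)
    the first is tightest at n = 30, where c >= 248/27, the second at n = 7, where c^2 < 90; 47/5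
    lies between. At n = 31 the two would ask for al >= 285 and al^2 < 75168 and are incompatible
    for small X. *)
Definition weight : R := if (n <= 30)%N then 47 / 5 * (N - 3) else 0.

Let X0 : 0 < k * (N - 6 - k).
Proof. by have := kexp_gt0; have := kexp_lt; have := hN; move: k N => K M; nra. Qed.

Lemma coef_sq1_gt0 : 0 < coef_sq1 n p weight.
Proof.
have N7 := hN.
have -> : coef_sq1 n p weight = 3 * (k * (N - 6 - k)) ^+ 2 + (12 * N - 32) * (k * (N - 6 - k))
    + (8 * (N - 2) * (N - 4) - weight ^+ 2 / 12).
  by rewrite /coef_sq1 /a11; field.
have h : 0 <= (12 * N - 32) * (k * (N - 6 - k)) by apply: mulr_ge0; [lra|exact: ltW].
have h2 : 0 <= 3 * (k * (N - 6 - k)) ^+ 2 by rewrite mulr_ge0// sqr_ge0.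
apply: ltr_wpDl; first exact: addr_ge0.
by rewrite /weight; case: ifP => _; nra.
Qed.

Lemma coef_sq2_ge0 : 0 <= coef_sq2 n p weight.
Proof.
have N7 := hN.
have -> : coef_sq2 n p weight = - N ^+ 2 + 24 * N - 68 + 10 * (k * (N - 6 - k)) + weight.
  by rewrite /coef_sq2 /a22 /a13; ring.
rewrite /weight; case: (leqP n 30) => n30; last first.
  by have := kexp_subcritical_bound n30; move: (k * _) => X; lra.
have : N <= 30 by rewrite (ler_nat R n 30).
by have := X0; move: (k * _) => X Xp N30; nra.
Qed.

Lemma coef_carre1_ge : (b12 n p / 4) ^+ 2 <= coef_carre1 n p weight.
Proof.
have N7 := hN.
(* [a] is the distance of k from its critical value (n - 6) / 2, in terms of which b12 / 4 = - (a +
   4) and X = (n - 6)^2 / 4 - a^2. *)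
rewrite -subr_ge0; set a := (N - 6) / 2 - k.
have -> : coef_carre1 n p weight - (b12 n p / 4) ^+ 2 =
    3 / 2 * (N - 2) ^+ 2 - 7 * a ^+ 2 - 8 * a - 16 + weight / 3.
  by rewrite /coef_carre1 /b11 /b12 /a; field.
have a1 : a < (N - 6) / 2 by rewrite /a; have := kexp_gt0; lra.
have a0 : 0 < a by rewrite /a; have := kexp_lt; lra.
rewrite /weight; case: (leqP n 30) => n30; last first.
  have N31 : 31 <= N by rewrite (ler_nat R 31).
  (* The bound a < (n - 6) / 2 would only give 7 a^2 < 7/4 (n - 6)^2, too weak against 3/2 (n - 2)^2
     for large n. The condition p < p_m improves it to 10 a^2 < 3/2 n^2 - 6 n + 19. *)
  have := kexp_subcritical_bound n30.
  have -> : k * (N - 6 - k) = (N - 6) ^+ 2 / 4 - a ^+ 2 by rewrite /a; field.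
  by move: a a0 a1 => a a0 a1; nra.
have : N <= 30 by rewrite (ler_nat R n 30).
by move: a a0 a1 => a a0 a1 N30; nra.
Qed.

End coefficients.

Theorem theorem2p2 (R : realType) (n : nat) (p : R)
    (hn : (7 <= n)%N)
    (hp : (n%:R + 6) / (n%:R - 6) < p)
    (hpm : (p%:E < p_m R n)%E) :
  exists (c : 'I_3 -> 'I_3 -> R) (C : R), 0 < C /\
    forall (u : 'rV[R]_n -> R) (x : 'rV[R]_n),
      smooth u -> triharmonic_solution p u ->
      let Ec := fun l : R => Ec_functional p c l x u in
      {in `]0, +oo[ &, {homo Ec : a b / a <= b}} /\
      (forall l : R, 0 < l ->
        derivable Ec l 1 /\
        C * l `^ (6 * ((p + 1) / (p - 1)) - 6 - n%:R)
          * sphere_integral x l (fun y =>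
              (6 / (p - 1) * u y + l * radial_derivative x u y) ^+ 2)
        <= derive1 Ec l).
Proof.
have n0 : (0 < n)%N by exact: leq_trans hn.
have p1 := supercritical_gt1 hn hp.
exists (correction n p (weight R n)), (coef_sq1 n p (weight R n)).
have C0 := coef_sq1_gt0 hn hp; split=> // u x su pde Ec.
have sv := smooth_shift x su.
have dE l (l0 : 0 < l) := is_derive_Ec n0 p1 (weight R n) x l0 su pde.
have bound l : 0 < l -> derivable Ec l 1 /\
    coef_sq1 n p (weight R n) * l `^ (6 * ((p + 1) / (p - 1)) - 6 - n%:R)
      * sphere_integral x l (fun y => (6 / (p - 1) * u y + l * radial_derivative x u y) ^+ 2)
    <= derive1 Ec l.
  move=> l0; have [dd de] := dE l l0; split; first exact: dd.
  rewrite derive1E de -mulrA (sphere_integral_radial n0 p1 x l0 su) mulrCA.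
  apply: ler_wpM2l; first exact: powR_ge0.
  exact: (sphere_mean_monotonicity n0 l0 sv (coef_sq2_ge0 hn hp hpm) (coef_carre1_ge hn hp hpm)).
split=> //.
have dE0 l : 0 < l -> 0 <= derive1 Ec l.
  move=> l0; have [_ H] := bound l l0; apply: le_trans H.
  rewrite -mulrA (sphere_integral_radial n0 p1 x l0 su) mulr_ge0 ?(ltW C0)//.
  apply: mulr_ge0; first exact: powR_ge0.
  by apply: sphere_mean_ge0 => y; exact: sqr_ge0.
move=> a b; rewrite !in_itv /= !andbT => a0 b0 ab.
have pos l : l \in `[a, b] -> 0 < l by rewrite in_itv => /andP[al _]; exact: lt_le_trans al.
have posoo l : l \in `]a, b[ -> 0 < l.
  by move=> lab; apply: pos; exact: subset_itv_oo_cc lab.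
apply: (@ger0_derive1_ndecr R Ec a b) => // [l /posoo /bound[]//|l /posoo /dE0//|].
apply: derivable_within_continuous => l /pos /bound[]//.
Qed.
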